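(* Let $\alpha_-,\alpha_+>0$ and $\beta_-,\beta_+\in\mathbb R$, and let $A_0$ be the operator $$A_0(u_-,u_+)=\big(\alpha_-u_-'''+\beta_-u_-',\ \alpha_+u_+'''+\beta_+u_+'\big),\qquad D(A_0)=C_c^\infty(-\infty,0)\oplus C_c^\infty(0,+\infty),$$ in $L^2(-\infty,0)\oplus L^2(0,+\infty)$. For $Z\in\mathbb R\setminus\{0\}$ let $$L_Z=\begin{pmatrix}1&0&0\\ Z&1&0\\ \frac{Z^2}{2}&Z&1\end{pmatrix},$$ and let $A_Z$ be the operator acting by the same differential expression as $A_0$ on the domain of all $u=(u_-,u_+)\in H^3(-\infty,0)\oplus H^3(0,+\infty)$ with $L_Z\,(u_-(0-),u_-'(0-),u_-''(0-))^T=(u_+(0+),u_+'(0+),u_+''(0+))^T$, that is, $$D(A_Z)=\Big\{u:\ u_-(0-)=u_+(0+),\ u_+'(0+)-u_-'(0-)=Zu_-(0-),\ \tfrac{Z^2}{2}u_-(0-)+Zu_-'(0-)=u_+''(0+)-u_-''(0-)\Big\}.$$ Then $(A_Z,D(A_Z))_{Z\in\mathbb R\setminus\{0\}}$ is a family of skew-self-adjoint extensions of $(A_0,D(A_0))$ (i.e. $A_Z^*=-A_Z$) provided $\alpha_-=\alpha_+$ and $\beta_-=\beta_+$, and these two equalities are also necessary for skew-self-adjointness. Moreover, each element of $D(A_Z)$ can be seen as an element of $H^1(\mathbb R)$.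
   Context: Here $u(0\mp)$, $u'(0\mp)$, $u''(0\mp)$ denote one-sided boundary values at the vertex $0$. A pair $(u_-,u_+)$ is identified with the function on $\mathbb R$ equal to $u_-$ on $(-\infty,0)$ and $u_+$ on $(0,+\infty)$. The inner product on $L^2(-\infty,0)\oplus L^2(0,+\infty)$ is $\langle u,v\rangle=\int_{-\infty}^0u_-\overline{v_-}\,dx+\int_0^\infty u_+\overline{v_+}\,dx$. *)

(* Defs.v *)
From HB Require Import structures.
From mathcomp Require Import all_boot all_order all_algebra.
From mathcomp Require Import complex.
From mathcomp Require Import all_classical all_reals all_analysis.
Import Order.TTheory GRing.Theory Num.Theory.
Import numFieldNormedType.Exports.

Set Implicit Arguments.
Unset Strict Implicit.
Unset Printing Implicit Defensive.

Local Open Scope classical_set_scope.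
Local Open Scope ring_scope.
Local Open Scope complex_scope.

Section ComplexFunctions.
Variable R : realType.
Implicit Types (I : set R) (f g u : R -> R[i]).

Definition re f : R -> R := fun x => complex.Re (f x).
Definition im f : R -> R := fun x => complex.Im (f x).

Definition cintegral I f : R[i] :=
  (\int[lebesgue_measure]_(x in I) re f x)%R
    +i* (\int[lebesgue_measure]_(x in I) im f x)%R.

Definition cderiv (n : nat) f : R -> R[i] :=
  fun x => derive1n n (re f) x +i* derive1n n (im f) x.

(* Elements of C_c^oo(I), I open, are represented by their extension by zero
   to the whole line. *)
Definition smooth f : Prop :=
  forall (n : nat) (x : R),
    derivable (derive1n n (re f)) x 1 /\ derivable (derive1n n (im f)) x 1.

Definition tsupport f : set R := closure [set x | f x != 0].

Definition test_function I f : Prop :=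
  [/\ smooth f, compact (tsupport f) & tsupport f `<=` I].

(* Functions on I are represented by functions on R of which only the
   values on I matter, and elements of L^2(I) by functions up to [aeq I]. *)
Definition aeq I f g : Prop := f = g %[ae lebesgue_measure in I].

Definition L2 I f : Prop :=
  [/\ measurable_fun I (re f), measurable_fun I (im f) &
      (\int[lebesgue_measure]_(x in I) ((re f x) ^+ 2 + (im f x) ^+ 2)%:E
         < +oo)%E].

Definition weak_derivative I (n : nat) u g : Prop :=
  forall phi, test_function I phi ->
    cintegral I (fun x => u x * cderiv n phi x) =
    (-1) ^+ n * cintegral I (fun x => g x * phi x).

Definition sobolev I (k : nat) u : Prop :=
  L2 I u /\
  forall j : nat, (j <= k)%N -> exists2 g, L2 I g & weak_derivative I j u g.

(* The weak derivative of order n as an element of L^2(I), unique up to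
   [aeq I]; the zero function if there is none. *)
Definition wderiv I (n : nat) u : R -> R[i] :=
  xget (fun=> 0 : R[i]) [set g : R -> R[i] | L2 I g /\ weak_derivative I n u g].

(* The limit along F of the continuous representative of u on I; the value 0
   is taken if there is no such representative or no such limit. *)
Definition boundary_value I (F : set_system R) u : R[i] :=
  xget (0 : R[i]) [set a : R[i] | exists g,
    [/\ aeq I u g,
        {within I, continuous (re g)} /\ {within I, continuous (im g)},
        re g x @[x --> F] --> complex.Re a &
        im g x @[x --> F] --> complex.Im a]].

End ComplexFunctions.

Section Operators.
Variable R : realType.

Definition Iminus : set R := `]-oo, 0[%classic.
Definition Iplus : set R := `]0, +oo[%classic.

(* Pairs (u_-, u_+), with u_- considered on ]-oo, 0[ and u_+ on ]0, +oo[. *)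
Definition fpair : Type := ((R -> R[i]) * (R -> R[i]))%type.
Implicit Types (u v w f : fpair).

Definition L2pair u : Prop := L2 Iminus u.1 /\ L2 Iplus u.2.

Definition aeqpair u v : Prop := aeq Iminus u.1 v.1 /\ aeq Iplus u.2 v.2.

Definition inner u v : R[i] :=
  cintegral Iminus (fun x => u.1 x * (v.1 x)^*) +
  cintegral Iplus (fun x => u.2 x * (v.2 x)^*).

Definition L2norm u : R := Num.sqrt (complex.Re (inner u u)).

(* Unbounded operators in L^2(-oo, 0) (+) L^2(0, +oo) are given by their graph:
   [A u f] means that the class of u is in D(A) and is sent to that of f. *)
Definition operator : Type := fpair -> fpair -> Prop.
Implicit Types A B : operator.

Definition domain A : set fpair := [set u | exists f, A u f].

Definition extends B A : Prop := forall u f, A u f -> B u f.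

Definition densely_defined A : Prop :=
  forall u, L2pair u -> forall e : R, 0 < e ->
    exists2 v, domain A v & L2norm (u - v) < e.

Definition adjoint A : operator := fun v w =>
  [/\ L2pair v, L2pair w & forall u f, A u f -> inner f v = inner u w].

Definition opp_operator A : operator := fun u f => A u (- f).

Definition skew_self_adjoint A : Prop :=
  densely_defined A /\ forall v w, adjoint A v w <-> opp_operator A v w.

Variables (alpham alphap betam betap : R).

(* [D n u] stands for the derivative of order n, classical or weak. *)
Definition third_order_expr (Dm Dp : nat -> (R -> R[i]) -> R -> R[i]) u : fpair :=
  (fun x => alpham%:C * Dm 3 u.1 x + betam%:C * Dm 1 u.1 x,
   fun x => alphap%:C * Dp 3 u.2 x + betap%:C * Dp 1 u.2 x).

Definition A0 : operator := fun u f =>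
  [/\ L2pair u, L2pair f & exists phi : fpair,
    [/\ test_function Iminus phi.1, test_function Iplus phi.2,
        aeqpair u phi & aeqpair f (third_order_expr (@cderiv R) (@cderiv R) phi)]].

Definition trace_minus (j : nat) u : R[i] :=
  boundary_value Iminus 0^'- (wderiv Iminus j u.1).
Definition trace_plus (j : nat) u : R[i] :=
  boundary_value Iplus 0^'+ (wderiv Iplus j u.2).

Definition H3pair u : Prop := sobolev Iminus 3 u.1 /\ sobolev Iplus 3 u.2.

Definition LZ (Z : R) : 'M[R[i]]_3 :=
  \matrix_(i, j) (nth 0 (nth [::] [:: [:: 1; 0; 0];
                                      [:: Z; 1; 0];
                                      [:: Z ^+ 2 / 2; Z; 1]] i) j)%:C.

Definition domAZ (Z : R) : set fpair := [set u |
  H3pair u /\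
  LZ Z *m (\col_(j < 3) trace_minus j u) = \col_(j < 3) trace_plus j u].

Definition AZ (Z : R) : operator := fun u f =>
  [/\ domAZ Z u, L2pair f & aeqpair f (third_order_expr (wderiv Iminus) (wderiv Iplus) u)].

(* The value at the single point 0 is immaterial. *)
Definition join_halves u : R -> R[i] := fun x => if x < 0 then u.1 x else u.2 x.

End Operators.

(* Main.v *)
(** Green's formula gives, for [u] and [v] in H^3 on both sides of the vertex,
  <A u, v> + <u, A v> = B_-(u, v) - B_+(u, v), where
  B(u, v) = alpha (u'' v - u' v' + u v'') + beta u v is evaluated at 0.  The
  matrix L_Z preserves this form as soon as both sides have the same
  coefficients, so that -A_Z is contained in the adjoint.  Conversely, if [v] is
  mapped to [w] by the adjoint, then alpha v''' + beta v' = - w weakly on each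
  half-line, and integrating three times gives a C^2 representative of [v].
  Repeated integration by parts against a quintic Hermite polynomial on the
  window [x, x + 1] expresses v'(x) by integrals of [v] and [w], and v''(x) by
  integrals of [v] and v''', so that all derivatives are square integrable.
  Green's formula against functions with arbitrary traces then forces the
  transmission conditions.  Necessity is Green's formula for [u = v] with
  suitable traces, and density follows by truncating away from 0 and taking
  iterated Steklov means.  As A_Z has real coefficients, all this can be done
  for real-valued functions. *)

Require Import Defs.
From HB Require Import structures.
From mathcomp Require Import all_boot all_order all_algebra.
From mathcomp Require Import complex.
From mathcomp Require Import all_classical all_reals all_analysis.
From mathcomp Require Import measurable_realfun.
From mathcomp Require Import ring lra.
Import Order.TTheory GRing.Theory Num.Theory.
Import numFieldNormedType.Exports.
Local Open Scope classical_set_scope.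
Local Open Scope ring_scope.
Local Open Scope complex_scope.

Set Implicit Arguments.
Unset Strict Implicit.
Unset Printing Implicit Defensive.

(** * Locally integrable functions and their primitives *)

Section Primitives.
Variable R : realType.
Local Notation mu := (@lebesgue_measure R).
Implicit Types (f g h F G H : R -> R) (a b c x : R).

(** The obstacle in the regularity part is the lower-order term: alpha v''' = - w - beta v' puts
    v''' in L^2 only once v' is known to be there. The window polynomial used for v' therefore
    vanishes at both ends of the window, so that beta v' can be moved onto v as well; the order of
    the estimates is v', then v''' from the equation, then v''. Absolute continuity is taken in
    integrated form ([primitive]), for functions defined on the whole line although square
    integrability and the equation concern only a half-line. Traces at the vertex then become plain
    values at 0, and no calculus with one-sided derivatives is needed. The du Bois-Reymond lemma
    supplies such representatives from weak derivatives. The left half-line is reduced to the right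
    one by x -> -x, under which an expression with only odd-order derivatives changes sign. *)

Definition loc_integrable f := forall a b, mu.-integrable `[a, b] (EFin \o f).

(** Absolute continuity stated through increments: f is a derivative almost everywhere and need not
    be continuous, as is the case for the third derivative of an H^3 function. *)
Definition primitive F f := loc_integrable f /\
  forall a b, a <= b -> F b - F a = \int[mu]_(x in `[a, b]) f x.

Lemma loc_integrable_measurable f : loc_integrable f -> measurable_fun setT f.
Proof.
move=> lf; have -> : [set: R] = \bigcup_n `[- n%:R, n%:R]%classic.
  apply/esym/seteqP; split => // x _; have [n nx] := ltr_add_invr (ltr01 (R:=R)).
  exists (Num.truncn `|x|).+1 => //=; rewrite in_itv/= -ler_norml ltW//.
  exact: truncnS_gt.
apply/measurable_fun_bigcup => // n.
by apply/measurable_EFinP; apply: measurable_int (lf _ _).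
Qed.

Lemma continuous_loc_integrable f : continuous f -> loc_integrable f.
Proof.
move=> cf a b; apply: continuous_compact_integrable; first exact: segment_compact.
exact: continuous_subspaceT.
Qed.

Lemma loc_integrableD f g : loc_integrable f -> loc_integrable g ->
  loc_integrable (f \+ g).
Proof. by move=> lf lg a b; exact: (integrableD _ (lf a b) (lg a b)). Qed.

Lemma loc_integrableZ k f : loc_integrable f -> loc_integrable (fun x => k * f x).
Proof. by move=> lf a b; exact: (integrableZl _ k (lf a b)). Qed.

Lemma loc_integrableM f g : loc_integrable f -> continuous g ->
  loc_integrable (fun x => f x * g x).
Proof.
move=> lf cg a b.
have mg : measurable_fun `[a, b] g.
  by apply: measurable_funTS; exact: continuous_measurable_fun.
apply: (@integrableMl _ _ _ mu `[a, b]%classic _ (EFin \o f) g) => //.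
have := compact_bounded (continuous_compact (continuous_subspaceT cg)
  (@segment_compact R a b)).
case=> M [Mr HM]; exists M; split => // y My x abx.
by apply: HM => //; exists x.
Qed.

Lemma loc_integrable_norm f : loc_integrable f ->
  loc_integrable (fun x => `|f x|).
Proof. by move=> lf a b; exact: integrable_norm. Qed.

Lemma itv_integralD f a b c : loc_integrable f -> a <= b -> b <= c ->
  \int[mu]_(x in `[a, c]) f x =
  \int[mu]_(x in `[a, b]) f x + \int[mu]_(x in `[b, c]) f x.
Proof.
move=> lf ab bc; rewrite addrC; apply/eqP; rewrite -subr_eq; apply/eqP.
have bc_int : mu.-integrable `]b, c] (EFin \o f).
  by apply: integrableS (lf b c) => //; exact: subset_itv_oc_cc.
rewrite -[RHS]Rintegral_itv_obnd_cbnd//.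
have := @Rintegral_itvB R f (BLeft a) (BRight c) b (lf a c).
rewrite !bnd_simp => /(_ ab bc) <-.
by [].
Qed.

Lemma primitive_exists f : loc_integrable f -> exists F, primitive F f.
Proof.
move=> lf; exists (fun x => if 0 <= x then \int[mu]_(t in `[0, x]) f t
                   else - \int[mu]_(t in `[x, 0]) f t); split => // a b ab.
have [a0|a0] := leP 0 a.
  rewrite (le_trans a0 ab) (itv_integralD lf a0 ab); lra.
have [b0|b0] := leP 0 b.
  rewrite (itv_integralD lf (ltW a0) b0); lra.
rewrite (itv_integralD lf ab (ltW b0)); lra.
Qed.

Lemma primitive_continuous F f : primitive F f -> continuous F.
Proof.
move=> [lf Ff] x.
have xm : x - 1 < x + 1 by lra.
have := parameterized_integral_continuous (ltW xm) (lf (x - 1) (x + 1)).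
move=> /(continuous_within_itvP _ xm)[+ _ _] => /(_ x).
rewrite in_itv/= => /(_ ltac:(lra)) H.
pose G y := F (x - 1) + parameterized_integral mu (x - 1) y f.
have GF y : x - 1 <= y -> G y = F y.
  by move=> xy; rewrite /G /parameterized_integral -Ff// addrC subrK.
have cG : {for x, continuous G} by apply: cvgD => //; exact: cvg_cst.
rewrite /continuous_at -GF; last lra.
apply: cvg_trans cG; apply: near_eq_cvg; near=> y; apply: GF.
apply: ltW; near: y; apply: lt_nbhsr; lra.
Unshelve. all: by end_near. Qed.

Lemma primitive_lebesgue_pt F f x : primitive F f -> lebesgue_pt f x ->
  is_derive x 1 F (f x).
Proof.
move=> [lf Ff] lx.
have x1 : x < x + 1 by lra.
have := @FTC1_lebesgue_pt R f (BLeft (x - 1)) x (x + 1) x1 (lf _ _).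
move=> /(_ _ lx) H0.
have {H0} : derivable (fun y => \int[mu]_(t in `[x - 1, y]) f t) x 1 /\
   (fun y => \int[mu]_(t in `[x - 1, y]) f t)^`()%classic x = f x.
  apply: H0.
  by rewrite lt_def /= eqe lee_fin; apply/andP; split; [apply/eqP; lra|lra].
set G := (G in derivable G x 1) => -[dG eG].
have GF y : x - 1 <= y -> F y = F (x - 1) + G y.
  by move=> xy; rewrite /G -Ff// addrC subrK.
have nGF : {near x, (cst (F (x - 1)) + G : R -> R) =1 F}.
  near=> y; rewrite (GF y)//.
  apply: ltW; near: y; apply: lt_nbhsr; lra.
apply: near_eq_is_derive nGF _.
rewrite -[f x]add0r -eG derive1E.
by apply: is_deriveD; apply: derivableP.
Unshelve. all: by end_near. Qed.

Lemma primitive_derive F f x : primitive F f -> {for x, continuous f} ->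
  is_derive x 1 F (f x).
Proof.
move=> Ff cf; apply: primitive_lebesgue_pt => //.
have mf : measurable_fun setT f by apply: loc_integrable_measurable; case: Ff.
by apply: (@continuous_lebesgue_pt _ _ _ setT) => //; split => //; exact: openT.
Qed.

Lemma loc_integrable_locally f : loc_integrable f -> locally_integrable setT f.
Proof.
move=> lf; split; first exact: loc_integrable_measurable.
  exact: openT.
move=> K _ cK.
have mK : measurable K by exact: compact_measurable.
have [M [Mr HM]] := compact_bounded cK.
have KM : K `<=` `[- (M + 1), M + 1].
  move=> y Ky; rewrite /= in_itv/= -ler_norml.
  by apply: (HM (M + 1)) => //; lra.
have : mu.-integrable K (EFin \o f).
  exact: integrableS (lf (- (M + 1)) (M + 1)).
by move=> /integrableP[_]; exact.
Qed.

Lemma primitive_ae F f : primitive F f -> {ae mu, forall x, is_derive x 1 F (f x)}.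
Proof.
move=> Ff; have := Ff => -[/loc_integrable_locally/lebesgue_differentiation + _].
by apply: (filterS (F := almost_everywhere mu)) => x; exact: primitive_lebesgue_pt.
Qed.

Lemma primitiveC1 F f : (forall x, is_derive x 1 F (f x)) -> continuous f ->
  primitive F f.
Proof.
move=> dF cf; have lf := continuous_loc_integrable cf; split => // a b.
rewrite le_eqVlt => /predU1P[<-|ab].
  by rewrite set_itv1 Rintegral_set1 subrr.
have cF : continuous F.
  by move=> y; apply/differentiable_continuous/derivable1_diffP; case: (dF y).
rewrite /Rintegral (@continuous_FTC2 _ f F)//.
- exact: continuous_subspaceT.
- split => [y _||]; first by case: (dF y).
  + by apply: cvg_at_right_filter; exact: cF.
  + by apply: cvg_at_left_filter; exact: cF.
- by move=> y _; rewrite derive1E; case: (dF y).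
Qed.

Lemma primitiveD F f G g : primitive F f -> primitive G g ->
  primitive (F \+ G) (f \+ g).
Proof.
move=> [lf Ff] [lg Gg]; split; first exact: loc_integrableD.
move=> a b ab /=; rewrite RintegralD//.
rewrite -Ff// -Gg//; lra.
Qed.

Lemma primitiveZ k F f : primitive F f ->
  primitive (fun x => k * F x) (fun x => k * f x).
Proof.
move=> [lf Ff]; split; first exact: loc_integrableZ.
move=> a b ab /=; rewrite RintegralZl//.
rewrite -Ff//; lra.
Qed.

Lemma primitive_addc k F f : primitive F f -> primitive (fun x => F x + k) f.
Proof. by move=> [lf Ff]; split => // a b ab; rewrite -Ff//; lra. Qed.

Lemma primitive_ext F f G g : primitive F f -> F =1 G -> f =1 g -> primitive G g.
Proof. by move=> Ff /funext <- /funext <-. Qed.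

Lemma primitive_increment_le F f a b : primitive F f -> a <= b ->
  `|F b - F a| <= \int[mu]_(x in `[a, b]) `|f x|.
Proof. by move=> [lf Ff] ab; rewrite Ff//; apply: le_normr_Rintegral => //; exact: lf. Qed.

(* A function whose increments are dominated by squares of the increments of a
   continuous function is constant: halving the increment of M by the
   intermediate value theorem gains a factor 2 at each step. *)
Lemma square_increments_const H M a b : continuous (M : R -> R) ->
  {homo M : x y / x <= y} ->
  (forall x y, x <= y -> `|H y - H x| <= (M y - M x) ^+ 2) ->
  a <= b -> H a = H b.
Proof.
move=> cM hM HM ab.
have key n : forall x y, x <= y -> `|H y - H x| <= (M y - M x) ^+ 2 / 2 ^+ n.
  elim: n => [x y xy|n IH x y xy]; first by rewrite expr0 divr1; exact: HM.
  have := @IVT R M x y ((M x + M y) / 2) xy (continuous_subspaceT cM).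
  have Mxy := hM _ _ xy.
  have -> : Num.min (M x) (M y) = M x by apply/min_idPl.
  have -> : Num.max (M x) (M y) = M y by apply/max_idPr.
  case; first by lra.
  move=> c; rewrite in_itv/= => /andP[xc cy] Mc.
  have := IH _ _ xc; have := IH _ _ cy; rewrite Mc => H1 H2.
  have -> : H y - H x = (H y - H c) + (H c - H x) by lra.
  apply: le_trans (ler_normD _ _) _; apply: le_trans (lerD H1 H2) _.
  rewrite (exprS 2 n) le_eqVlt; apply/orP; left; apply/eqP.
  have : (2 : R) ^+ n != 0 by exact: expf_neq0.
  move: (2 ^+ n) => t t0; by field.
apply/eqP; rewrite eq_sym -subr_eq0 -normr_eq0 eq_le normr_ge0 andbT.
apply/ler_addgt0Pl => e e0; rewrite addr0.
set K := (M b - M a) ^+ 2.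
have K0 : 0 <= K by exact: sqr_ge0.
have [n nK] : exists n, K / e < n%:R by exists (Num.truncn (K / e)).+1; exact: truncnS_gt.
apply: le_trans (key n _ _ ab) _; rewrite -/K ler_pdivrMr ?exprn_gt0//.
rewrite mulrC -ler_pdivrMr//; apply: le_trans (ltW nK) _.
by rewrite -natrX ler_nat ltnW// ltn_expl.
Qed.

(** Let K be a primitive of f G + F g. The increment of F G - K over [x, y] is the integral of f (G
    y - G t) + (F x - F t) g. Both differences are at most the increment of M, a primitive of |f| +
    |g|, so the whole is at most the square of that increment, and [square_increments_const] shows
    that F G - K is constant. No Fubini argument is needed. *)
Lemma primitiveM F f G g : primitive F f -> primitive G g ->
  primitive (fun x => F x * G x) (fun x => f x * G x + F x * g x).
Proof.
move=> Ff Gg; have cF := primitive_continuous Ff; have cG := primitive_continuous Gg.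
have [lf eF] := Ff; have [lg eG] := Gg.
have lfG := loc_integrableM lf cG.
have lgF := loc_integrableM lg cF.
have lFg : loc_integrable (fun x => F x * g x).
  by rewrite (_ : (fun x => F x * g x) = fun x => g x * F x)//; apply/funext => x; rewrite mulrC.
have lh : loc_integrable (fun x => f x * G x + F x * g x) by exact: loc_integrableD.
have [K [_ eK]] := primitive_exists lh.
have lm : loc_integrable (fun x => `|f x| + `|g x|).
  by apply: loc_integrableD; exact: loc_integrable_norm.
have [M Mm] := primitive_exists lm; have cM := primitive_continuous Mm.
have [_ eM] := Mm.
split => // a b ab; rewrite -eK//.
suff : F a * G a - K a = F b * G b - K b by lra.
have M_mono : {homo M : x y / x <= y}.
  move=> x y xy; rewrite -subr_ge0 eM//; apply: Rintegral_ge0 => z _.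
  by rewrite addr_ge0.
apply: (@square_increments_const (fun x => F x * G x - K x) M a b) => // x y xy.
have Ef t : x <= t <= y -> `|F t - F x| <= M y - M x.
  move=> /andP[xt ty]; apply: le_trans (primitive_increment_le Ff xt) _.
  have : M t <= M y by exact: M_mono.
  suff : \int[mu]_(s in `[x, t]) `|f s| <= M t - M x by lra.
  rewrite eM//; apply: le_Rintegral => //.
  - exact: (loc_integrable_norm lf).
  - by move=> s _; rewrite lerDl.
have Eg t : x <= t <= y -> `|G y - G t| <= M y - M x.
  move=> /andP[xt ty]; apply: le_trans (primitive_increment_le Gg ty) _.
  have : M x <= M t by exact: M_mono.
  suff : \int[mu]_(s in `[t, y]) `|g s| <= M y - M t by lra.
  rewrite eM//; apply: le_Rintegral => //.
  - exact: (loc_integrable_norm lg).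
  - by move=> s _; rewrite lerDr.
(* From F y G y - F x G x = (F y - F x) G y + F x (G y - G x), with both increments written as
   integrals. *)
have -> : F y * G y - K y - (F x * G x - K x) =
    \int[mu]_(t in `[x, y]) (f t * (G y - G t) + (F x - F t) * g t).
  transitivity (\int[mu]_(t in `[x, y]) ((f t * G y + F x * g t)
                 - (f t * G t + F t * g t))); last first.
    by apply: eq_Rintegral => t _; lra.
  have lfGy : mu.-integrable `[x, y] (EFin \o (fun t => f t * G y)).
    by apply: (@loc_integrableM f (cst (G y))) => //; exact: cst_continuous.
  have lFxg : mu.-integrable `[x, y] (EFin \o (fun t => F x * g t)).
    exact: (loc_integrableZ (F x) lg).
  rewrite RintegralB//; last exact: (integrableD _ lfGy lFxg).
  rewrite -eK// RintegralD//.
  rewrite RintegralZr// RintegralZl// -eF// -eG//.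
  lra.
have lr : mu.-integrable `[x, y]
    (EFin \o (fun t => f t * (G y - G t) + (F x - F t) * g t)).
  have -> : (fun t => f t * (G y - G t) + (F x - F t) * g t) =
     ((fun t => f t * (G y - G t)) \+ (fun t => g t * (F x - F t))).
    by apply/funext => t /=; rewrite (mulrC (g t)).
  apply: loc_integrableD; apply: loc_integrableM => //.
  - by move=> t; apply: cvgB; [exact: cvg_cst|exact: cG].
  - by move=> t; apply: cvgB; [exact: cvg_cst|exact: cF].
apply: le_trans (le_normr_Rintegral _ lr) _ => //.
rewrite expr2 [X in _ <= X * _]eM// -RintegralZr//.
apply: le_Rintegral => //.
- exact: integrable_norm.
- by apply: (@loc_integrableM _ (cst (M y - M x))) => //; exact: cst_continuous.
move=> t; rewrite /= in_itv/= => xty.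
apply: le_trans (ler_normD _ _) _; rewrite !normrM mulrDl lerD//.
  by rewrite ler_wpM2l// Eg.
by rewrite mulrC ler_wpM2l// distrC Ef.
Qed.

Lemma primitive_horner (p : {poly R}) : primitive (horner p) (horner p^`()).
Proof.
by apply: primitiveC1; exact: continuous_horner.
Qed.

(** Continuity at the junction suffices, since the integrand at the single point c does not matter.
    This serves both for cutting off polynomials and for joining the two halves of an element of the
    domain. *)
Lemma primitive_glue c F f G g : primitive F f -> primitive G g -> F c = G c ->
  primitive (fun x => if x < c then F x else G x)
            (fun x => if x < c then f x else g x).
Proof.
move=> [lf Ff] [lg Gg] FGc.
set h := fun x => if x < c then f x else g x.
have mh : measurable_fun setT h.
  apply: measurable_fun_ifT; first exact: measurable_fun_ltr.
    exact: loc_integrable_measurable.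
  exact: loc_integrable_measurable.
have lh : loc_integrable h.
  move=> a b; have := loc_integrableD (loc_integrable_norm lf) (loc_integrable_norm lg).
  move=> /(_ a b); apply: le_integrable => //.
    by apply/measurable_EFinP; exact: measurable_funTS.
  move=> x _ /=; rewrite lee_fin [leRHS]ger0_norm ?addr_ge0// /h.
  by case: ifP => _; rewrite ?lerDl ?lerDr.
have L a b : a <= b -> b <= c -> F b - F a = \int[mu]_(x in `[a, b]) h x.
  move=> ab bc; rewrite Ff// -!Rintegral_itv_bndo_bndc//.
  - apply: eq_Rintegral => x; rewrite inE/= in_itv/= => /andP[_ xb].
    by rewrite /h (lt_le_trans xb bc).
  - by apply: integrableS (lh a b) => //; exact: subset_itv_co_cc.
  - by apply: integrableS (lf a b) => //; exact: subset_itv_co_cc.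
have Rr a b : a <= b -> c <= a -> G b - G a = \int[mu]_(x in `[a, b]) h x.
  move=> ab ca; rewrite Gg//.
  apply: eq_Rintegral => x; rewrite inE/= in_itv/= => /andP[ax _].
  by rewrite /h ltNge (le_trans ca ax).
split => // a b ab.
have [ac|ca] := ltP a c; last by rewrite ltNge (le_trans ca ab)/= Rr.
have [bc|cb] := ltP b c; first by rewrite L// ltW.
rewrite (itv_integralD lh (ltW ac) cb) -L ?(ltW ac)// -Rr// FGc; lra.
Qed.

Lemma lebesgue_integrable_opp (D : set R) f : measurable D ->
  mu.-integrable D (EFin \o f) ->
  mu.-integrable (-%R @^-1` D) (EFin \o (fun x => f (- x))) /\
  \int[mu]_(x in -%R @^-1` D) f (- x) = \int[mu]_(x in D) f x.
Proof.
(* f is controlled on D only; its extension by zero is measurable on the whole line, which the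
   pushforward by negation requires. *)
move=> mD fi; set g := f \_ D.
have mN : measurable_fun setT (-%R : measurableTypeR R -> measurableTypeR R) by exact: oppr_measurable.
have mND : measurable (-%R @^-1` D) by rewrite -[X in measurable X]setTI; exact: mN.
have mg : measurable_fun setT (EFin \o g).
  apply/measurable_EFinP; apply/(measurable_restrictT _ _).1 => //.
  by apply/measurable_EFinP; apply: measurable_int fi.
have gf : {in D, EFin \o g =1 EFin \o f} by move=> x xD /=; rewrite /g patchE xD.
have gfN : {in -%R @^-1` D, (EFin \o g) \o -%R =1 EFin \o (fun x => f (- x))}.
  by move=> x; rewrite inE/= => xD; rewrite /g patchE mem_set.
have gi : mu.-integrable D (EFin \o g).
  by apply: eq_integrable fi => // x xD; rewrite gf.
have giN : mu.-integrable (-%R @^-1` D) ((EFin \o g) \o -%R).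
  apply/integrableP; split.
    by apply: measurable_funTS; apply: (measurableT_comp mg mN).
  have /integrableP[_] := gi; apply: le_lt_trans.
  rewrite -(@ge0_integral_pushforward _ _ _ _ _ _ mN mu D (fun x => `|(g x)%:E|)%E)//.
    rewrite le_eqVlt; apply/orP; left; apply/eqP.
    by apply: eq_measure_integral => A mA _; exact: lebesgue_measureN.
  by apply: measurableT_comp => //; exact: measurable_funTS.
split; first by apply: eq_integrable giN => // x xD; rewrite gfN.
transitivity (fine (\int[mu]_(x in -%R @^-1` D) ((EFin \o g) \o -%R) x)%E).
  by congr fine; apply: eq_integral => x xD; rewrite gfN.
rewrite -(@integral_pushforward _ _ _ _ _ _ mN mu D (EFin \o g))//.
transitivity (fine (\int[mu]_(x in D) (EFin \o g) x)%E); last first.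
  by congr fine; apply: eq_integral => x xD; rewrite gf.
congr fine.
by apply: eq_measure_integral => A mA _; exact: lebesgue_measureN.
Qed.

Lemma primitive_opp F f : primitive F f ->
  primitive (fun x => - F (- x)) (fun x => f (- x)).
Proof.
move=> [lf Ff].
have opp_itv a b : -%R @^-1` `[- b, - a] = `[a, b]%classic :> set R.
  by apply/seteqP; split => x/=; rewrite !in_itv/= !lerN2 => /andP[-> ->].
split => [a b|a b ab].
  by have [] := lebesgue_integrable_opp (measurable_itv _) (lf (- b) (- a)); rewrite opp_itv.
have [_] := lebesgue_integrable_opp (measurable_itv _) (lf (- b) (- a)).
rewrite opp_itv => ->; rewrite -Ff ?lerN2//; lra.
Qed.

End Primitives.

(** * Square integrable functions *)

Section SquareIntegrable.
Variable R : realType.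
Local Notation mu := (@lebesgue_measure R).
Implicit Types (f g h F G H : R -> R) (a b c x : R) (I J : set R).

Definition sq_integrable I f := measurable_fun I f /\
  mu.-integrable I (EFin \o (fun x => f x ^+ 2)).

Lemma sq_integrable_le I f g : measurable I -> measurable_fun I f ->
  (forall x, I x -> `|f x| <= `|g x|) -> sq_integrable I g -> sq_integrable I f.
Proof.
move=> mI mf fg [mg ig]; split => //; apply: le_integrable ig => //.
  by apply/measurable_EFinP; exact: measurable_funX.
move=> x Ix; rewrite /= lee_fin !normrX lerXn2r ?nnegrE//; exact: fg.
Qed.

Lemma sq_integrableM I f g : measurable I -> sq_integrable I f ->
  sq_integrable I g -> mu.-integrable I (EFin \o (fun x => f x * g x)).
Proof.
move=> mI [mf if2] [mg ig2]; apply: le_integrable (integrableD _ if2 ig2) => //.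
  by apply/measurable_EFinP; exact: measurable_funM.
move=> x Ix; rewrite /= lee_fin [leRHS]ger0_norm ?addr_ge0 ?sqr_ge0//.
rewrite normrM -(real_normK (num_real (f x))) -(real_normK (num_real (g x))).
have := sqr_ge0 (`|f x| - `|g x|); have := sqr_ge0 (`|f x| + `|g x|).
nra.
Qed.

Lemma sq_integrableD I f g : measurable I -> sq_integrable I f ->
  sq_integrable I g -> sq_integrable I (fun x => f x + g x).
Proof.
move=> mI f2 g2; split; first by apply: measurable_funD; [case: f2|case: g2].
apply: le_integrable (integrableD _ (integrableZl _ 2 f2.2) (integrableZl _ 2 g2.2)) => //.
  apply/measurable_EFinP; apply: measurable_funX.
  by apply: measurable_funD; [case: f2|case: g2].
move=> x Ix; rewrite /= lee_fin.
rewrite ger0_norm ?sqr_ge0// ger0_norm; last first.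
  by rewrite addr_ge0// mulr_ge0// sqr_ge0.
have := sqr_ge0 (f x - g x); nra.
Qed.

Lemma sq_integrableZ I k f : measurable I -> sq_integrable I f ->
  sq_integrable I (fun x => k * f x).
Proof.
move=> mI [mf if2]; split; first by apply: measurable_funM.
by apply: eq_integrable (integrableZl _ (k ^+ 2) if2) => // x _ /=; rewrite exprMn.
Qed.

Lemma sq_integrableB I f g : measurable I -> sq_integrable I f ->
  sq_integrable I g -> sq_integrable I (fun x => f x - g x).
Proof.
move=> mI f2 g2.
have -> : (fun x => f x - g x) = (fun x => f x + -1 * g x).
  by apply/funext => x; rewrite mulN1r.
by apply: sq_integrableD => //; exact: sq_integrableZ.
Qed.

Lemma ae_eq_integrable I f g : measurable I -> measurable_fun I g ->
  f = g %[ae mu in I] -> mu.-integrable I (EFin \o f) ->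
  mu.-integrable I (EFin \o g).
Proof.
move=> mI mg fg fi; have mf := measurable_int mu fi.
move/integrableP : fi => [_ fi]; apply/integrableP; split.
  exact/measurable_EFinP.
apply: le_lt_trans fi; rewrite le_eqVlt; apply/orP; left; apply/eqP.
apply: ge0_ae_eq_integral => //.
- by apply: measurableT_comp => //; exact/measurable_EFinP.
- exact: measurableT_comp.
apply: (filterS (F := almost_everywhere mu)) fg => x fg Ix.
by rewrite /= fg.
Qed.

Lemma ae_eq_Rintegral I f g : measurable I -> measurable_fun I f ->
  measurable_fun I g -> f = g %[ae mu in I] ->
  \int[mu]_(x in I) f x = \int[mu]_(x in I) g x.
Proof.
move=> mI mf mg fg; congr fine; apply: ae_eq_integral => //.
- exact/measurable_EFinP.
- exact/measurable_EFinP.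
by apply: (filterS (F := almost_everywhere mu)) fg => x fg Ix; rewrite fg.
Qed.

Lemma ae_eq_sq_integrable I f g : measurable I -> measurable_fun I g ->
  f = g %[ae mu in I] -> sq_integrable I f -> sq_integrable I g.
Proof.
move=> mI mg fg [mf fi]; split => //; apply: ae_eq_integrable fi => //.
  exact: measurable_funX.
by apply: (filterS (F := almost_everywhere mu)) fg => x fg Ix; rewrite fg.
Qed.

Lemma sq_integrable_restrict I f : measurable I -> sq_integrable I f ->
  sq_integrable setT (f \_ I).
Proof.
move=> mI [mf fi]; split; first exact/(measurable_restrictT _ _).1.
have -> : EFin \o (fun x => (f \_ I) x ^+ 2) = (EFin \o (fun x => f x ^+ 2)) \_ I.
  apply/funext => x; rewrite /= !patchE; case: ifP => // _.
  by rewrite expr0n.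
by apply: (proj1 (integrable_mkcond _ _)) fi.
Qed.

Lemma sq_integrable_loc f : sq_integrable setT f -> loc_integrable f.
Proof.
move=> [mf fi] a b.
have i1 : mu.-integrable `[a, b] (EFin \o cst 1).
  by apply: continuous_loc_integrable; exact: cst_continuous.
have i2 : mu.-integrable `[a, b] (EFin \o (fun x => f x ^+ 2)).
  exact: integrableS fi.
apply: le_integrable (integrableD _ i1 i2) => //.
  by apply/measurable_EFinP; exact: measurable_funTS.
move=> x Ix; rewrite /= lee_fin [leRHS]ger0_norm ?addr_ge0 ?sqr_ge0//.
rewrite -(real_normK (num_real (f x))).
have := sqr_ge0 (`|f x| - 1); have := normr_ge0 (f x); nra.
Qed.

Lemma restrict_ae I f : f \_ I = f %[ae mu in I].
Proof. by apply: aeW => x Ix; rewrite patchE mem_set. Qed.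

Lemma sq_integrable_restrictE I f : measurable I ->
  sq_integrable I (f \_ I) <-> sq_integrable I f.
Proof.
have e : {in I, (f \_ I) =1 f} by move=> x xI; rewrite patchE xI.
move=> mI; split=> -[mf fi]; split.
- exact: eq_measurable_fun mf.
- by apply: eq_integrable fi => // x xI /=; rewrite e.
- by apply: eq_measurable_fun mf => x xI; rewrite e.
- by apply: eq_integrable fi => // x xI /=; rewrite e.
Qed.

Lemma sq_integrable_opp I f : measurable I -> sq_integrable I f ->
  sq_integrable (-%R @^-1` I) (fun x => f (- x)).
Proof.
move=> mI [mf fi]; split; last by have [] := lebesgue_integrable_opp mI fi.
have mI' : measurable (-%R @^-1` I).
  by rewrite -[X in measurable X]setTI; exact: oppr_measurable.
have mN : measurable_fun setT (-%R : measurableTypeR R -> measurableTypeR R).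
  exact: oppr_measurable.
have mg : measurable_fun setT (f \_ I) by apply/(measurable_restrictT _ _).1.
apply: (@eq_measurable_fun _ _ _ _ _ ((f \_ I) \o -%R)).
  by move=> x; rewrite inE/= => Ix; rewrite patchE mem_set.
by apply: measurable_funTS; exact: measurableT_comp mg mN.
Qed.

Lemma Rintegral_supp I J f : J `<=` I -> (forall x, I x -> ~ J x -> f x = 0) ->
  \int[mu]_(x in I) f x = \int[mu]_(x in J) f x.
Proof.
move=> JI f0; rewrite Rintegral_mkcond [RHS]Rintegral_mkcond.
congr (Rintegral _ _ _); apply/funext => x; rewrite !patchE.
have [xJ|xJ] := boolP (x \in J).
  by rewrite mem_set//; apply: JI; rewrite -in_setE.
case: ifPn => // /set_mem xI; rewrite f0//.
by move/negP : xJ; rewrite inE.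
Qed.

Lemma integrable_supp I J f : measurable I -> measurable J ->
  J `<=` I -> (forall x, I x -> ~ J x -> f x = 0) ->
  mu.-integrable J (EFin \o f) -> mu.-integrable I (EFin \o f).
Proof.
move=> mI mJ JI f0 fi; apply: (proj2 (integrable_mkcond _ _)) => //.
have {}fi : mu.-integrable setT ((EFin \o f) \_ J).
  by apply: (proj1 (integrable_mkcond _ _)) fi.
apply: eq_integrable fi => // x _; rewrite !patchE.
have [xJ|xJ] := boolP (x \in J).
  by rewrite mem_set//; apply: JI; rewrite -in_setE.
case: ifPn => // /set_mem xI; rewrite /= f0//.
by move/negP : xJ; rewrite inE.
Qed.

Lemma le_Rintegral_subset I J f : measurable I -> measurable J -> I `<=` J ->
  (forall x, J x -> 0 <= f x) -> mu.-integrable J (EFin \o f) ->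
  \int[mu]_(x in I) f x <= \int[mu]_(x in J) f x.
Proof.
move=> mI mJ IJ f0 fJ; have fI : mu.-integrable I (EFin \o f).
  exact: integrableS fJ.
apply: fine_le; [exact: integrable_fin_num|exact: integrable_fin_num|].
by apply: ge0_subset_integral => //; exact: (measurable_int mu fJ).
Qed.

End SquareIntegrable.

(** * Smooth functions *)

Section TestFunctions.
Variable R : realType.
Local Notation mu := (@lebesgue_measure R).
Implicit Types (f g h : R -> R) (p q : {poly R}) (a b c x : R) (I : set R).

Definition smoothr f := forall n x, derivable (derive1n n f) x 1.

(** Coinduction: a class of functions stable under differentiation consists of smooth functions. It
    avoids closed formulas for the n-th derivatives of products and compositions. *)
Lemma smoothr_coind (C : (R -> R) -> Prop) :
  (forall f, C f -> exists2 g, C g & forall x, is_derive x 1 f (g x)) ->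
  forall f, C f -> smoothr f.
Proof.
move=> HC f Cf n.
have Cn : C (derive1n n f).
  elim: n => [//|n IH]; rewrite derive1nS.
  have [g Cg fg] := HC _ IH; rewrite (_ : _^`()%classic = g)//.
  by apply/funext => x; rewrite derive1E; case: (fg x).
by have [g _ fg] := HC _ Cn; move=> x; case: (fg x).
Qed.

Lemma smoothr_is_derive f x : smoothr f -> is_derive x 1 f (f^`()%classic x).
Proof. by move=> sf; rewrite derive1E; apply: derivableP; exact: (sf 0%N). Qed.

Lemma smoothr_derive f : smoothr f -> smoothr f^`()%classic.
Proof. by move=> sf n x; have := sf n.+1 x; rewrite /derive1n iterSr. Qed.

Lemma smoothr_deriven n f : smoothr f -> smoothr (derive1n n f).
Proof. by move=> sf m x; have := sf (m + n)%N x; rewrite /derive1n iterD. Qed.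

Lemma smoothr_continuous f : smoothr f -> continuous f.
Proof.
move=> sf x; apply/differentiable_continuous/derivable1_diffP; exact: (sf 0%N).
Qed.

Lemma smoothr_primitive f : smoothr f -> primitive f f^`()%classic.
Proof.
move=> sf; apply: primitiveC1 => [x|]; first exact: smoothr_is_derive.
exact/smoothr_continuous/smoothr_derive.
Qed.

Lemma is_derive1_compose f g x a b : is_derive (g x) 1 f a ->
  is_derive x 1 g b -> is_derive x 1 (fun y => f (g y)) (a * b).
Proof.
move=> [df <-] [dg <-]; apply: DeriveDef.
  apply/derivable1_diffP; apply: differentiable_comp; exact/derivable1_diffP.
by rewrite -!derive1E -(derive1_comp dg df).
Qed.

(** The derivative of a product is a sum of products, and that of an affine substitution carries a
    factor; only the class generated by all these operations together is stable under
    differentiation, as [smoothr_coind] demands. *)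
Inductive smooth_alg : (R -> R) -> Prop :=
| smooth_alg_base f : smoothr f -> smooth_alg f
| smooth_alg_add f g : smooth_alg f -> smooth_alg g ->
    smooth_alg (fun x => f x + g x)
| smooth_alg_mul f g : smooth_alg f -> smooth_alg g ->
    smooth_alg (fun x => f x * g x)
| smooth_alg_affine f a b : smooth_alg f -> smooth_alg (fun x => f (a * x + b)).

Lemma smoothr_cst c : smoothr (fun=> c).
Proof.
apply: (@smoothr_coind (fun f => exists k, f = fun=> k)); last by exists c.
move=> _ [k ->]; exists (fun=> 0); first by exists 0.
by move=> x; exact: is_derive_cst.
Qed.

Lemma smooth_algP f : smooth_alg f -> smoothr f.
Proof.
apply: smoothr_coind => {}f; elim => {f}.
- move=> f sf; exists f^`()%classic; last by move=> x; exact: smoothr_is_derive.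
  exact/smooth_alg_base/smoothr_derive.
- move=> f g _ [f' af' ff'] _ [g' ag' gg'].
  exists (fun x => f' x + g' x); first exact: smooth_alg_add.
  by move=> x; exact: is_deriveD.
- move=> f g af [f' af' ff'] ag [g' ag' gg'].
  exists (fun x => f x * g' x + g x * f' x).
    by apply: smooth_alg_add; exact: smooth_alg_mul.
  by move=> x; exact: is_deriveM.
- move=> f a b af [f' af' ff'].
  exists (fun x => f' (a * x + b) * a).
    apply: smooth_alg_mul; first exact: smooth_alg_affine.
    exact/smooth_alg_base/smoothr_cst.
  move=> x; apply: is_derive1_compose.
  have d : is_derive x 1 (a \*: (@id R) + cst b) (a *: 1 + 0).
    by apply: is_deriveD.
  by move: d; rewrite addr0 /GRing.scale/= mulr1.
Qed.

Lemma smoothrD f g : smoothr f -> smoothr g -> smoothr (fun x => f x + g x).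
Proof.
by move=> sf sg; apply/smooth_algP/smooth_alg_add; exact: smooth_alg_base.
Qed.

Lemma smoothrM f g : smoothr f -> smoothr g -> smoothr (fun x => f x * g x).
Proof.
by move=> sf sg; apply/smooth_algP/smooth_alg_mul; exact: smooth_alg_base.
Qed.

Lemma smoothrZ k f : smoothr f -> smoothr (fun x => k * f x).
Proof. by move=> sf; apply: smoothrM => //; exact: smoothr_cst. Qed.

Lemma smoothr_affine a b f : smoothr f -> smoothr (fun x => f (a * x + b)).
Proof. by move=> sf; apply/smooth_algP/smooth_alg_affine/smooth_alg_base. Qed.

Lemma smoothr_antiderive f g : smoothr g -> (forall x, is_derive x 1 f (g x)) ->
  smoothr f.
Proof.
move=> sg fg; have e : f^`()%classic = g.
  by apply/funext => x; rewrite derive1E; case: (fg x).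
case=> [x|n x]; first by case: (fg x).
by rewrite /derive1n iterSr -/(derive1n n _) e.
Qed.

Lemma derive1nD n f g : smoothr f -> smoothr g ->
  derive1n n (fun x => f x + g x) = (fun x => derive1n n f x + derive1n n g x).
Proof.
move=> sf sg; elim: n => [//|n IH]; rewrite !derive1nS IH.
by apply/funext => x; rewrite derive1E deriveD -?derive1E.
Qed.

Lemma derive1nZ n k f : smoothr f ->
  derive1n n (fun x => k * f x) = (fun x => k * derive1n n f x).
Proof.
move=> sf; elim: n => [//|n IH]; rewrite !derive1nS IH.
by apply/funext => x; rewrite derive1E deriveZ -?derive1E//; exact: sf.
Qed.

(** Termwise: exp y >= 1 + y^(i+2) / (i+2)! bounds y^(i+2) exp(-y) by (i+2)!. The extra factor y^2,
    read at y = 1/x, makes p(1/x) exp(-1/x) vanish quadratically at 0. *)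
Lemma horner_expR_bound (p : {poly R}) :
  exists2 C, 0 <= C & forall y, 0 < y -> `|p.[y]| * expR (- y) * y ^+ 2 <= C.
Proof.
exists (\sum_(i < size p) `|p`_i| * (i.+2)`!%:R).
  by apply: sumr_ge0 => i _; rewrite mulr_ge0.
move=> y y0; rewrite horner_coef.
have -> : forall z, z * expR (- y) * y ^+ 2 = z * (expR (- y) * y ^+ 2).
  by move=> z; rewrite mulrA.
have y0' : 0 <= expR (- y) * y ^+ 2 by rewrite mulr_ge0 ?expR_ge0 ?sqr_ge0.
apply: le_trans (ler_wpM2r y0' (ler_norm_sum _ _ _)) _.
rewrite mulr_suml; apply: ler_sum => i _.
rewrite normrM -mulrA ler_wpM2l//.
have := expR_ge1Dxn i.+1 (ltW y0).
rewrite normrX (gtr0_norm y0) expRN => H.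
rewrite mulrCA -exprD addn2 ler_pdivrMl ?expR_gt0//.
rewrite -ler_pdivrMr ?ltr0n ?fact_gt0//.
by apply: le_trans H; rewrite lerDr.
Qed.

Lemma is_derive0_quadratic f C : f 0 = 0 ->
  (forall x, `|f x| <= C * x ^+ 2) -> is_derive (0 : R) 1 f 0.
Proof.
move=> f0 fC.
have C0 : 0 <= C.
  by have := fC 1; rewrite expr1n mulr1; apply: le_trans.
have cvg0 : h^-1 *: ((f \o shift 0) (h *: 1) - f 0) @[h --> 0^'] --> (0 : R).
  apply/cvgr0Pnorm_le => e e0; near=> h.
  rewrite /= f0 subr0 addr0 /GRing.scale/= mulr1 normrM normfV.
  have h0 : h != 0 by near: h; exact: nbhs_dnbhs_neq.
  rewrite ler_pdivrMl ?normr_gt0//; apply: le_trans (fC h) _.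
  rewrite -(real_normK (num_real h)) expr2 mulrA mulrC ler_wpM2l//.
  have : `|h| <= e / (C + 1).
    by near: h; apply: dnbhs0_le; rewrite divr_gt0//; lra.
  rewrite ler_pdivlMr; last lra.
  by have := normr_ge0 h; nra.
apply: DeriveDef; first by apply/cvg_ex; exists 0.
exact: cvg_lim.
Unshelve. all: by end_near. Qed.

(** The classical flat function exp(-1/x) with a polynomial factor in 1/x. The factor closes the
    family under differentiation, which sends p to X^2 (p - p'). *)
Definition flat (p : {poly R}) x : R :=
  if 0 < x then p.[x^-1] * expR (- x^-1) else 0.

Lemma is_derive_flat p x :
  is_derive x 1 (flat p) (flat ('X^2 * (p - p^`())) x).
Proof.
have [x0|x0|->] := ltgtP x 0.
- have -> : flat ('X^2 * (p - p^`())) x = 0 by rewrite /flat ltNge ltW.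
  have d0 : is_derive x 1 (cst 0 : R -> R) 0 by exact: is_derive_cst.
  apply: near_eq_is_derive d0; near=> y; rewrite /flat ifF//; apply/negbTE; rewrite -leNgt ltW//.
  by near: y; exact: lt_nbhsl.
- have dV : is_derive x 1 (fun y : R => y^-1) (- x^-2).
    apply: DeriveDef; first by apply: derivableV; rewrite ?gt_eqF.
    rewrite deriveV ?gt_eqF// derive_id /GRing.scale/= mulr1 //.
  have d1 : is_derive x 1 (fun y => p.[y^-1]) (p^`().[x^-1] * - x^-2).
    exact: is_derive1_compose.
  have d2 : is_derive x 1 (fun y => expR (- y^-1)) (expR (- x^-1) * x^-2).
    apply: is_derive1_compose.
    by rewrite -[x^-2]opprK; exact: is_deriveN.
  have -> : flat ('X^2 * (p - p^`())) x =
     p.[x^-1] *: (expR (- x^-1) * x^-2) + expR (- x^-1) *: (p^`().[x^-1] * - x^-2).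
    rewrite /flat x0 !hornerE /GRing.scale/= exprVn; lra.
  apply: near_eq_is_derive (is_deriveM d1 d2).
  by near=> y; rewrite /flat ifT//; near: y; exact: lt_nbhsr.
- have -> : flat ('X^2 * (p - p^`())) 0 = 0 by rewrite /flat ltxx.
  have [C C0 HC] := horner_expR_bound p.
  apply: (@is_derive0_quadratic _ C); first by rewrite /flat ltxx.
  move=> y; rewrite /flat; case: ifPn => y0; last first.
    by rewrite normr0 mulr_ge0// sqr_ge0.
  rewrite normrM (ger0_norm (expR_ge0 _)).
  have := HC y^-1; rewrite invr_gt0 => /(_ y0).
  by rewrite exprVn ler_pdivrMr ?exprn_gt0.
Unshelve. all: by end_near. Qed.

Lemma smoothr_flat p : smoothr (flat p).
Proof.
apply: (@smoothr_coind (fun f => exists q, f = flat q)); last by exists p.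
move=> _ [q ->]; exists (flat ('X^2 * (q - q^`()))); first by eexists.
by move=> x; exact: is_derive_flat.
Qed.

Lemma flat1_bound x : 0 <= flat 1 x <= 1.
Proof.
rewrite /flat; case: ifPn => x0; rewrite ?lexx ?ler01// hornerE mul1r.
by rewrite expR_ge0/= -expR0 ler_expR oppr_le0 invr_ge0 ltW.
Qed.

(* Smooth functions supported in [a, b] which converge boundedly to the
   indicator function of ]a, b[. *)
Definition bump a b n x : R := flat 1 (n.+1%:R * (x - a)) * flat 1 (n.+1%:R * (b - x)).

Lemma smoothr_bump a b n : smoothr (bump a b n).
Proof.
apply: smoothrM.
  rewrite (_ : (fun x => _) = (fun x => flat 1 (n.+1%:R * x + - (n.+1%:R * a)))).
    exact/smoothr_affine/smoothr_flat.
  by apply/funext => x; rewrite mulrBr.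
rewrite (_ : (fun x => _) = (fun x => flat 1 (- n.+1%:R * x + n.+1%:R * b))).
  exact/smoothr_affine/smoothr_flat.
by apply/funext => x; rewrite mulrBr mulNr addrC.
Qed.

Lemma bump_out a b n x : ~ (a < x < b) -> bump a b n x = 0.
Proof.
move=> /negP; rewrite negb_and -!leNgt /bump /flat => /orP[xa|bx].
  by rewrite ifF ?mul0r//; apply/negbTE; rewrite -leNgt pmulr_rle0// subr_le0.
rewrite [X in _ * X]ifF ?mulr0//; apply/negbTE.
by rewrite -leNgt pmulr_rle0// subr_le0.
Qed.

Lemma bump_bound a b n x : 0 <= bump a b n x <= 1.
Proof.
have /andP[h1 h2] := flat1_bound (n.+1%:R * (x - a)).
have /andP[h3 h4] := flat1_bound (n.+1%:R * (b - x)).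
by rewrite /bump mulr_ge0//= mulr_ile1.
Qed.

Lemma cvg_flat_nat y : 0 < y -> flat 1 (n.+1%:R * y) @[n --> \oo] --> (1 : R).
Proof.
move=> y0.
have -> : (fun n => flat 1 (n.+1%:R * y)) = (fun n => expR (- (y^-1 * n.+1%:R^-1))).
  apply/funext => n; rewrite /flat mulr_gt0// hornerE mul1r invfM//.
  by rewrite mulrC.
have : - (y^-1 * n.+1%:R^-1) @[n --> \oo] --> (0 : R).
  rewrite -oppr0; apply: cvgN; rewrite -(mulr0 y^-1).
  by apply: cvgM; [exact: cvg_cst|exact: cvg_harmonic].
move=> H; rewrite -[X in _ --> X]expR0.
apply: (@continuous_cvg _ R R _ _ (fun n : nat => - (y^-1 / n.+1%:R)) expR 0).
  exact: continuous_expR.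
exact: H.
Qed.

Lemma cvg_bump a b x : bump a b n x @[n --> \oo] --> (\1_(`]a, b[%classic) x : R).
Proof.
rewrite indicE; have [/set_mem|/negP] := boolP (x \in `]a, b[%classic).
  rewrite /= in_itv/= => /andP[ax xb]; rewrite -[X in _ --> X]mulr1.
  by apply: cvgM; apply: cvg_flat_nat; rewrite subr_gt0.
rewrite inE/= in_itv/= => nx.
have -> : bump a b ^~ x = fun=> 0.
  by apply/funext => n; rewrite bump_out.
exact: cvg_cst.
Qed.

End TestFunctions.

(** * Test functions and the du Bois-Reymond lemma *)

Section WeakDerivatives.
Variable R : realType.
Local Notation mu := (@lebesgue_measure R).
Implicit Types (f g h u w p q F G U : R -> R) (a b c x : R) (I J : set R).

Definition open_interval I := [/\ open I, is_interval I & I !=set0].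

(** A segment with endpoints in I replaces compactness of the topological support; [test_functionP]
    shows the equivalence. *)
Definition test_on I p := smoothr p /\
  exists a b, [/\ a <= b, I a, I b & forall x, ~ (a <= x <= b) -> p x = 0].

Lemma open_interval_measurable I : open_interval I -> measurable I.
Proof. by case=> oI _ _; exact: open_measurable. Qed.

Lemma interval_subset I a b : open_interval I -> I a -> I b ->
  `[a, b]%classic `<=` I.
Proof. by move=> [_ iI _] Ia Ib x /=; rewrite in_itv/=; exact: iI. Qed.

Lemma derive1_out f a b : (forall x, ~ (a <= x <= b) -> f x = 0) ->
  forall x, ~ (a <= x <= b) -> f^`()%classic x = 0.
Proof.
move=> f0 x /negP nx.
have d0 : is_derive x 1 (cst 0 : R -> R) 0 by exact: is_derive_cst.
suff N : {near x, (cst 0 : R -> R) =1 f}.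
  by rewrite derive1E; have [_ <-] := near_eq_is_derive N d0.
move: nx; rewrite negb_and -!ltNge => /orP[xa|bx].
  near=> y; rewrite f0// => /andP[ay _].
  have : y < a by near: y; exact: lt_nbhsl.
  by rewrite ltNge ay.
near=> y; rewrite f0// => /andP[_ yb].
have : b < y by near: y; exact: lt_nbhsr.
by rewrite ltNge yb.
Unshelve. all: by end_near. Qed.

Lemma test_on_derive I p : test_on I p -> test_on I p^`()%classic.
Proof.
move=> [sp [a [b [ab Ia Ib p0]]]]; split; first exact: smoothr_derive.
by exists a, b; split => //; exact: derive1_out.
Qed.

Lemma test_on_deriven n I p : test_on I p -> test_on I (derive1n n p).
Proof. by move=> tp; elim: n => [//|n IH]; rewrite derive1nS; exact: test_on_derive. Qed.

Lemma test_on_add I p q : test_on I p -> test_on I q ->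
  test_on I (fun x => p x + q x).
Proof.
move=> [sp [a [b [ab Ia Ib p0]]]] [sq [c [d [cd Ic Id q0]]]].
split; first exact: smoothrD.
exists (Num.min a c), (Num.max b d); split.
- by rewrite ge_min le_max ab.
- by case: (leP a c).
- by case: (leP b d).
- move=> x nx; rewrite p0 ?q0 ?addr0// => /andP[ax xb]; apply: nx.
    by rewrite ge_min ax le_max xb !orbT.
  by rewrite ge_min ax le_max xb.
Qed.

Lemma test_on_scale I k p : test_on I p -> test_on I (fun x => k * p x).
Proof.
move=> [sp [a [b [ab Ia Ib p0]]]]; split; first exact: smoothrZ.
by exists a, b; split => // x nx; rewrite p0 ?mulr0.
Qed.

Lemma test_on_bump I a b n : a <= b -> I a -> I b -> test_on I (bump a b n).
Proof.
move=> ab Ia Ib; split; first exact: smoothr_bump.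
exists a, b; split => // x nx; rewrite bump_out// => /andP[ax xb].
by apply: nx; rewrite !ltW.
Qed.

Lemma test_on_integral I p h : open_interval I -> test_on I p ->
  loc_integrable h ->
  mu.-integrable I (EFin \o (fun x => h x * p x)) /\
  exists a b, a <= b /\ (forall x, ~ (a < x < b) -> p x = 0) /\
  forall f, \int[mu]_(x in I) (f x * p x) = \int[mu]_(x in `[a, b]) (f x * p x).
Proof.
move=> oI [sp [a [b [ab Ia Ib p0]]]] lh.
have abI := interval_subset oI Ia Ib.
have f0 f x : ~ `[a, b]%classic x -> f x * p x = 0.
  by rewrite /= in_itv/= => nx; rewrite p0// mulr0.
split.
  apply: (@integrable_supp _ I `[a, b]%classic) => //.
  - exact: open_interval_measurable.
  - by move=> x _; exact: f0.
  - by apply: loc_integrableM => //; exact: smoothr_continuous.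
exists (a - 1), (b + 1); split; first lra.
split; first by move=> x nx; apply: p0 => ?; apply: nx; lra.
move=> f; rewrite (@Rintegral_supp _ I `[a, b]%classic)//; last by move=> x _; exact: f0.
rewrite [RHS](@Rintegral_supp _ _ `[a, b]%classic)//.
  by move=> x /=; rewrite !in_itv/=; lra.
by move=> x _; exact: f0.
Qed.

Lemma test_on_int I p h : open_interval I -> test_on I p -> loc_integrable h ->
  mu.-integrable I (EFin \o (fun x => h x * p x)).
Proof. by move=> oI tp lh; have [] := test_on_integral oI tp lh. Qed.

Lemma loc_integrable_cst c : loc_integrable (fun=> c : R).
Proof. by apply: continuous_loc_integrable => x; exact: cst_continuous. Qed.

Lemma primitive_weak I F f p : open_interval I -> primitive F f -> test_on I p ->
  \int[mu]_(x in I) (F x * p^`()%classic x) = - \int[mu]_(x in I) (f x * p x).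
Proof.
move=> oI Ff tp; have [sp _] := tp; have [lf _] := Ff.
have lF : loc_integrable F by apply/continuous_loc_integrable/primitive_continuous/Ff.
have mI := open_interval_measurable oI.
apply/eqP; rewrite -subr_eq0 opprK addrC -RintegralD//; last 2 first.
- exact: test_on_int.
- by apply: test_on_int => //; exact: test_on_derive.
have [_ [a [b [ab [p0 _]]]]] := test_on_integral oI tp lf.
have pF := primitiveM Ff (smoothr_primitive sp).
have [_ /(_ _ _ ab)] := pF; rewrite (p0 a) ?(p0 b) ?ltxx ?andbF//.
rewrite !mulr0 subrr => E.
move: tp => [_ [c [d [cd Ic Id q0]]]].
have cdI := interval_subset oI Ic Id.
have z0 x : ~ `[c, d]%classic x -> f x * p x + F x * p^`()%classic x = 0.
  rewrite /= in_itv/= => nx; rewrite q0// (derive1_out q0 nx); lra.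
rewrite (@Rintegral_supp _ I `[c, d]%classic)//; last by move=> x _; exact: z0.
(* Both ends of [c - 1, d + 1] lie outside the support of p, so the boundary term F p vanishes
   there. *)
have [_ /(_ (c - 1) (d + 1))] := pF; rewrite !q0; [|lra..].
rewrite !mulr0 subrr => /(_ ltac:(lra)).
rewrite (@Rintegral_supp _ _ `[c, d]%classic); first by move=> <-.
  by move=> x /=; rewrite !in_itv/=; lra.
by move=> x _; exact: z0.
Qed.

(** The primitive that vanishes at a vanishes to the left of a, and also to the right of b because
    the total integral is zero. *)
Lemma test_on_primitive I p : open_interval I -> test_on I p ->
  \int[mu]_(x in I) p x = 0 -> exists2 q, test_on I q & q^`()%classic = p.
Proof.
move=> oI [sp [a [b [ab Ia Ib p0]]]] ip.
have [P Pp] := primitive_exists (continuous_loc_integrable (smoothr_continuous sp)).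
have dP x : is_derive x 1 (fun y => P y + - P a) (p x).
  rewrite -[p x]addr0; apply: is_deriveD.
  by apply: primitive_derive Pp _; exact: smoothr_continuous.
have [lp eP] := Pp.
have Pab : P b - P a = 0.
  rewrite eP// -(@Rintegral_supp _ I)//; first exact: interval_subset.
  by move=> x _; rewrite /= in_itv/=; exact: p0.
exists (fun y => P y + - P a); last first.
  by apply/funext => x; rewrite derive1E; case: (dP x).
split; first exact: smoothr_antiderive sp dP.
exists a, b; split => // x /negP; rewrite negb_and -!ltNge => /orP[xa|bx].
  have := eP _ _ (ltW xa); rewrite -Rintegral_itv_bndo_bndc; last first.
    by apply: integrableS (lp x a) => //; exact: subset_itv_co_cc.
  rewrite (@eq_Rintegral _ _ _ _ _ (cst 0)) ?Rintegral_cst//=; first by lra.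
  move=> y; rewrite inE/= in_itv/= => /andP[_ ya]; rewrite p0//.
  by rewrite leNgt ya.
have := eP _ _ (ltW bx); rewrite -Rintegral_itv_obnd_cbnd; last first.
  by apply: integrableS (lp b x) => //; exact: subset_itv_oc_cc.
rewrite (@eq_Rintegral _ _ _ _ _ (cst 0)) ?Rintegral_cst//=; first by lra.
move=> y; rewrite inE/= in_itv/= => /andP[ya _]; rewrite p0//.
by rewrite [y <= b]leNgt ya andbF.
Qed.

Lemma bump_limit a b h : loc_integrable h ->
  \int[mu]_(x in `[a, b]) (h x * bump a b n x) @[n --> \oo] -->
  \int[mu]_(x in `[a, b]) h x.
Proof.
move=> lh.
have cb n : continuous (bump a b n) by exact/smoothr_continuous/smoothr_bump.
pose f_ n x := (h x * bump a b n x)%:E.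
have mh := loc_integrable_measurable lh.
(* The bumps tend to the indicator of the open interval; the two endpoints are discarded as null
   sets. *)
have ae_neq (c : R) : \forall x \ae mu, x <> c.
  by exists [set c]; split => //; [exact: lebesgue_measure_set1|move=> x /= /contrapT].
have [|||||fi _ cvf] := @dominated_convergence _ _ _ mu `[a, b]%classic
    (measurable_itv _) f_ (fun x => (h x)%:E) (fun x => `|h x|%:E).
- move=> n; apply/measurable_EFinP; apply: measurable_funTS.
  by apply: measurable_funM => //; exact: continuous_measurable_fun.
- by apply/measurable_EFinP; exact: measurable_funTS.
- apply: (filterS2 (F := almost_everywhere mu)) (ae_neq a) (ae_neq b) => x xa xb.
  rewrite /= in_itv/= => /andP[ax bx]; apply: cvg_EFin; first by near=> n.
  rewrite -[X in _ --> X]mulr1; apply: cvgM; first exact: cvg_cst.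
  have := @cvg_bump R a b x; rewrite indicE mem_set//= in_itv/= !lt_neqAle ax bx !andbT.
  by apply/andP; split; apply/eqP => // /esym.
- exact: loc_integrable_norm.
- apply: aeW => x n _; rewrite /f_ /= lee_fin normrM.
  have /andP[b0 b1] := bump_bound a b n x.
  by rewrite [X in _ * X]ger0_norm// ler_piMr.
apply: fine_cvg; rewrite fineK; first exact: cvf.
exact: integrable_fin_num.
Unshelve. all: by end_near. Qed.

Lemma test_on_zero_itv I h : open_interval I -> loc_integrable h ->
  (forall p, test_on I p -> \int[mu]_(x in I) (h x * p x) = 0) ->
  forall a b, I a -> I b -> a <= b -> \int[mu]_(x in `[a, b]) h x = 0.
Proof.
move=> oI lh h0 a b Ia Ib ab.
have e n : \int[mu]_(x in `[a, b]) (h x * bump a b n x) = 0.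
  rewrite -(h0 _ (test_on_bump n ab Ia Ib)).
  rewrite [RHS](@Rintegral_supp _ I `[a, b]%classic)//.
    exact: interval_subset.
  move=> x _; rewrite /= in_itv/= => nx; rewrite bump_out ?mulr0//.
  by move=> /andP[ax xb]; apply: nx; rewrite !ltW.
have := @bump_limit a b _ lh; rewrite (_ : (fun n => _) = cst 0); last first.
  by apply/funext => n; exact: e.
by move=> /cvg_lim; rewrite lim_cst// => ->.
Qed.

(** A primitive of h is locally constant on I, and its derivative is h almost everywhere. *)
Lemma zero_itv_ae I h : open_interval I -> loc_integrable h ->
  (forall a b, I a -> I b -> a <= b -> \int[mu]_(x in `[a, b]) h x = 0) ->
  h = cst 0 %[ae mu in I].
Proof.
move=> oI lh h0; have [H Hh] := primitive_exists lh; have [_ eH] := Hh.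
apply: (filterS (F := almost_everywhere mu)) (primitive_ae Hh) => x [_ <-] Ix.
rewrite /cst; have [oI' _ _] := oI.
have d0 : is_derive x 1 (cst (H x) : R -> R) 0 by exact: is_derive_cst.
suff N : {near x, (cst (H x) : R -> R) =1 H} by have [_ <-] := near_eq_is_derive N d0.
have : nbhs x I by exact: open_nbhs_nbhs.
apply: filterS => y Iy /=; have [xy|yx] := leP x y.
  by have := eH _ _ xy; rewrite h0//; lra.
by have := eH _ _ (ltW yx); rewrite h0//; [lra|exact: ltW].
Qed.

Lemma fundamental_lemma I h : open_interval I -> loc_integrable h ->
  (forall p, test_on I p -> \int[mu]_(x in I) (h x * p x) = 0) ->
  h = cst 0 %[ae mu in I].
Proof. by move=> oI lh h0; apply: zero_itv_ae => //; exact: test_on_zero_itv h0. Qed.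

(** If all bumps on a segment [x, y] of I had integral zero, so would their limit, which is y - x >
    0. Hence some bump can be normalised. *)
Lemma test_on_unit_integral I : open_interval I ->
  exists2 p, test_on I p & \int[mu]_(x in I) p x = 1.
Proof.
move=> oI; have [oI' _ [x Ix]] := oI.
have [y Iy xy] : exists2 y, I y & x < y.
  have : nbhs x I by exact: open_nbhs_nbhs.
  move=> [e /= e0 eI]; exists (x + e / 2); last by lra.
  by apply: eI => /=; rewrite opprD addrA subrr sub0r normrN gtr0_norm; lra.
suff [n n0] : exists n, \int[mu]_(t in I) bump x y n t != 0.
  exists (fun t => (\int[mu]_(t in I) bump x y n t)^-1 * bump x y n t).
    by apply/test_on_scale/test_on_bump => //; exact: ltW.
  have tb : test_on I (bump x y n) by apply: test_on_bump => //; exact: ltW.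
  have := test_on_int oI tb (loc_integrable_cst 1).
  under eq_fun do rewrite mul1r.
  move=> ib; rewrite RintegralZl//; last exact: open_interval_measurable.
  by rewrite mulVf.
apply: contrapT => /forallNP n0.
have n0' n : \int[mu]_(t in I) bump x y n t = 0.
  by apply/eqP/negPn/negP; exact: n0.
have := @bump_limit x y _ (loc_integrable_cst 1).
rewrite (_ : (fun n => _) = cst 0); last first.
  apply/funext => n; rewrite -[RHS](n0' n) [RHS](@Rintegral_supp _ I `[x, y]%classic)//.
  - by under eq_Rintegral do rewrite mul1r.
  - exact: interval_subset.
  - move=> z _; rewrite /= in_itv/= => nz; rewrite bump_out//.
    by move=> /andP[xz zy]; apply: nz; rewrite !ltW.
move=> /cvg_lim -/(_ (@norm_hausdorff _ _)); rewrite lim_cst//.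
have [_ /(_ _ _ (ltW xy)) <-] : primitive (@id R) (fun=> 1).
  by apply: primitiveC1 => z; exact: cst_continuous.
rewrite /=; lra.
Qed.

(* A linear functional on test functions which vanishes on derivatives is a
   multiple of the integral, because p - (\int p) theta is the derivative of a
   test function as soon as \int theta = 1. *)
Lemma functional_dubois_reymond I (L : (R -> R) -> R) : open_interval I ->
  (forall k p q, test_on I p -> test_on I q ->
     L (fun x => p x + k * q x) = L p + k * L q) ->
  (forall p, test_on I p -> L p^`()%classic = 0) ->
  exists c, forall p, test_on I p -> L p = c * \int[mu]_(x in I) p x.
Proof.
move=> oI Llin L0; have mI := open_interval_measurable oI.
have [t tt it] := test_on_unit_integral oI.
have ti p : test_on I p -> mu.-integrable I (EFin \o p).
  move=> tp; have := test_on_int oI tp (loc_integrable_cst 1).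
  by under eq_fun do rewrite mul1r.
exists (L t) => p tp; set s := \int[mu]_(x in I) p x.
have tq : test_on I (fun x => p x + - s * t x) by apply/test_on_add/test_on_scale.
have iq : \int[mu]_(x in I) (p x + - s * t x) = 0.
  rewrite RintegralD//; [|exact: ti|exact/ti/test_on_scale].
  by rewrite RintegralZl//; [rewrite it -/s; lra|exact: ti].
have [q tq' eq] := test_on_primitive oI tq iq.
have := L0 _ tq'; rewrite eq Llin//; lra.
Qed.

(** With G a primitive of g, integration against u - G kills derivatives of test functions, so by
    [functional_dubois_reymond] it is a multiple c of the integral; then u = G + c almost everywhere
    by the fundamental lemma. *)
Lemma dubois_reymond I u g : open_interval I -> loc_integrable u ->
  loc_integrable g ->
  (forall p, test_on I p -> \int[mu]_(x in I) (u x * p^`()%classic x) =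
                          - \int[mu]_(x in I) (g x * p x)) ->
  exists2 U, primitive U g & u = U %[ae mu in I].
Proof.
move=> oI lu lg ug; have mI := open_interval_measurable oI.
have [G Gg] := primitive_exists lg.
have lG : loc_integrable G by apply/continuous_loc_integrable/primitive_continuous/Gg.
pose w x := u x - G x.
have lw : loc_integrable w.
  have := loc_integrableD lu (loc_integrableZ (-1) lG).
  rewrite (_ : _ \+ _ = w)//; apply/funext => x; rewrite /w /=; lra.
have [k p q tp tq|p tp|c Hc] := @functional_dubois_reymond I
  (fun p => \int[mu]_(x in I) (w x * p x)) oI.
- transitivity (\int[mu]_(x in I) (w x * p x + k * (w x * q x))).
    by apply: eq_Rintegral => x _; lra.
  rewrite RintegralD//; [|exact: test_on_int|].
    by rewrite RintegralZl//; exact: test_on_int.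
  exact: (integrableZl _ k (test_on_int oI tq lw)).
- transitivity (\int[mu]_(x in I) (u x * p^`()%classic x - G x * p^`()%classic x)).
    by apply: eq_Rintegral => x _; rewrite /w; lra.
  have tp' := test_on_derive tp.
  rewrite RintegralB//; [|exact: test_on_int|exact: test_on_int].
  by rewrite ug// (primitive_weak oI Gg tp); lra.
exists (fun x => G x + c); first exact: primitive_addc.
have := @fundamental_lemma I (fun x => w x + - c) oI.
have lwc : loc_integrable (fun x => w x + - c).
  exact: (loc_integrableD lw (loc_integrable_cst (- c))).
move=> /(_ lwc) H.
have {}H : (fun x => w x + - c) = cst 0 %[ae mu in I].
  apply: H => p tp.
  transitivity (\int[mu]_(x in I) (w x * p x + - c * (1 * p x))).
    by apply: eq_Rintegral => x _; lra.
  have i1 := test_on_int oI tp (loc_integrable_cst 1).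
  rewrite RintegralD//; [|exact: test_on_int|exact: (integrableZl _ (- c) i1)].
  rewrite RintegralZl//.
  under [X in _ + _ * X]eq_Rintegral do rewrite mul1r.
  by rewrite Hc//; lra.
apply: (filterS (F := almost_everywhere mu)) H => x /[swap] Ix /(_ Ix).
by rewrite /w /=; lra.
Qed.

End WeakDerivatives.

(** * Absolutely continuous representatives of Sobolev functions *)

Section SobolevRepresentatives.
Variable R : realType.
Local Notation mu := (@lebesgue_measure R).
Implicit Types (f g h u w p q F G : R -> R) (a b c x : R) (I J : set R).
Implicit Types (U V : nat -> R -> R) (j k n : nat).

Definition weakr I n u g := forall p, test_on I p ->
  \int[mu]_(x in I) (u x * derive1n n p x) =
  (-1) ^+ n * \int[mu]_(x in I) (g x * p x).

(* U lists absolutely continuous representatives of u and of its weak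
   derivatives on I, extended to the whole line. *)
Definition sobolev_rep I k u U :=
  [/\ forall j, (j < k)%N -> primitive (U j) (U j.+1), u = U 0%N %[ae mu in I]
    & forall j, (j <= k)%N -> sq_integrable I (U j)].

Lemma ae_eq_sym I f g : f = g %[ae mu in I] -> g = f %[ae mu in I].
Proof. by apply: (filterS (F := almost_everywhere mu)) => x fg Ix; rewrite fg. Qed.

Lemma ae_eq_trans I f g h : f = g %[ae mu in I] -> g = h %[ae mu in I] ->
  f = h %[ae mu in I].
Proof.
by apply: (filterS2 (F := almost_everywhere mu)) => x fg gh Ix; rewrite fg// gh.
Qed.

Lemma ae_eq_Rintegral_mul I f g p : measurable I -> measurable_fun I f ->
  measurable_fun I g -> measurable_fun I p -> f = g %[ae mu in I] ->
  \int[mu]_(x in I) (f x * p x) = \int[mu]_(x in I) (g x * p x).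
Proof.
move=> mI mf mg mp fg; apply: ae_eq_Rintegral => //; [exact: measurable_funM..|].
by apply: (filterS (F := almost_everywhere mu)) fg => x fg Ix; rewrite fg.
Qed.

Lemma test_on_measurable I J p : test_on I p -> measurable_fun J p.
Proof.
move=> [sp _]; apply: measurable_funTS; apply: continuous_measurable_fun.
exact: smoothr_continuous.
Qed.

Lemma restrict_Rintegral I f p :
  \int[mu]_(x in I) ((f \_ I) x * p x) = \int[mu]_(x in I) (f x * p x).
Proof. by apply: eq_Rintegral => x xI; rewrite patchE xI. Qed.

Lemma weakr0 I u g : open_interval I -> sq_integrable I u -> sq_integrable I g ->
  weakr I 0 u g -> u = g %[ae mu in I].
Proof.
move=> oI u2 g2 ug; have mI := open_interval_measurable oI.
have lu := sq_integrable_loc (sq_integrable_restrict mI u2).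
have lg := sq_integrable_loc (sq_integrable_restrict mI g2).
have lug : loc_integrable (fun x => (u \_ I) x + -1 * (g \_ I) x).
  exact: (loc_integrableD lu (loc_integrableZ (-1) lg)).
have := fundamental_lemma oI lug; set H := (X in (X -> _) -> _).
have h : H.
  move=> p tp; transitivity (\int[mu]_(x in I) ((u \_ I) x * p x - (g \_ I) x * p x)).
    by apply: eq_Rintegral => x _; lra.
  rewrite RintegralB//; [|exact: test_on_int|exact: test_on_int].
  by rewrite !restrict_Rintegral; have := ug p tp; rewrite /= mul1r => ->; rewrite subrr.
move=> /(_ h); apply: (filterS (F := almost_everywhere mu)) => x + Ix => /(_ Ix).
rewrite !patchE mem_set//= /cst; lra.
Qed.

Lemma weakr_unique I n u g h : open_interval I -> sq_integrable I g ->
  sq_integrable I h -> weakr I n u g -> weakr I n u h -> g = h %[ae mu in I].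
Proof.
move=> oI g2 h2 ug uh; apply: weakr0 => // p tp; rewrite expr0 mul1r.
have := ug p tp; rewrite (uh p tp) => /mulfI -> //.
by rewrite signr_eq0.
Qed.

Lemma sobolev_rep_continuous I k u U j : sobolev_rep I k u U -> (j < k)%N ->
  continuous (U j).
Proof. by move=> [pU _ _] jk; exact: primitive_continuous (pU _ jk). Qed.

Lemma sobolev_rep_weakr I k u U : open_interval I -> measurable_fun I u ->
  sobolev_rep I k u U -> forall j, (j <= k)%N -> weakr I j u (U j).
Proof.
move=> oI mu' [pU uU U2] j jk p tp; have mI := open_interval_measurable oI.
rewrite (@ae_eq_Rintegral_mul _ u (U 0%N))//; last 2 first.
- by have [] := U2 0%N.
- by apply: test_on_measurable; exact: (test_on_deriven j tp).
suff H i : (i + j <= k)%N -> \int[mu]_(x in I) (U i x * derive1n j p x) =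
  (-1) ^+ j * \int[mu]_(x in I) (U (i + j)%N x * p x) by exact: H.
elim: j i {jk} p tp => [|j IH] i p tp ijk; first by rewrite addn0 expr0 mul1r.
rewrite derive1nS (primitive_weak oI (pU _ _) (test_on_deriven j tp)); last first.
  by apply: leq_trans ijk; rewrite addnS ltnS leq_addr.
by rewrite IH// ?addSnnS// exprS mulN1r mulNr.
Qed.

(** The induction is on [g 1] rather than on u: the weak derivatives of [g 1] are the [g j.+1], and
    the du Bois-Reymond lemma integrates its representative once more to reach u. Local
    integrability of [U 0] is carried along because for k = 0 no [primitive] relation provides
    it. *)
Lemma weakr_sobolev_rep I k u (g : nat -> R -> R) : open_interval I -> sq_integrable I u ->
  (forall j, (j <= k)%N -> sq_integrable I (g j) /\ weakr I j u (g j)) ->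
  exists U, [/\ sobolev_rep I k u U, loc_integrable (U 0%N) &
    forall j, (j <= k)%N -> g j = U j %[ae mu in I]].
Proof.
move=> oI; have mI := open_interval_measurable oI.
elim: k u g => [|k IH] u g u2 gu.
  have [g2 ug] := gu _ (leqnn 0); exists (fun=> g 0%N \_ I); split.
  - split=> //.
      apply: ae_eq_trans (weakr0 oI u2 g2 ug) _; apply: ae_eq_sym.
      exact: restrict_ae.
    by move=> [|]// _; apply/sq_integrable_restrictE.
  - exact/sq_integrable_loc/sq_integrable_restrict.
  - by move=> [|]// _; apply: ae_eq_sym; exact: restrict_ae.
have [g12 ug1] := gu 1%N isT.
have [|U [[pU gU U2] lU gU']] := IH (g 1%N) (fun j => g j.+1) g12.
  move=> j jk; have [g2 ug] := gu j.+1 jk; split => // p tp.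
  have := ug1 _ (test_on_deriven j tp); rewrite /= -/(derive1n j.+1 p) ug//.
  by rewrite expr1 exprS !mulN1r mulNr => /oppr_inj.
have U02 := U2 0%N isT.
have [||p tp|V VU uV] := @dubois_reymond _ I (u \_ I) (U 0%N) oI.
- exact/sq_integrable_loc/sq_integrable_restrict.
- by [].
- rewrite restrict_Rintegral; have := ug1 p tp; rewrite /= => ->.
  rewrite expr1 mulN1r; congr (- _); apply: ae_eq_Rintegral_mul => //.
  + by case: g12.
  + by case: U02.
  + exact: test_on_measurable tp.
have uV' : u = V %[ae mu in I].
  by apply: ae_eq_trans uV; apply: ae_eq_sym; exact: restrict_ae.
have lV := continuous_loc_integrable (primitive_continuous VU).
have V2 : sq_integrable I V.
  apply: ae_eq_sq_integrable u2 => //; apply: measurable_funTS.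
  exact: loc_integrable_measurable.
exists (fun j => if j is j'.+1 then U j' else V); split => //.
- split => //; first by case=> // j jk; exact: pU.
  by case=> // j jk; exact: U2.
- case=> [_|j jk]; last exact: gU'.
  have [g02 ug0] := gu 0%N isT.
  by apply: ae_eq_trans uV'; apply: ae_eq_sym; exact: weakr0 ug0.
Qed.

End SobolevRepresentatives.

(** * Complex Sobolev functions and boundary values through real and imaginary parts *)

Section ComplexSobolev.
Variable R : realType.
Local Notation mu := (@lebesgue_measure R).
Implicit Types (I : set R) (f g u v w phi : R -> R[i]) (U V : nat -> R -> R).
Implicit Types (p q : R -> R).

Definition cfun p q : R -> R[i] := fun x => p x +i* q x.

Lemma cfunE f : f = cfun (re f) (im f).
Proof. by apply/funext => x; rewrite /cfun /re /im; case: (f x). Qed.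

Lemma L2P I u : measurable I ->
  L2 I u <-> sq_integrable I (re u) /\ sq_integrable I (im u).
Proof.
move=> mI; split=> [[mr mi fin]|[[mr r2] [mi i2]]].
  have i : mu.-integrable I (EFin \o (fun x => re u x ^+ 2 + im u x ^+ 2)).
    apply/integrableP; split.
      by apply/measurable_EFinP; apply: measurable_funD; exact: measurable_funX.
    under eq_integral do rewrite /= ger0_norm ?addr_ge0 ?sqr_ge0//.
    exact: fin.
  split; split => //; apply: le_integrable i => //.
  - by apply/measurable_EFinP; exact: measurable_funX.
  - by move=> x _; rewrite /= lee_fin !ger0_norm ?addr_ge0 ?sqr_ge0// lerDl sqr_ge0.
  - by apply/measurable_EFinP; exact: measurable_funX.
  - by move=> x _; rewrite /= lee_fin !ger0_norm ?addr_ge0 ?sqr_ge0// lerDr sqr_ge0.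
split => //; have /integrableP[_] := integrableD (mI : measurable (I : set (measurableTypeR R))) r2 i2.
apply: le_lt_trans; apply: ge0_le_integral => //.
- by move=> x _; rewrite lee_fin addr_ge0 ?sqr_ge0.
- by apply/measurable_EFinP; apply: measurable_funD; exact: measurable_funX.
- apply: measurableT_comp => //.
  by apply/measurable_EFinP; apply: measurable_funD; exact: measurable_funX.
- by move=> x _; rewrite /= lee_fin ler_norm.
Qed.

Lemma aeqP I f g : aeq I f g <->
  re f = re g %[ae mu in I] /\ im f = im g %[ae mu in I].
Proof.
split=> [fg|[fr fi]].
  by split; apply: (filterS (F := almost_everywhere mu)) fg => x fg Ix;
    rewrite /re /im fg.
apply: (filterS2 (F := almost_everywhere mu)) fr fi => x fr fi Ix.
by move: (fr Ix) (fi Ix); rewrite /re /im; case: (f x); case: (g x) => a b c d /= -> ->.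
Qed.

Lemma test_on_tsupport I p q : test_on I p -> test_on I q ->
  open_interval I -> test_function I (cfun p q).
Proof.
move=> [sp [a [b [ab Ia Ib p0]]]] [sq [c [d [cd Ic Id q0]]]] oI.
set m := Num.min a c; set M := Num.max b d.
have Im : I m by rewrite /m; case: (leP a c).
have IM : I M by rewrite /M; case: (leP b d).
have supp : tsupport (cfun p q) `<=` `[m, M].
  rewrite /tsupport; have := @itv_closed _ R m M; rewrite closure_id => ->.
  apply: closure_subset => x /= /eqP nz; rewrite in_itv/=.
  apply: contrapT => nx; apply: nz; rewrite /cfun.
  rewrite p0 ?q0//= => /andP[x1 x2]; apply: nx.
    by rewrite ge_min x1 le_max x2 !orbT.
  by rewrite ge_min x1 le_max x2.
split.
- by move=> n x; split; [exact: sp|exact: sq].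
- apply: (subclosed_compact _ (@segment_compact R m M)) => //.
  exact: closed_closure.
- by apply: subset_trans supp _; exact: interval_subset.
Qed.

Lemma test_functionP I phi : open_interval I ->
  test_function I phi <-> test_on I (re phi) /\ test_on I (im phi).
Proof.
move=> oI; split=> [[sphi cphi suppI]|[tr ti]]; last first.
  by rewrite [phi]cfunE; exact: test_on_tsupport.
have [a [b [ab Ia Ib phi0]]] : exists a b, [/\ a <= b, I a, I b &
    forall x, ~ (a <= x <= b) -> phi x = 0].
  (* The minimum and maximum of the support bound a nonempty compact support; for an empty one, any
     point of I serves as a degenerate segment. *)
  have [[x0 sx0]|/asboolPn/forallp_asboolPn e] := pselect (exists x, tsupport phi x).
    have ne : tsupport phi !=set0 by exists x0.
    have [M /set_mem sM maxM] := compact_EVT_max ne cphi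
      (continuous_subspaceT (fun x : R => @cvg_id _ (nbhs x))).
    have [m /set_mem sm minm] := compact_EVT_min ne cphi
      (continuous_subspaceT (fun x : R => @cvg_id _ (nbhs x))).
    exists m, M; split; [|exact: suppI|exact: suppI|].
      exact: minm (mem_set sM).
    move=> x nx; apply/eqP/negPn/negP => nz; apply: nx.
    have sx : x \in tsupport phi by apply/mem_set/subset_closure.
    by rewrite minm//= maxM.
  have [_ _ [z Iz]] := oI; exists z, z; split => // x _.
  by apply/eqP/negPn/negP => nz; apply: (e x); exact: subset_closure.
split; split; [by move=> n x; case: (sphi n x)| |by move=> n x; case: (sphi n x)|].
- by exists a, b; split => // x nx; rewrite /re phi0.
- by exists a, b; split => // x nx; rewrite /im phi0.
Qed.

Lemma ReM (x y : R[i]) : complex.Re (x * y) =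
  complex.Re x * complex.Re y - complex.Im x * complex.Im y.
Proof. by case: x; case: y. Qed.

Lemma ImM (x y : R[i]) : complex.Im (x * y) =
  complex.Re x * complex.Im y + complex.Im x * complex.Re y.
Proof. by case: x; case: y. Qed.

Lemma cintegralM I u v : measurable I ->
  mu.-integrable I (EFin \o (fun x => re u x * re v x)) ->
  mu.-integrable I (EFin \o (fun x => re u x * im v x)) ->
  mu.-integrable I (EFin \o (fun x => im u x * re v x)) ->
  mu.-integrable I (EFin \o (fun x => im u x * im v x)) ->
  cintegral I (fun x => u x * v x) =
  (\int[mu]_(x in I) (re u x * re v x) - \int[mu]_(x in I) (im u x * im v x))
  +i* (\int[mu]_(x in I) (re u x * im v x) + \int[mu]_(x in I) (im u x * re v x)).
Proof.
move=> mI i1 i2 i3 i4; rewrite /cintegral -RintegralB// -RintegralD//.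
by congr (_ +i* _); apply: eq_Rintegral => x _; rewrite /re /im ?ReM ?ImM.
Qed.

Lemma sq_integrable_test I p (u : R -> R) : open_interval I -> sq_integrable I u ->
  test_on I p -> mu.-integrable I (EFin \o (fun x => u x * p x)).
Proof.
move=> oI u2 tp; have mI := open_interval_measurable oI.
have := test_on_int oI tp (sq_integrable_loc (sq_integrable_restrict mI u2)).
by apply: eq_integrable => // x xI /=; rewrite patchE xI.
Qed.

Lemma weak_derivativeP I n u g : open_interval I -> L2 I u -> L2 I g ->
  weak_derivative I n u g <->
  weakr I n (re u) (re g) /\ weakr I n (im u) (im g).
Proof.
move=> oI; have mI := open_interval_measurable oI.
move=> /(L2P _ mI)[ru2 iu2] /(L2P _ mI)[rg2 ig2].
(* The test functions p + i0 are enough to separate the real and imaginary parts of the identity. *)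
have t0 : test_on I (fun=> 0 : R).
  split; first exact: smoothr_cst.
  by have [_ _ [z Iz]] := oI; exists z, z.
have E1 phi : test_function I phi ->
   cintegral I (fun x => u x * cderiv n phi x) =
   (\int[mu]_(x in I) (re u x * derive1n n (re phi) x) -
    \int[mu]_(x in I) (im u x * derive1n n (im phi) x)) +i*
   (\int[mu]_(x in I) (re u x * derive1n n (im phi) x) +
    \int[mu]_(x in I) (im u x * derive1n n (re phi) x)).
  move=> /(test_functionP _ oI)[tr ti].
  by rewrite cintegralM//; apply: sq_integrable_test => //; exact: test_on_deriven.
have E2 phi : test_function I phi ->
   cintegral I (fun x => g x * phi x) =
   (\int[mu]_(x in I) (re g x * re phi x) -
    \int[mu]_(x in I) (im g x * im phi x)) +i*
   (\int[mu]_(x in I) (re g x * im phi x) +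
    \int[mu]_(x in I) (im g x * re phi x)).
  move=> /(test_functionP _ oI)[tr ti].
  by rewrite cintegralM//; exact: sq_integrable_test.
have sgn (a b : R) : (-1) ^+ n * (a +i* b) = ((-1) ^+ n * a) +i* ((-1) ^+ n * b).
  rewrite -signr_odd -[(-1 : R) ^+ n]signr_odd.
  by case: (odd n); rewrite ?expr1 ?expr0 ?mulN1r ?mul1r.
split=> [ug|[rug iug] phi tphi]; last first.
  rewrite E1// E2// sgn; move/(test_functionP _ oI) : tphi => [tr ti].
  rewrite (rug _ tr) (rug _ ti) (iug _ tr) (iug _ ti).
  by rewrite mulrBr mulrDr.
have D0 : derive1n n (fun=> 0 : R) = fun=> 0.
  elim: n {ug E1 sgn} => [//|n IH]; rewrite derive1nS IH.
  by apply/funext => x; rewrite derive1_cst.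
have int0 (f : R -> R) : \int[mu]_(x in I) (f x * 0) = 0.
  under eq_Rintegral do rewrite mulr0.
  by rewrite Rintegral_cst// mul0r.
split=> p tp; have tphi := test_on_tsupport tp t0 oI;
  move: (ug _ tphi); rewrite E1// E2// sgn /= D0 !int0 => -[].
  by rewrite !subr0.
by rewrite !add0r.
Qed.

(** [wderiv] is an arbitrary choice made by [xget]; uniqueness of weak derivatives in L^2 makes it
    agree almost everywhere with any known one. *)
Lemma wderivP I n u g : open_interval I -> L2 I u -> L2 I g ->
  weak_derivative I n u g ->
  [/\ L2 I (wderiv I n u), weak_derivative I n u (wderiv I n u) &
      aeq I (wderiv I n u) g].
Proof.
move=> oI u2 g2 ug; have mI := open_interval_measurable oI.
have [w2 uw] : [set h | L2 I h /\ weak_derivative I n u h] (wderiv I n u).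
  by apply: xgetPex; exists g.
split => //.
have /(weak_derivativeP _ oI u2 g2)[r1 i1] := ug.
have /(weak_derivativeP _ oI u2 w2)[r2 i2] := uw.
have /(L2P _ mI)[rg2 ig2] := g2; have /(L2P _ mI)[rw2 iw2] := w2.
by apply/aeqP; split; apply: weakr_unique; eassumption.
Qed.

Lemma sobolevP I k u : open_interval I -> sobolev I k u <->
  L2 I u /\ exists U V, sobolev_rep I k (re u) U /\ sobolev_rep I k (im u) V.
Proof.
move=> oI; have mI := open_interval_measurable oI.
split=> [[u2 ug]|[u2 [U [V [rU iV]]]]]; split => //.
  have /choice[g Hg] j : exists h, (j <= k)%N -> L2 I h /\ weak_derivative I j u h.
    have [jk|kj] := leqP j k; last by exists u.
    by have [h h2 uh] := ug j jk; exists h.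
  have /(L2P _ mI)[ru2 iu2] := u2.
  have [|U [rU _ _]] := @weakr_sobolev_rep _ I k (re u) (fun j => re (g j)) oI ru2.
    move=> j jk; have [g2 /(weak_derivativeP _ oI u2 g2)[? _]] := Hg j jk.
    by have /(L2P _ mI)[? _] := g2.
  have [|V [iV _ _]] := @weakr_sobolev_rep _ I k (im u) (fun j => im (g j)) oI iu2.
    move=> j jk; have [g2 /(weak_derivativeP _ oI u2 g2)[_ ?]] := Hg j jk.
    by have /(L2P _ mI)[_ ?] := g2.
  by exists U, V.
move=> j jk; have g2 : L2 I (cfun (U j) (V j)).
  by apply/(L2P _ mI); split; [case: rU|case: iV] => _ _; apply.
exists (cfun (U j) (V j)) => //; apply/(weak_derivativeP _ oI u2 g2).
have [mr mi _] := u2.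
by split; [exact: sobolev_rep_weakr rU _ _|exact: sobolev_rep_weakr iV _ _].
Qed.

Lemma wderiv_rep I k u U V : open_interval I -> L2 I u ->
  sobolev_rep I k (re u) U -> sobolev_rep I k (im u) V ->
  forall j, (j <= k)%N ->
  L2 I (wderiv I j u) /\ aeq I (wderiv I j u) (cfun (U j) (V j)).
Proof.
move=> oI u2 rU iV j jk; have mI := open_interval_measurable oI.
have g2 : L2 I (cfun (U j) (V j)).
  by apply/(L2P _ mI); split; [case: rU|case: iV] => _ _; apply.
have [mr mi _] := u2.
have ug : weak_derivative I j u (cfun (U j) (V j)).
  apply/(weak_derivativeP _ oI u2 g2).
  by split; [exact: sobolev_rep_weakr rU _ _|exact: sobolev_rep_weakr iV _ _].
by have [] := wderivP oI u2 g2 ug.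
Qed.

Lemma continuous_ae_eq I p q : open I -> {within I, continuous p} ->
  {within I, continuous q} -> p = q %[ae mu in I] -> forall x, I x -> p x = q x.
Proof.
move=> oI cp cq pq x Ix.
have {}cp : {for x, continuous p}.
  by move: cp; rewrite continuous_open_subspace// => /(_ x); apply; rewrite inE.
have {}cq : {for x, continuous q}.
  by move: cq; rewrite continuous_open_subspace// => /(_ x); apply; rewrite inE.
apply: contrapT => /eqP; rewrite -subr_eq0 => nz.
have cpq : {for x, continuous (fun y => p y - q y)} by exact: cvgB.
have [e /= e0 He] : nbhs x [set y | I y /\ p y - q y != 0].
  apply: filterI; first exact: open_nbhs_nbhs.
  exact: cvgr_neq0 cpq nz.
have [N [mN N0 subN]] := pq.
set B := `]x - e, x + e[%classic.
have ballN : B `<=` N.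
  move=> y; rewrite /B/= in_itv/= => /andP[y1 y2]; apply: subN => /= H.
  have [|Iy /eqP] := He y; first by rewrite /ball_/= ltr_norml; lra.
  by rewrite H// subrr.
have : (mu B <= mu N)%E.
  apply: le_measure => //; rewrite inE//; exact: measurable_itv.
rewrite N0 /B lebesgue_measure_itv/= lte_fin ifT; last lra.
by rewrite -EFinD lee_fin; lra.
Qed.

(** Two continuous representatives agree everywhere on the open set I, so the limit found by [xget]
    cannot depend on the one chosen. The filter F stands for either one-sided neighbourhood filter
    of 0. *)
Lemma boundary_valueE I (F : set_system R) w p q : open I -> ProperFilter F ->
  F I -> F `=>` nbhs (0 : R) -> continuous p -> continuous q ->
  aeq I w (cfun p q) -> boundary_value I F w = p 0 +i* q 0.
Proof.
move=> oI PF FI F0 cp cq wpq.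
have cvgF (f : R -> R) : continuous f -> f @ F --> f 0.
  by move=> cf; apply: cvg_trans (cf 0); exact: cvg_app.
rewrite /boundary_value; apply: xget_unique.
  exists (cfun p q); split; [by []|split|exact: cvgF|exact: cvgF].
    exact: continuous_subspaceT.
  exact: continuous_subspaceT.
move=> z [g [wg [cgr cgi] gr gi]].
have /aeqP[er ei] : aeq I g (cfun p q).
  apply: (filterS2 (F := almost_everywhere mu)) wg wpq => x wg wpq Ix.
  by rewrite -wg// wpq.
have gpr : forall x, I x -> re g x = p x.
  by apply: continuous_ae_eq => //; exact: continuous_subspaceT.
have gqi : forall x, I x -> im g x = q x.
  by apply: continuous_ae_eq => //; exact: continuous_subspaceT.
have zr : complex.Re z = p 0.
  apply: (cvg_unique (@norm_hausdorff _ R) gr).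
  apply: cvg_trans (cvgF _ cp); apply: near_eq_cvg.
  by apply: filterS FI => x Ix; rewrite gpr.
have zi : complex.Im z = q 0.
  apply: (cvg_unique (@norm_hausdorff _ R) gi).
  apply: cvg_trans (cvgF _ cq); apply: near_eq_cvg.
  by apply: filterS FI => x Ix; rewrite gqi.
by move: zr zi; case: z {gr gi} => a b /= -> ->.
Qed.

End ComplexSobolev.

(** * Green's formula on the half-lines *)

Section HalfLines.
Variable R : realType.
Local Notation mu := (@lebesgue_measure R).
Local Notation Im := (@Iminus R).
Local Notation Ip := (@Iplus R).
Implicit Types (f g h u v w p q B b F G : R -> R) (x al be : R).
Implicit Types (U V : nat -> R -> R) (j k n : nat).

Lemma plusE x : Ip x = (0 < x) :> Prop.
Proof. by rewrite /Ip /= in_itv/= andbT. Qed.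

Lemma minusE x : Im x = (x < 0) :> Prop.
Proof. by rewrite /Im /= in_itv/=. Qed.

Lemma open_interval_minus : open_interval Im.
Proof.
split; first exact: interval_open.
- by move=> x y; rewrite !minusE => x0 y0 z /andP[_ zy]; rewrite minusE (le_lt_trans zy).
- by exists (-1); rewrite minusE; lra.
Qed.

Lemma open_interval_plus : open_interval Ip.
Proof.
split; first exact: interval_open.
- by move=> x y; rewrite !plusE => x0 y0 z /andP[xz _]; rewrite plusE (lt_le_trans x0).
- by exists 1; rewrite plusE; lra.
Qed.

Lemma open_interval_setT : open_interval [set: R].
Proof. by split => //; [exact: openT|exists 0]. Qed.

Lemma measurable_plus : measurable Ip. Proof. exact: measurable_itv. Qed.
Lemma measurable_minus : measurable Im. Proof. exact: measurable_itv. Qed.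

Lemma preimage_opp_minus : -%R @^-1` Im = Ip.
Proof. by apply/seteqP; split => x; rewrite /Im /Ip /= !in_itv/= oppr_lt0 andbT. Qed.

Lemma preimage_opp_plus : -%R @^-1` Ip = Im.
Proof. by apply/seteqP; split => x; rewrite /Im /Ip /= !in_itv/= oppr_gt0 andbT. Qed.

(* Integrating b (1 - x / n) on [0, n] by parts avoids any discussion of the
   limit of B at infinity. *)
Lemma half_line_FTC B b : primitive B b -> mu.-integrable Ip (EFin \o b) ->
  mu.-integrable Ip (EFin \o B) -> \int[mu]_(x in Ip) b x = - B 0.
Proof.
move=> Bb ib iB.
have cB := primitive_continuous Bb; have [lb eB] := Bb; have mI := measurable_plus.
pose chi n x : R := 1 - x / n.+1%:R.
pose f_ n x := ((if x < n.+1%:R then b x * chi n x else 0))%:E.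
have cchi n : continuous (chi n).
  by move=> x; apply: cvgB; [exact: cvg_cst|apply: cvgM; [exact: cvg_id|exact: cvg_cst]].
have mb := loc_integrable_measurable lb.
have [|||||_ _ cvf] := @dominated_convergence _ _ _ mu Ip
    measurable_plus f_ (fun x => (b x)%:E) (fun x => `|b x|%:E).
- move=> n; apply/measurable_EFinP; apply: measurable_funTS.
  apply: measurable_fun_ifT => //; first exact: measurable_fun_ltr.
  by apply: measurable_funM => //; exact: continuous_measurable_fun.
- by apply/measurable_EFinP; exact: measurable_funTS.
- apply: aeW => x; rewrite plusE => x0; apply: cvg_EFin; first by near=> n.
  apply: (@cvg_trans _ ((fun n => b x * chi n x) @ \oo)).
    apply: near_eq_cvg; near=> n; rewrite /f_ /= ifT//.
    apply: lt_le_trans (truncnS_gt x) _; rewrite ler_nat ltnS.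
    by near: n; exact: nbhs_infty_ge.
  suff : b x * chi n x @[n --> \oo] --> b x * 1 by rewrite mulr1.
  apply: cvgM; first exact: cvg_cst.
  rewrite -[X in _ --> X]subr0; apply: cvgB; first exact: cvg_cst.
  rewrite -(mulr0 x); apply: cvgM; first exact: cvg_cst.
  exact: cvg_harmonic.
- exact: integrable_norm.
- apply: aeW => x n; rewrite plusE => x0; rewrite /f_; case: ifPn => xn; last first.
    by rewrite /= lee_fin normr0.
  rewrite /= lee_fin normrM ler_piMr// /chi.
  have : 0 < x / n.+1%:R by rewrite divr_gt0.
  have : x / n.+1%:R < 1 by rewrite ltr_pdivrMr ?mul1r.
  by move: (x / n.+1%:R) => t t1 t0; rewrite ger0_norm; lra.
(* Since [chi n] vanishes at n+1 and equals 1 at 0, integration by parts leaves - B 0 and the mean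
   of B over [0, n+1], which is at most the L^1 norm of B divided by n+1. *)
have E n : \int[mu]_(x in Ip) fine (f_ n x) =
    - B 0 + n.+1%:R^-1 * \int[mu]_(x in `[0, n.+1%:R]) B x.
  have n0 : 0 <= n.+1%:R :> R by [].
  have lBchi : primitive (chi n) (fun=> - n.+1%:R^-1).
    apply: primitiveC1 => [x|x]; last exact: cst_continuous.
    rewrite /chi.
    have d : is_derive x 1 (cst 1 - n.+1%:R^-1 \*: (@id R)) (0 - n.+1%:R^-1 *: 1).
      exact: is_deriveB.
    rewrite (_ : (fun y => 1 - y / n.+1%:R) = (cst 1 - n.+1%:R^-1 \*: (@id R))).
      by move: d; rewrite sub0r /GRing.scale/= mulr1.
    by apply/funext => y /=; rewrite mulrC.
  have [lp /(_ _ _ n0)] := primitiveM Bb lBchi.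
  rewrite {1 2}/chi mul0r subr0 mulr1 divff ?pnatr_eq0// subrr mulr0 sub0r => ->.
  have lbc := loc_integrableM lb (cchi n).
  have lB := continuous_loc_integrable cB.
  rewrite RintegralD//; last first.
    by apply: (@loc_integrableM _ _ (cst _)) => //; exact: cst_continuous.
  rewrite RintegralZr// mulrN mulrC subrK.
  rewrite (@Rintegral_supp _ Ip `]0, n.+1%:R[%classic).
  - rewrite -Rintegral_itv_bndo_bndc; last first.
      by apply: integrableS (lbc 0 n.+1%:R) => //; exact: subset_itv_co_cc.
    rewrite -Rintegral_itv_obnd_cbnd; last first.
      by apply: integrableS (lbc 0 n.+1%:R) => //; exact: subset_itv_oo_cc.
    by apply: eq_Rintegral => x; rewrite inE/= in_itv/= /f_ => /andP[_ ->].
  - by move=> x /=; rewrite in_itv/= plusE => /andP[].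
  - move=> x; rewrite plusE /= in_itv/= /f_ => -> /negP /=.
    by case: ifP.
have lim1 : \int[mu]_(x in Ip) fine (f_ n x) @[n --> \oo] --> \int[mu]_(x in Ip) b x.
  apply: fine_cvg; rewrite fineK; last exact: integrable_fin_num.
  by apply: cvg_trans cvf; apply: near_eq_cvg; near=> n.
have lim2 : \int[mu]_(x in Ip) fine (f_ n x) @[n --> \oo] --> - B 0.
  rewrite (_ : (fun n => _) = (fun n => - B 0 + n.+1%:R^-1 *
      \int[mu]_(x in `[0, n.+1%:R]) B x)); last by apply/funext => n; exact: E.
  rewrite -[X in _ --> X]addr0; apply: cvgD; first exact: cvg_cst.
  set K := \int[mu]_(x in Ip) `|B x|.
  have KB n : `|\int[mu]_(x in `[0, n.+1%:R]) B x| <= K.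
    have lB := continuous_loc_integrable cB.
    apply: le_trans (le_normr_Rintegral _ (lB _ _)) _ => //.
    have lnB := loc_integrable_norm lB.
    rewrite -Rintegral_itv_obnd_cbnd; last first.
      by apply: integrableS (lnB 0 n.+1%:R) => //; exact: subset_itv_oc_cc.
    apply: le_Rintegral_subset => //; last exact: integrable_norm.
    by move=> x /=; rewrite in_itv/= plusE => /andP[].
  apply/cvgr0Pnorm_le => e e0; near=> n.
  rewrite normrM; apply: le_trans (ler_wpM2l (normr_ge0 _) (KB n)) _.
  rewrite gtr0_norm// mulrC ler_pdivrMr//.
  rewrite mulrC -ler_pdivrMr//; apply: le_trans (ltW (truncnS_gt _)) _.
  by rewrite ler_nat ltnS; near: n; exact: nbhs_infty_ge.
exact: (cvg_unique (@norm_hausdorff _ R) lim1 lim2).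
Unshelve. all: by end_near. Qed.

Lemma primitive_reflect F f : primitive F f ->
  primitive (fun x => F (- x)) (fun x => - f (- x)).
Proof.
move=> /primitive_opp/(primitiveZ (-1)) Ff.
by apply: primitive_ext Ff _ _ => x; rewrite mulN1r ?opprK.
Qed.

Definition reflect_rep U j x : R := (-1) ^+ j * U j (- x).

Lemma ae_reflect I f g : f = g %[ae mu in I] ->
  (fun x => f (- x)) = (fun x => g (- x)) %[ae mu in -%R @^-1` I].
Proof.
move=> [N [mN N0 subN]]; exists (-%R @^-1` N); split.
- by rewrite -[X in measurable X]setTI; exact: oppr_measurable.
- by rewrite -[RHS]N0; exact: lebesgue_measureN.
- by move=> x /= H; apply: subN => /= H'; apply: H.
Qed.

Lemma sobolev_rep_reflect I k u U : measurable I -> sobolev_rep I k u U ->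
  sobolev_rep (-%R @^-1` I) k (fun x => u (- x)) (reflect_rep U).
Proof.
move=> mI [pU uU U2]; have mI' : measurable (-%R @^-1` I).
  by rewrite -[X in measurable X]setTI; exact: oppr_measurable.
split=> [j jk||j jk].
- have H := primitiveZ ((-1) ^+ j) (primitive_reflect (pU _ jk)).
  apply: primitive_ext H _ _ => x //.
  by rewrite /reflect_rep exprS; lra.
- apply: ae_eq_trans (ae_reflect uU) _; apply: aeW => x _.
  by rewrite /reflect_rep expr0 mul1r.
- by apply: sq_integrableZ => //; apply: sq_integrable_opp => //; exact: U2.
Qed.

Definition green_form al be U V : R :=
  al * (U 2%N 0 * V 0%N 0 - U 1%N 0 * V 1%N 0 + U 0%N 0 * V 2%N 0) +
  be * (U 0%N 0 * V 0%N 0).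

Lemma green_plus al be u v U V :
  sobolev_rep Ip 3 u U -> sobolev_rep Ip 3 v V ->
  \int[mu]_(x in Ip) ((al * U 3%N x + be * U 1%N x) * V 0%N x) +
  \int[mu]_(x in Ip) (U 0%N x * (al * V 3%N x + be * V 1%N x)) =
  - green_form al be U V.
Proof.
move=> [pU _ U2] [pV _ V2]; have mI := measurable_plus.
have i j k : (j <= 3)%N -> (k <= 3)%N -> mu.-integrable Ip (EFin \o (fun x => U j x * V k x)).
  by move=> j3 k3; apply: sq_integrableM => //; [exact: U2|exact: V2].
have iZ c j k : (j <= 3)%N -> (k <= 3)%N ->
    mu.-integrable Ip (EFin \o (fun x => c * (U j x * V k x))).
  by move=> j3 k3; exact: (integrableZl _ c (i j k j3 k3)).
have iD f g : mu.-integrable Ip (EFin \o f) -> mu.-integrable Ip (EFin \o g) ->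
    mu.-integrable Ip (EFin \o (fun x => f x + g x)).
  by move=> fi gi; exact: (integrableD _ fi gi).
(* B is the bilinear concomitant at the point x: its derivative is the sum b of the two integrands,
   and all products U j * V k being integrable, [half_line_FTC] applies to it. *)
pose B x := al * (U 2%N x * V 0%N x) + (- al * (U 1%N x * V 1%N x) +
  (al * (U 0%N x * V 2%N x) + be * (U 0%N x * V 0%N x))).
pose b x := ((al * U 3%N x + be * U 1%N x) * V 0%N x) +
   (U 0%N x * (al * V 3%N x + be * V 1%N x)).
have i1 : mu.-integrable Ip (EFin \o (fun x => (al * U 3%N x + be * U 1%N x) * V 0%N x)).
  rewrite (_ : (fun x => _) = (fun x => al * (U 3%N x * V 0%N x) + be * (U 1%N x * V 0%N x))).
    exact: (iD _ _ (iZ _ _ _ _ _) (iZ _ _ _ _ _)).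
  by apply/funext => x; lra.
have i2 : mu.-integrable Ip (EFin \o (fun x => U 0%N x * (al * V 3%N x + be * V 1%N x))).
  rewrite (_ : (fun x => _) = (fun x => al * (U 0%N x * V 3%N x) + be * (U 0%N x * V 1%N x))).
    exact: (iD _ _ (iZ _ _ _ _ _) (iZ _ _ _ _ _)).
  by apply/funext => x; lra.
rewrite -RintegralD//.
have -> : green_form al be U V = B 0 by rewrite /green_form /B; lra.
apply: half_line_FTC; last 2 first.
- exact: iD i1 i2.
- exact: (iD _ _ (iZ _ _ _ _ _) (iD _ _ (iZ _ _ _ _ _) (iD _ _ (iZ _ _ _ _ _) (iZ _ _ _ _ _)))).
have p01 := pU 0%N isT; have p12 := pU 1%N isT; have p23 := pU 2%N isT.
have q01 := pV 0%N isT; have q12 := pV 1%N isT; have q23 := pV 2%N isT.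
have H := primitiveD (primitiveZ al (primitiveM p23 q01))
  (primitiveD (primitiveZ (- al) (primitiveM p12 q12))
  (primitiveD (primitiveZ al (primitiveM p01 q23)) (primitiveZ be (primitiveM p01 q01)))).
by apply: primitive_ext H _ _ => x //=; lra.
Qed.

Lemma reflect_Rintegral f : mu.-integrable Im (EFin \o f) ->
  \int[mu]_(x in Ip) f (- x) = \int[mu]_(x in Im) f x.
Proof.
move=> fi; have [_] := lebesgue_integrable_opp measurable_minus fi.
by rewrite preimage_opp_minus.
Qed.

(** Reflection changes the sign of al u''' + be u', whose terms have odd order, and leaves the form
    at 0 unchanged, whose terms have even total order; hence the sign opposite to [green_plus]. *)
Lemma green_minus al be u v U V :
  sobolev_rep Im 3 u U -> sobolev_rep Im 3 v V ->
  \int[mu]_(x in Im) ((al * U 3%N x + be * U 1%N x) * V 0%N x) +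
  \int[mu]_(x in Im) (U 0%N x * (al * V 3%N x + be * V 1%N x)) =
  green_form al be U V.
Proof.
move=> uU vV; have mI := measurable_minus.
have /(sobolev_rep_reflect mI) := uU; rewrite preimage_opp_minus => uU'.
have /(sobolev_rep_reflect mI) := vV; rewrite preimage_opp_minus => vV'.
have [_ _ U2] := uU; have [_ _ V2] := vV.
have s (W : nat -> R -> R) : (forall j, (j <= 3)%N -> sq_integrable Im (W j)) ->
    sq_integrable Im (fun x => al * W 3%N x + be * W 1%N x).
  by move=> W2; apply: sq_integrableD => //; apply: sq_integrableZ => //; exact: W2.
have i1 : mu.-integrable Im (EFin \o (fun x => (al * U 3%N x + be * U 1%N x) * V 0%N x)).
  by apply: sq_integrableM => //; [exact: s|exact: V2].
have i2 : mu.-integrable Im (EFin \o (fun x => U 0%N x * (al * V 3%N x + be * V 1%N x))).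
  by apply: sq_integrableM => //; [exact: U2|exact: s].
have refl f g : mu.-integrable Im (EFin \o f) -> (forall x, g x = - f (- x)) ->
    \int[mu]_(x in Ip) g x = - \int[mu]_(x in Im) f x.
  move=> fi gf; rewrite -reflect_Rintegral// -mulN1r -RintegralZl//.
  - by apply: eq_Rintegral => x _; rewrite gf mulN1r.
  - exact: measurable_plus.
  have [] := lebesgue_integrable_opp measurable_minus fi.
  by rewrite preimage_opp_minus.
have signs : (-1) ^+ 0 = 1 :> R /\ (-1) ^+ 1 = -1 :> R /\ (-1) ^+ 2 = 1 :> R /\ (-1) ^+ 3 = -1 :> R.
  by rewrite expr0 expr1 sqrrN expr1n (exprS _ 2) sqrrN expr1n mulr1.
case: signs => s0 [s1 [s2 s3]].
have := green_plus al be uU' vV'.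
rewrite (refl _ _ i1); last by move=> x; rewrite /reflect_rep s0 s1 s3; lra.
rewrite (refl _ _ i2); last by move=> x; rewrite /reflect_rep s0 s1 s3; lra.
rewrite /green_form /reflect_rep !oppr0 s0 s1 s2; lra.
Qed.

End HalfLines.

(** * Regularity of weak solutions up to the vertex *)

Section Regularity.
Variable R : realType.
Local Notation mu := (@lebesgue_measure R).
Local Notation Im := (@Iminus R).
Local Notation Ip := (@Iplus R).
Implicit Types (f g h m u v w p q B b F G W : R -> R) (x al be c : R).
Implicit Types (U V : nat -> R -> R) (e : {poly R}) (j k n : nat).

Lemma test_on_integralZD I c f g p : open_interval I -> loc_integrable f ->
  loc_integrable g -> test_on I p ->
  \int[mu]_(x in I) ((f x + c * g x) * p x) =
  \int[mu]_(x in I) (f x * p x) + c * \int[mu]_(x in I) (g x * p x).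
Proof.
move=> oI lf lg tp; have mI := open_interval_measurable oI.
have fp := test_on_int oI tp lf; have gp := test_on_int oI tp lg.
rewrite -RintegralZl//.
rewrite -RintegralD//; first by apply: eq_Rintegral => x _; lra.
exact: (integrableZl _ c gp).
Qed.

Lemma loc_integrable_primitive F f : primitive F f -> loc_integrable F.
Proof. by move=> Ff; exact/continuous_loc_integrable/primitive_continuous/Ff. Qed.

(* With W a primitive of the right-hand side, the equation
   (al v'' + be v + W)' = 0 is integrated three times. *)
Lemma weak_third_order_integrate I al be v W w : open_interval I -> al != 0 ->
  loc_integrable v -> primitive W w ->
  (forall p, test_on I p ->
     al * \int[mu]_(x in I) (v x * derive1n 3 p x) +
     be * \int[mu]_(x in I) (v x * derive1n 1 p x) =
     \int[mu]_(x in I) (w x * p x)) ->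
  exists c (V0 V1 : R -> R), [/\ primitive V0 V1,
    primitive V1 (fun x => - al^-1 * (W x + be * v x) + c) &
    v = V0 %[ae mu in I]].
Proof.
move=> oI al0 lv Ww vw; have lW := loc_integrable_primitive Ww.
have mI := open_interval_measurable oI.
have [lw _] := Ww.
have i1 u p : loc_integrable u -> test_on I p ->
  mu.-integrable I (EFin \o (fun x => u x * p x)) by move=> *; exact: test_on_int.
have lin u (k : R) p q : loc_integrable u -> test_on I p -> test_on I q ->
    \int[mu]_(x in I) (u x * (p x + k * q x)) =
    \int[mu]_(x in I) (u x * p x) + k * \int[mu]_(x in I) (u x * q x).
  move=> lu tp tq; have up := i1 _ _ lu tp; have uq := i1 _ _ lu tq.
  rewrite -RintegralZl// -RintegralD//; first by apply: eq_Rintegral => x _; lra.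
  exact: (integrableZl _ k uq).
have dlin n (k : R) p q : test_on I p -> test_on I q ->
    derive1n n (fun x => p x + k * q x) = fun x => derive1n n p x + k * derive1n n q x.
  move=> [sp _] [sq _]; rewrite (derive1nD n sp (smoothrZ (k := k) sq)).
  by rewrite (derive1nZ n k sq).
have alg1 (a b c d k : R) : al * (a + k * b) + (c + k * d) = al * a + c + k * (al * b + d).
  by ring.
have alg2 (a b : R) : al * a + (- (al * a + be * b) + be * b) = 0 by ring.
have alg4 (a b c d k : R) : a + k * b + (c + k * d) = a + c + k * (b + d) by ring.
have alg5 (a b : R) : a = - (b - (a + b)) by ring.
have alg3 (a b c s : R) : al * a + b = c * s -> a = c / al * s - al^-1 * b.
  by move=> E; rewrite mulrAC -E; field.
have lh : loc_integrable (fun x => W x + be * v x).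
  exact: loc_integrableD lW (loc_integrableZ be lv).
(* This functional kills p' because of the equation: W integrated against p' gives minus the
   integral of w p. The constant c1 obtained here is the first constant of integration. *)
have [k p q tp tq|p tp|c1 Hc1] := @functional_dubois_reymond _ I
  (fun p => al * \int[mu]_(x in I) (v x * derive1n 2 p x) +
            \int[mu]_(x in I) ((W x + be * v x) * p x)) oI.
- rewrite (dlin 2%N k p q tp tq) (lin _ k _ _ lv (test_on_deriven 2 tp) (test_on_deriven 2 tq))
    (lin _ k _ _ lh tp tq).
  exact: alg1.
- have tp1 := test_on_derive tp.
  rewrite (test_on_integralZD be oI lW lv tp1) (primitive_weak oI Ww tp).
  rewrite -(vw p tp); exact: alg2.
pose c := c1 / al.
pose g2 x := - al^-1 * (W x + be * v x) + c.
have lg2 : loc_integrable g2.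
  exact: loc_integrableD (loc_integrableZ _ lh) (loc_integrable_cst c).
have [G2 G2g2] := primitive_exists lg2; have lG2 := loc_integrable_primitive G2g2.
have v2 p : test_on I p -> \int[mu]_(x in I) (v x * derive1n 2 p x) =
    \int[mu]_(x in I) (g2 x * p x).
  move=> tp; have := Hc1 p tp.
  have -> : \int[mu]_(x in I) (g2 x * p x) = c * \int[mu]_(x in I) p x
      - al^-1 * \int[mu]_(x in I) ((W x + be * v x) * p x).
    transitivity (\int[mu]_(x in I) ((c + - al^-1 * (W x + be * v x)) * p x)).
      by apply: eq_Rintegral => x _; rewrite /g2 addrC.
    rewrite (test_on_integralZD (- al^-1) oI (loc_integrable_cst c) lh tp).
    rewrite mulNr; congr (_ - _); rewrite RintegralZl//.
    by have := i1 _ _ (loc_integrable_cst 1) tp; under eq_fun do rewrite mul1r.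
  exact: alg3.
(* The previous step says that v'' = g2 weakly; this functional expresses v' = G2 up to a constant,
   absorbed into V1 below. *)
have [k p q tp tq|p tp|c2 Hc2] := @functional_dubois_reymond _ I
  (fun p => \int[mu]_(x in I) (v x * derive1n 1 p x) +
            \int[mu]_(x in I) (G2 x * p x)) oI.
- rewrite (dlin 1%N k p q tp tq) (lin _ k _ _ lv (test_on_deriven 1 tp) (test_on_deriven 1 tq))
    (lin _ k _ _ lG2 tp tq).
  exact: alg4.
- by rewrite (primitive_weak oI G2g2 tp); have := v2 p tp; rewrite /= => ->; rewrite subrr.
pose V1 x := G2 x + - c2.
have V1g2 : primitive V1 g2 by exact: primitive_addc.
have [p tp|V0 V01 vV] := dubois_reymond oI lv (loc_integrable_primitive V1g2).
  have -> : \int[mu]_(x in I) (V1 x * p x) =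
     \int[mu]_(x in I) (G2 x * p x) - c2 * \int[mu]_(x in I) p x.
    transitivity (\int[mu]_(x in I) ((G2 x + - c2 * 1) * p x)).
      by apply: eq_Rintegral => x _; rewrite mulr1.
    rewrite (test_on_integralZD (- c2) oI lG2 (loc_integrable_cst 1) tp) mulNr.
    by under [X in _ - _ * X]eq_Rintegral do rewrite mul1r.
  rewrite -(Hc2 p tp); exact: alg5.
by exists c, V0, V1.
Qed.

Lemma Rintegral_unit_cst (a c : R) : \int[mu]_(t in `[a, a + 1]) c = c.
Proof.
have a1 : a <= a + 1 by lra.
have [_ /(_ _ _ a1) <-] : primitive (fun y => c * y) (fun=> c).
  apply: primitiveC1 => y; last exact: cst_continuous.
  have d : is_derive y 1 (c \*: (@id R)) (c *: 1) by exact: is_deriveZ.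
  by move: d; rewrite /GRing.scale/= mulr1.
by rewrite /=; lra.
Qed.

(** Cauchy-Schwarz on a window of length 1: with A the mean of |m|, integrate 2 A |m| <= A^2 +
    m^2. *)
Lemma sq_window m x : loc_integrable m -> loc_integrable (fun x => m x ^+ 2) ->
  (\int[mu]_(t in `[x, x + 1]) `|m t|) ^+ 2 <= \int[mu]_(t in `[x, x + 1]) (m t ^+ 2).
Proof.
move=> lm lm2; set A := Rintegral _ _ _; set B := Rintegral _ _ _.
have x1 : x <= x + 1 by lra.
have one := Rintegral_unit_cst x.
have lmn := loc_integrable_norm lm.
suff : 2 * A * A <= A ^+ 2 + B by rewrite expr2; lra.
rewrite -[X in X + _](one (A ^+ 2)) -RintegralD//; last exact: loc_integrable_cst.
rewrite -RintegralZl//; apply: le_Rintegral => //.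
- exact: (loc_integrableZ (2 * A) lmn).
- exact: (loc_integrableD (loc_integrable_cst (A ^+ 2)) lm2).
move=> t _ /=; rewrite -(real_normK (num_real (m t))).
have := sqr_ge0 (A - `|m t|); rewrite !expr2; lra.
Qed.

Lemma integrable_half_line_bounded f K : measurable_fun setT f ->
  (forall x, 0 <= f x) -> loc_integrable f ->
  (forall n, \int[mu]_(x in `[0, n%:R]) f x <= K) ->
  mu.-integrable Ip (EFin \o f).
Proof.
move=> mf f0 lf fK.
pose F n := `[0 : R, n%:R]%classic.
have : mu.-integrable (\bigcup_n F n) (EFin \o f).
  apply/integrableP; split.
    by apply/measurable_EFinP; exact: measurable_funTS.
  under eq_integral do rewrite /= ger0_norm//.
  have cv : (\int[mu]_(x in F n) (f x)%:E @[n --> \oo] --> \int[mu]_(x in \bigcup_n F n) (f x)%:E)%E.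
    apply: ge0_nondecreasing_set_cvg_integral.
    - move=> a b ab; rewrite subsetEset /F => x /=; rewrite !in_itv/= => /andP[-> /=].
      by move=> /le_trans; apply; rewrite ler_nat.
    - by move=> n; exact: measurable_itv.
    - by move=> n; apply/measurable_EFinP; exact: measurable_funTS.
    - by move=> n x _; rewrite lee_fin.
  apply: (@le_lt_trans _ _ K%:E); last exact: ltry.
  rewrite -(cvg_lim _ cv)//; apply: lime_le; first by apply/cvg_ex; eexists; exact: cv.
  apply: nearW => n; have lfn := lf 0 n%:R.
  have mF : measurable (F n) by exact: measurable_itv.
  rewrite -[leLHS]fineK; last exact: integrable_fin_num.
  by rewrite lee_fin; exact: fK.
apply: integrableS => //; first by apply: bigcup_measurable => n _; exact: measurable_itv.
  exact: measurable_plus.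
move=> x; rewrite plusE => x0; exists (Num.truncn x).+1 => //=.
by rewrite /F /= in_itv/= ltW//= ltW// truncnS_gt.
Qed.

(** With M a primitive of m^2 extended by zero, h^2 <= C^2 (M(x+1) - M(x)). The integral of the
    right-hand side over [0, n] telescopes to the integral of M over [n, n+1] minus that over
    [0, 1]. As M stays between M 0 and M 0 + K on the half-line, the difference is at most K,
    uniformly in n. This takes the place of exchanging the order of integration. *)
Lemma sq_integrable_window h m C : continuous h -> 0 <= C -> sq_integrable Ip m ->
  (forall x, 0 <= x -> `|h x| <= C * \int[mu]_(t in `[x, x + 1]) `|(m \_ Ip) t|) ->
  sq_integrable Ip h.
Proof.
move=> ch C0 m2 hm.
have mI := @measurable_plus R.
have mh : measurable_fun setT h by exact: continuous_measurable_fun.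
split; first exact: measurable_funTS.
have mr2 := sq_integrable_restrict mI m2; set r := m \_ Ip in mr2 hm.
have lr := sq_integrable_loc mr2.
have lr2 : loc_integrable (fun x => r x ^+ 2).
  by move=> a b; apply: integrableS mr2.2.
set K := \int[mu]_x (r x ^+ 2).
have [M Mm] := primitive_exists lr2; have cM := primitive_continuous Mm.
have [_ eM] := Mm.
have dM (a b : R) : a <= b -> 0 <= M b - M a <= K.
  move=> ab; rewrite eM//; apply/andP; split.
    by apply: Rintegral_ge0 => x _; exact: sqr_ge0.
  by apply: le_Rintegral_subset => //; [move=> x _; exact: sqr_ge0|exact: mr2.2].
have [N Nn] := primitive_exists (continuous_loc_integrable cM).
have [_ eN] := Nn.
have cshift : continuous (fun x : R => x + 1).
  by move=> x; apply: cvgD; [exact: cvg_id|exact: cvg_cst].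
have cMs : continuous (fun x => M (x + 1)).
  by move=> x; apply: continuous_comp; [exact: cshift|exact: cM].
have Ns : primitive (fun x => N (x + 1)) (fun x => M (x + 1)).
  apply: primitiveC1 => // x; rewrite -[M _]mulr1; apply: is_derive1_compose.
    by apply: primitive_derive Nn _; exact: cM.
  have d : is_derive x 1 ((@id R) + cst 1) (1 + 0) by exact: is_deriveD.
  by move: d; rewrite addr0.
have cD : continuous (fun x => C ^+ 2 * (M (x + 1) - M x)).
  move=> x; apply: cvgM; first exact: cvg_cst.
  by apply: cvgB; [exact: cMs|exact: cM].
have ch2 : continuous (fun x => h x ^+ 2).
  rewrite (_ : (fun x => h x ^+ 2) = fun x => h x * h x).
    by move=> x; apply: cvgM; exact: ch.
  by apply/funext => x; rewrite expr2.
apply: (@integrable_half_line_bounded _ (C ^+ 2 * K)).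
- exact: measurable_funX.
- by move=> x; exact: sqr_ge0.
- exact: continuous_loc_integrable.
move=> n; have n0 : 0 <= n%:R :> R by [].
apply: (@le_trans _ _ (\int[mu]_(x in `[0, n%:R]) (C ^+ 2 * (M (x + 1) - M x)))).
  apply: le_Rintegral => //.
  - exact: continuous_loc_integrable.
  - exact: continuous_loc_integrable.
  move=> x /=; rewrite in_itv/= => /andP[x0 _].
  rewrite eM; last lra.
  rewrite -(real_normK (num_real (h x))).
  apply: (@le_trans _ _ ((C * \int[mu]_(t in `[x, x + 1]) `|r t|) ^+ 2)).
    by rewrite lerXn2r ?nnegrE ?mulr_ge0 ?Rintegral_ge0//; exact: hm.
  rewrite exprMn ler_wpM2l ?sqr_ge0//; exact: sq_window.
have lMs := continuous_loc_integrable cMs; have lM := continuous_loc_integrable cM.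
have lMM : mu.-integrable `[0, n%:R] (EFin \o (fun x => M (x + 1) - M x)).
  by apply: continuous_loc_integrable => x; apply: cvgB; [exact: cMs|exact: cM].
rewrite RintegralZl// ler_wpM2l ?sqr_ge0// RintegralB//.
have [_ eNs] := Ns; rewrite -eNs// -eN// add0r.
have -> : N (n%:R + 1) - N 1 - (N n%:R - N 0) = (N (n%:R + 1) - N n%:R) - (N 1 - N 0) by lra.
have n1 : n%:R <= n%:R + 1 :> R by lra.
rewrite (eN _ _ n1) (eN 0 1)//.
have K0 : 0 <= K by apply: Rintegral_ge0 => x _; exact: sqr_ge0.
have one := Rintegral_unit_cst.
have u1 : \int[mu]_(x in `[n%:R, n%:R + 1]) M x <= M 0 + K.
  rewrite -[leRHS](one n%:R); apply: le_Rintegral => //; first exact: loc_integrable_cst.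
  move=> x /=; rewrite in_itv/= => /andP[nx _].
  by have /andP[_] := dM 0 x (le_trans n0 nx); lra.
have u2 : M 0 <= \int[mu]_(x in `[0, 1]) M x.
  have := one 0 (M 0); rewrite add0r => E; rewrite -[leLHS]E.
  apply: le_Rintegral => //; first exact: loc_integrable_cst.
  move=> x /=; rewrite in_itv/= => /andP[x0 _].
  by have /andP[] := dM 0 x x0; lra.
lra.
Qed.

Lemma primitive_horner_shift e x :
  primitive (fun t => e.[t - x]) (fun t => e^`().[t - x]).
Proof.
have cs : continuous (fun t : R => t - x).
  by move=> t; apply: cvgB; [exact: cvg_id|exact: cvg_cst].
apply: primitiveC1 => t; last first.
  apply: (@continuous_comp _ _ _ (fun t : R => t - x) (horner e^`())); first exact: cs.
  exact: continuous_horner.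
rewrite -[X in is_derive _ _ _ X]mulr1; apply: is_derive1_compose.
have d : is_derive t 1 ((@id R) - cst x) (1 - 0) by exact: is_deriveB.
by move: d; rewrite subr0.
Qed.

Lemma horner_bounded01 e : exists2 C, 0 <= C &
  forall s, 0 <= s <= 1 -> `|e.[s]| <= C.
Proof.
exists (\sum_(i < size e) `|e`_i|); first exact: sumr_ge0.
move=> s /andP[s0 s1]; rewrite horner_coef.
apply: le_trans (ler_norm_sum _ _ _) _; apply: ler_sum => i _.
by rewrite normrM ler_piMr// ger0_norm ?exprn_ge0// exprn_ile1.
Qed.

Lemma kernel_sq_integrable h f g (e1 e2 : {poly R}) : continuous h ->
  loc_integrable f -> loc_integrable g -> sq_integrable Ip f ->
  sq_integrable Ip g ->
  (forall x, 0 <= x ->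
    h x = \int[mu]_(t in `[x, x + 1]) (f t * e1.[t - x] + g t * e2.[t - x])) ->
  sq_integrable Ip h.
Proof.
move=> ch lf lg f2 g2 hE; have mI := @measurable_plus R.
have [C1 C10 e1C] := horner_bounded01 e1; have [C2 C20 e2C] := horner_bounded01 e2.
have n2 (u : R -> R) : sq_integrable Ip u -> sq_integrable Ip (fun x => `|u x|).
  move=> u2; apply: (sq_integrable_le (g := u)) => //; last by move=> x _; rewrite normr_id.
  by apply: measurableT_comp => //; case: u2.
pose m x := `|f x| + `|g x|.
have lm : loc_integrable m by exact: loc_integrableD (loc_integrable_norm lf) (loc_integrable_norm lg).
apply: (@sq_integrable_window h m (C1 + C2)) => //; first exact: addr_ge0.
  by apply: sq_integrableD => //; exact: n2.
move=> x x0; have x1 : x <= x + 1 by lra.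
(* For x = 0 the window contains the vertex, which is outside [Ip] but negligible. *)
have -> : \int[mu]_(t in `[x, x + 1]) `|(m \_ Ip) t| = \int[mu]_(t in `[x, x + 1]) `|m t|.
  have lmn := loc_integrable_norm lm.
  have i2 : mu.-integrable `]x, x + 1] (EFin \o (fun t => `|m t|)).
    by apply: integrableS (lmn x (x + 1)) => //; exact: subset_itv_oc_cc.
  have e : {in `]x, x + 1]%classic, (fun t => `|m t|) =1 (fun t => `|(m \_ Ip) t|)}.
    move=> t; rewrite inE/= in_itv/= => /andP[xt _]; rewrite patchE mem_set// plusE.
    exact: le_lt_trans xt.
  rewrite -Rintegral_itv_obnd_cbnd; last first.
    by apply: eq_integrable i2 => // t /e /= ->.
  rewrite -[RHS]Rintegral_itv_obnd_cbnd//.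
  by apply: eq_Rintegral => t /e ->.
have ce (e : {poly R}) : continuous (fun t : R => e.[t - x]).
  exact: primitive_continuous (primitive_horner_shift e x).
have l : loc_integrable (fun t => f t * e1.[t - x] + g t * e2.[t - x]).
  by apply: loc_integrableD; exact: loc_integrableM.
rewrite hE//; apply: le_trans (le_normr_Rintegral _ (l x (x + 1))) _ => //.
have lmn := loc_integrable_norm lm.
rewrite -RintegralZl//; apply: le_Rintegral => //.
- exact: (loc_integrable_norm l).
- exact: (loc_integrableZ (C1 + C2) lmn).
move=> t; rewrite /= in_itv/= => /andP[xt tx].
have s01 : 0 <= t - x <= 1 by lra.
rewrite [X in _ <= _ * X]ger0_norm ?addr_ge0//.
apply: le_trans (ler_normD _ _) _; rewrite !normrM /m.
have := e1C _ s01; have := e2C _ s01.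
have := normr_ge0 (f t); have := normr_ge0 (g t).
move: `|f t| `|g t| `|e1.[t - x]| `|e2.[t - x]| => a b c d a0 b0 cC dC.
nra.
Qed.

(* Quintic Hermite interpolation: prescribed value and first two derivatives at
   0, triple zero at 1. *)
Definition hermite (a0 a1 a2 : R) : {poly R} :=
  a0%:P + a1 *: 'X + (a2 / 2) *: 'X^2 + (- 10 * a0 - 6 * a1 - 3 / 2 * a2) *: 'X^3
  + (15 * a0 + 8 * a1 + 3 / 2 * a2) *: 'X^4
  + (- 6 * a0 - 3 * a1 - 1 / 2 * a2) *: 'X^5.

Lemma hermiteE a0 a1 a2 (e := hermite a0 a1 a2) :
  [/\ e.[0] = a0, e^`().[0] = a1 & e^`()^`().[0] = a2] /\
  [/\ e.[1] = 0, e^`().[1] = 0 & e^`()^`().[1] = 0].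
Proof.
rewrite /e /hermite !(derivD, derivZ, derivC, derivX, derivXn, derivMn).
rewrite /= !(hornerE, hornerMn, hornerXn) /=.
by split; split; rewrite ?expr0n ?expr1n/=; field.
Qed.

(** The integrand is the derivative of U2 e - U1 e' + U0 e'', where e is taken at t - x; the triple
    zero of e at 1 removes the boundary terms at x + 1. *)
Lemma kernel_identity U (e : {poly R}) x :
  primitive (U 0%N) (U 1%N) -> primitive (U 1%N) (U 2%N) ->
  primitive (U 2%N) (U 3%N) ->
  e.[1] = 0 -> e^`().[1] = 0 -> e^`()^`().[1] = 0 ->
  \int[mu]_(t in `[x, x + 1]) (U 3%N t * e.[t - x] + U 0%N t * e^`()^`()^`().[t - x]) =
  - (U 2%N x * e.[0] - U 1%N x * e^`().[0] + U 0%N x * e^`()^`().[0]).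
Proof.
move=> p0 p1 p2 e0 e1 e2; have x1 : x <= x + 1 by lra.
have q0 := primitive_horner_shift e x.
have q1 := primitive_horner_shift e^`() x.
have q2 := primitive_horner_shift e^`()^`() x.
have H := primitiveD (primitiveM p2 q0)
  (primitiveD (primitiveZ (-1) (primitiveM p1 q1)) (primitiveM p0 q2)).
have [_ /(_ _ _ x1)] := H => /=.
have -> : x + 1 - x = 1 by lra.
rewrite subrr e0 e1 e2 => E.
transitivity (\int[mu]_(t in `[x, x + 1])
  (U 3%N t * e.[t - x] + U 2%N t * e^`().[t - x] +
     (-1 * (U 2%N t * e^`().[t - x] + U 1%N t * e^`()^`().[t - x]) +
      (U 1%N t * e^`()^`().[t - x] + U 0%N t * e^`()^`()^`().[t - x])))).
  by apply: eq_Rintegral => t _; ring.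
rewrite -E; ring.
Qed.

Lemma interpolation_plus U al be : al != 0 ->
  primitive (U 0%N) (U 1%N) -> primitive (U 1%N) (U 2%N) ->
  primitive (U 2%N) (U 3%N) ->
  sq_integrable Ip (U 0%N) -> sq_integrable Ip (fun x => al * U 3%N x + be * U 1%N x) ->
  forall j, (j <= 3)%N -> sq_integrable Ip (U j).
Proof.
move=> al0 p0 p1 p2 U02 w2; have mI := @measurable_plus R.
have l0 := loc_integrable_primitive p0; have l1 := loc_integrable_primitive p1.
have l3 : loc_integrable (U 3%N) by case: p2.
have lw : loc_integrable (fun x => al * U 3%N x + be * U 1%N x).
  exact: loc_integrableD (loc_integrableZ al l3) (loc_integrableZ be l1).
(* With e'(0) = 1 and e(0) = e''(0) = 0 the identity yields U1. Writing U3 = (w - be U1) / al, with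
   w for the expression al U3 + be U1, brings U1 back under the integral; since e vanishes at 0 and
   1, the integral of U1 e + U0 e' is zero, and U1 can be traded for U0. Hence the kernels e / al
   against w and (be / al) e' + e''' against U0. *)
have U12 : sq_integrable Ip (U 1%N).
  have := hermiteE 0 1 0; move: (hermite 0 1 0) => e [[e00 e10 e20] [e01 e11 e21]].
  apply: (@kernel_sq_integrable _ _ _ (al^-1 *: e)
    ((be / al) *: e^`() + e^`()^`()^`()) (primitive_continuous p1) lw l0 w2 U02).
  move=> x _.
  have := kernel_identity x p0 p1 p2 e01 e11 e21.
  rewrite e00 e10 e20 => E1.
  have x1 : x <= x + 1 by lra.
  have [l /(_ _ _ x1)] := primitiveM p0 (primitive_horner_shift e x).
  have -> : x + 1 - x = 1 by lra.
  rewrite subrr e00 e01 !mulr0 subrr => E2.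
  have l' : loc_integrable (fun t => U 3%N t * e.[t - x] + U 0%N t * e^`()^`()^`().[t - x]).
    by apply: loc_integrableD; apply: loc_integrableM => //;
      exact: primitive_continuous (primitive_horner_shift _ x).
  transitivity (\int[mu]_(t in `[x, x + 1])
     ((U 3%N t * e.[t - x] + U 0%N t * e^`()^`()^`().[t - x]) +
      be / al * (U 1%N t * e.[t - x] + U 0%N t * e^`().[t - x]))); last first.
    apply: eq_Rintegral => t _; rewrite hornerD !hornerZ.
    have alg (u3 u1 u0 k k1 k3 : R) : u3 * k + u0 * k3 + be / al * (u1 * k + u0 * k1)
      = (al * u3 + be * u1) * (al^-1 * k) + u0 * (be / al * k1 + k3) by field.
    exact: alg.
  rewrite RintegralD//; last exact: (loc_integrableZ (be / al) l).
  by rewrite RintegralZl// -E2 E1; ring.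
have U32 : sq_integrable Ip (U 3%N).
  have := sq_integrableZ al^-1 mI (sq_integrableB mI w2 (sq_integrableZ be mI U12)).
  rewrite (_ : (fun x => al^-1 * _) = U 3%N)//.
  by apply/funext => x; field.
(* U3 is now square integrable, so the identity with e(0) = 1 and e'(0) = e''(0) = 0 can be used
   directly; it yields - U2, whence the opposite kernels. *)
have U22 : sq_integrable Ip (U 2%N).
  have := hermiteE 1 0 0; move: (hermite 1 0 0) => e [[e00 e10 e20] [e01 e11 e21]].
  apply: (@kernel_sq_integrable _ _ _ (- e) (- e^`()^`()^`())
    (primitive_continuous p2) l3 l0 U32 U02).
  move=> x _.
  have := kernel_identity x p0 p1 p2 e01 e11 e21.
  rewrite e00 e10 e20 => E1.
  have l' : loc_integrable (fun t => U 3%N t * e.[t - x] + U 0%N t * e^`()^`()^`().[t - x]).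
    by apply: loc_integrableD; apply: loc_integrableM => //;
      exact: primitive_continuous (primitive_horner_shift _ x).
  transitivity (\int[mu]_(t in `[x, x + 1])
     (-1 * (U 3%N t * e.[t - x] + U 0%N t * e^`()^`()^`().[t - x]))); last first.
    apply: eq_Rintegral => t _; rewrite !hornerN.
    have alg (u3 u0 k k3 : R) : -1 * (u3 * k + u0 * k3) = u3 * - k + u0 * - k3 by ring.
    exact: alg.
  by rewrite RintegralZl// E1; ring.
by case=> [|[|[|[|]]]].
Qed.

Lemma regularity_plus al be v w : al != 0 -> sq_integrable Ip v ->
  sq_integrable Ip w ->
  (forall p, test_on Ip p ->
     al * \int[mu]_(x in Ip) (v x * derive1n 3 p x) +
     be * \int[mu]_(x in Ip) (v x * derive1n 1 p x) =
     \int[mu]_(x in Ip) (w x * p x)) ->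
  exists2 V, sobolev_rep Ip 3 v V &
    w = (fun x => - (al * V 3%N x + be * V 1%N x)) %[ae mu in Ip].
Proof.
move=> al0 v2 w2 vw; have oI := open_interval_plus R; have mI := @measurable_plus R.
have wr2 := sq_integrable_restrict mI w2; have lw := sq_integrable_loc wr2.
have lv := sq_integrable_loc (sq_integrable_restrict mI v2).
have [W Ww] := primitive_exists lw.
have [|c0 [V0 [V1 [p01 p12 vV0]]]] := weak_third_order_integrate oI al0 (be := be) lv Ww.
  by move=> p tp; rewrite !restrict_Rintegral; exact: vw.
have lV0 := loc_integrable_primitive p01.
have vV0' : v = V0 %[ae mu in Ip].
  by apply: ae_eq_trans vV0; apply: ae_eq_sym; exact: restrict_ae.
have mV0 : measurable_fun Ip V0.
  by apply: measurable_funTS; exact: loc_integrable_measurable.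
have V02 := ae_eq_sq_integrable mI mV0 vV0' v2.
(* The first pass gives a second derivative that contains v itself, known only up to null sets.
   Running the integration again with the C^1 representative V0 in place of v gives the second
   derivative -(W + be V0) / al + c, which can be differentiated once more. *)
have [|c [U0 [U1 [q01 q12 V0U0]]]] := weak_third_order_integrate oI al0 (be := be) lV0 Ww.
  move=> p tp; rewrite restrict_Rintegral -vw//.
  have [mv _] := v2.
  have E n : \int[mu]_(x in Ip) (V0 x * derive1n n p x) =
             \int[mu]_(x in Ip) (v x * derive1n n p x).
    apply: ae_eq_Rintegral_mul => //; last exact: ae_eq_sym.
    by apply: test_on_measurable; exact: (test_on_deriven n tp).
  by rewrite !E.
pose U (j : nat) : R -> R := match j with
  | 0 => U0 | 1 => U1 | 2 => fun x => - al^-1 * (W x + be * V0 x) + c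
  | _ => fun x => - al^-1 * ((w \_ Ip) x + be * V1 x) end.
have q23 : primitive (U 2%N) (U 3%N).
  by apply: primitive_addc; apply: primitiveZ; apply: primitiveD => //; exact: primitiveZ.
have mU0 : measurable_fun Ip U0.
  apply: measurable_funTS; apply: loc_integrable_measurable.
  exact: loc_integrable_primitive q01.
have vU0 : v = U0 %[ae mu in Ip] by exact: ae_eq_trans vV0' V0U0.
have U02 : sq_integrable Ip U0 by exact: ae_eq_sq_integrable vU0 v2.
have V0U0' : forall x, Ip x -> V0 x = U0 x.
  have [oI' _ _] := oI; apply: continuous_ae_eq => //; apply: continuous_subspaceT.
    exact: primitive_continuous p01.
  exact: primitive_continuous q01.
(* [U 3] is built from V1, the derivative of V0, whereas the equation involves U1; on [Ip] both are
   derivatives of the same function. *)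
have V1U1 x : Ip x -> V1 x = U1 x.
  move=> Ix.
  have dV : is_derive x 1 V0 (V1 x).
    by apply: primitive_derive p01 _; exact: (primitive_continuous p12).
  have dU : is_derive x 1 U0 (U1 x).
    by apply: primitive_derive q01 _; exact: (primitive_continuous q12).
  suff N : {near x, V0 =1 U0}.
    by have [_ <-] := near_eq_is_derive N dV; case: dU.
  have [oI' _ _] := oI.
  have : nbhs x Ip by exact: open_nbhs_nbhs.
  by apply: filterS => y; exact: V0U0'.
have wU : w = (fun x => - (al * U 3%N x + be * U 1%N x)) %[ae mu in Ip].
  apply: aeW => x Ix; rewrite /U patchE mem_set// V1U1//; field.
  exact: al0.
have eq2 : sq_integrable Ip (fun x => al * U 3%N x + be * U 1%N x).
  have := sq_integrableZ (-1) mI w2; apply: ae_eq_sq_integrable => //.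
    apply: measurable_funTS; apply: loc_integrable_measurable.
    apply: loc_integrableD (loc_integrableZ al _) (loc_integrableZ be _).
      by case: q23.
    exact: loc_integrable_primitive q12.
  by apply: (filterS (F := almost_everywhere mu)) wU => x H Ix; rewrite H//; ring.
exists U => //; split => //; first by case=> [|[|[|]]].
exact: (interpolation_plus al0 q01 q12 q23 U02 eq2).
Qed.

End Regularity.

(** * The operator on real-valued functions *)

Section RealOperator.
Variable R : realType.
Local Notation mu := (@lebesgue_measure R).
Local Notation Im := (@Iminus R).
Local Notation Ip := (@Iplus R).
Implicit Types (f g u v w p q : R -> R) (x al be Z : R).
Implicit Types (U V : nat -> R -> R) (I : set R).

Lemma lebesgue_RintegralZl I k f : measurable I -> mu.-integrable I (EFin \o f) ->
  \int[mu]_(x in I) (k * f x) = k * \int[mu]_(x in I) f x.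
Proof. by move=> mI fi; rewrite RintegralZl. Qed.

Lemma lebesgue_RintegralD I f g : measurable I -> mu.-integrable I (EFin \o f) ->
  mu.-integrable I (EFin \o g) -> \int[mu]_(x in I) (f x + g x) =
  \int[mu]_(x in I) f x + \int[mu]_(x in I) g x.
Proof. by move=> mI fi gi; rewrite RintegralD. Qed.

Lemma lebesgue_integrableZl I k f : measurable I -> mu.-integrable I (EFin \o f) ->
  mu.-integrable I (EFin \o (fun x => k * f x)).
Proof. by move=> mI fi; exact: (integrableZl _ k fi). Qed.

Lemma sq_integrableN I f : measurable I -> sq_integrable I f ->
  sq_integrable I (fun x => - f x).
Proof.
by move=> mI f2; have := sq_integrableZ (-1) mI f2; under eq_fun do rewrite mulN1r.
Qed.

Lemma sq_inner_neg I f g : measurable I -> sq_integrable I f -> sq_integrable I g ->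
  \int[mu]_(x in I) (f x * - g x) = - \int[mu]_(x in I) (f x * g x).
Proof.
move=> mI f2 g2; rewrite -[RHS]mulN1r.
rewrite -(lebesgue_RintegralZl (-1) mI (sq_integrableM mI f2 g2)).
by apply: eq_Rintegral => x _; ring.
Qed.

Lemma derive1n_opp n p : smoothr p ->
  derive1n n (fun x => p (- x)) = fun x => (-1) ^+ n * derive1n n p (- x).
Proof.
move=> sp; elim: n => [|n IH]; first by apply/funext => x; rewrite expr0 mul1r.
rewrite derive1nS IH; apply/funext => x; rewrite derive1E.
have dp : is_derive (- x) 1 (derive1n n p) (derive1n n.+1 p (- x)).
  by rewrite derive1nS; apply: smoothr_is_derive; exact: smoothr_deriven.
have d := is_derive1_compose dp (is_deriveNid x 1).
have [_] := is_deriveZ ((-1) ^+ n : R) d.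
by rewrite /GRing.scale/= => ->; rewrite exprS; ring.
Qed.

Lemma test_on_opp p : test_on Ip p -> test_on Im (fun x => p (- x)).
Proof.
move=> [sp [a [b [ab Ia Ib p0]]]]; split.
  have := smoothr_affine (a := -1) (b := 0) sp.
  by under eq_fun do rewrite addr0 mulN1r.
move: Ia Ib; rewrite !plusE => Ia Ib.
exists (- b), (- a); split; rewrite ?minusE ?oppr_lt0 ?lerN2// => x nx.
by apply: p0 => H; apply: nx; lra.
Qed.

Lemma regularity_minus al be v w : al != 0 -> sq_integrable Im v ->
  sq_integrable Im w ->
  (forall p, test_on Im p ->
     al * \int[mu]_(x in Im) (v x * derive1n 3 p x) +
     be * \int[mu]_(x in Im) (v x * derive1n 1 p x) =
     \int[mu]_(x in Im) (w x * p x)) ->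
  exists2 V, sobolev_rep Im 3 v V &
    w = (fun x => - (al * V 3%N x + be * V 1%N x)) %[ae mu in Im].
Proof.
move=> al0 v2 w2 vw; have mI := @measurable_minus R; have mIp := @measurable_plus R.
have oI := open_interval_minus R.
have v2' : sq_integrable Ip (fun x => v (- x)).
  by rewrite -preimage_opp_minus; exact: sq_integrable_opp.
(* The sign of w is reversed because al p''' + be p' changes sign under reflection. *)
have w2' : sq_integrable Ip (fun x => -1 * w (- x)).
  by apply: sq_integrableZ => //; rewrite -preimage_opp_minus; exact: sq_integrable_opp.
have [p tp|V vV wV] := regularity_plus al0 (be := be) v2' w2'.
  have tq := test_on_opp tp; have [sp _] := tp.
  have E (u : R -> R) n : sq_integrable Im u ->
      \int[mu]_(x in Ip) (u (- x) * derive1n n p x) = (-1) ^+ n *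
      \int[mu]_(x in Im) (u x * derive1n n (fun y => p (- y)) x).
    move=> u2; have tqn := test_on_deriven n tq.
    have i := sq_integrable_test oI u2 tqn.
    have [i' _] := lebesgue_integrable_opp mI i; rewrite preimage_opp_minus in i'.
    rewrite -(reflect_Rintegral i) -RintegralZl//.
    apply: eq_Rintegral => x _; rewrite derive1n_opp// opprK.
    by rewrite mulrCA [X in _ = _ * X]mulrA -exprMn mulrNN mulr1 expr1n mul1r.
  rewrite (E _ 3%N v2) (E _ 1%N v2).
  have E0 := E _ 0%N w2; rewrite /= in E0.
  have -> : \int[mu]_(x in Ip) (-1 * w (- x) * p x) = - \int[mu]_(x in Ip) (w (- x) * p x).
    have i := sq_integrable_test oI w2 tq.
    have [i' _] := lebesgue_integrable_opp mI i; rewrite preimage_opp_minus in i'.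
    have {}i' : mu.-integrable Ip (EFin \o (fun x => w (- x) * p x)).
      by apply: eq_integrable i' => // x _ /=; rewrite opprK.
    by rewrite -[RHS]mulN1r -(lebesgue_RintegralZl (-1) mIp i'); apply: eq_Rintegral => x _; rewrite mulrA.
  rewrite E0 -(vw _ tq) expr0 mul1r expr1 exprS expr2.
  have alg (a b : R) : al * (-1 * (-1 * -1) * a) + be * (-1 * b) = - (al * a + be * b) by ring.
  exact: alg.
exists (reflect_rep V).
  have := sobolev_rep_reflect mIp vV; rewrite preimage_opp_plus.
  by under eq_fun do rewrite opprK.
have := ae_reflect wV; rewrite preimage_opp_plus.
apply: (filterS (F := almost_everywhere mu)) => x H Ix.
have := H Ix; rewrite opprK /reflect_rep !exprS expr0 => E.
have -> : w x = - (-1 * w x) by ring.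
by rewrite E; ring.
Qed.

Lemma zero_rep I k : measurable I -> sobolev_rep I k (fun=> 0) (fun _ _ => 0).
Proof.
move=> mI; have p0 : primitive (fun=> 0 : R) (fun=> 0).
  by apply: primitiveC1 => x; exact: cst_continuous.
split => //; first exact: aeW.
move=> j _; split => //.
by rewrite (_ : EFin \o _ = cst 0%E) ?integrable0//; apply/funext => x /=; rewrite expr0n.
Qed.

Lemma test_on_sq_integrable I p : open_interval I -> test_on I p ->
  sq_integrable I p.
Proof.
move=> oI tp; have [sp _] := tp; split; first exact: test_on_measurable tp.
have := test_on_int oI tp (continuous_loc_integrable (smoothr_continuous sp)).
by under eq_fun do rewrite -expr2.
Qed.

Lemma test_rep I k p : open_interval I -> test_on I p ->
  sobolev_rep I k p (fun j => derive1n j p).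
Proof.
move=> oI tp; have [sp _] := tp; split=> [j _||j _]; last 2 first.
- exact: aeW.
- exact: (test_on_sq_integrable oI (test_on_deriven j tp)).
by rewrite derive1nS; apply: smoothr_primitive; exact: smoothr_deriven.
Qed.

Lemma test_on_out I p x : open_interval I -> test_on I p -> ~ I x -> p x = 0.
Proof.
move=> oI [_ [a [b [ab Ia Ib p0]]]] nI; apply: p0 => axb; apply: nI.
by apply: (interval_subset oI Ia Ib); rewrite /= in_itv.
Qed.

(** The Hermite polynomial is replaced by 0 beyond 1. Its triple zero there keeps the first two
    derivatives continuous, so the third one may jump and the result is still in H^3. *)
Lemma cutoff_plus (a0 a1 a2 : R) : exists V, sobolev_rep Ip 3 (V 0%N) V /\
  [/\ V 0%N 0 = a0, V 1%N 0 = a1 & V 2%N 0 = a2].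
Proof.
have [[e00 e10 e20] [e01 e11 e21]] := hermiteE a0 a1 a2.
move: (hermite a0 a1 a2) e00 e10 e20 e01 e11 e21 => e e00 e10 e20 e01 e11 e21.
pose V (j : nat) x := if x < 1 then (derivn j e).[x] else 0.
have mI := @measurable_plus R.
have p0 : primitive (fun=> 0 : R) (fun=> 0).
  by apply: primitiveC1 => x; exact: cst_continuous.
exists V; split; last by rewrite /V ltr01.
have pV j : (derivn j e).[1] = 0 -> primitive (V j) (V j.+1).
  move=> ej; apply: primitive_glue => //.
  by rewrite derivnS; exact: primitive_horner.
split.
- by case=> [|[|[|]]]// _; apply: pV.
- exact: aeW.
- move=> j _; split.
    apply: measurable_funTS; apply: measurable_fun_ifT => //; first exact: measurable_fun_ltr.
    by apply: continuous_measurable_fun; exact: continuous_horner.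
  set q := derivn j e.
  (* Gluing a primitive of q^2 to 0 at the point 1 supplies the local integrability of the square of
     [V j]. *)
  have [Q Qq] := primitive_exists (continuous_loc_integrable (@continuous_horner _ (q * q))).
  have [l _] := primitive_glue (c := 1) (primitive_addc (- Q 1) Qq) p0 (subrr _).
  apply: (@integrable_supp _ Ip `]0, 1]%classic) => //.
  + by move=> x /=; rewrite in_itv/= plusE => /andP[].
  + move=> x; rewrite plusE /= in_itv/= => x0 /negP; rewrite x0/= -ltNge => x1.
    by rewrite /V ltNge ltW//= expr0n.
  + have : mu.-integrable `]0, 1] (EFin \o (fun x => if x < 1 then (q * q).[x] else 0)).
      by apply: integrableS (l 0 1) => //; exact: subset_itv_oc_cc.
    apply: eq_integrable => // x _; rewrite /= /V -/q.
    by case: ifP => _; rewrite ?hornerM ?expr2// mulr0.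
Qed.

Lemma cutoff_minus (a0 a1 a2 : R) : exists V, sobolev_rep Im 3 (V 0%N) V /\
  [/\ V 0%N 0 = a0, V 1%N 0 = a1 & V 2%N 0 = a2].
Proof.
have [V [rV [V0 V1 V2]]] := cutoff_plus a0 (- a1) a2.
exists (reflect_rep V); split.
  have := sobolev_rep_reflect (@measurable_plus R) rV; rewrite preimage_opp_plus.
  congr sobolev_rep; apply/funext => x; first by rewrite /reflect_rep expr0 mul1r.
by rewrite /reflect_rep !oppr0 V0 V1 V2 expr0 expr1 !exprS expr0; split; ring.
Qed.

End RealOperator.

(** * The real operator: Green's formula on pairs, adjoint, transmission conditions *)

Section Operator.
Variable R : realType.
Local Notation mu := (@lebesgue_measure R).
Local Notation Im := (@Iminus R).
Local Notation Ip := (@Iplus R).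
Local Notation rpair := ((R -> R) * (R -> R))%type.
Variables (am ap bm bp Z : R).
Implicit Types (u v w : rpair) (U V : nat -> R -> R).

Definition traces_match U V := [/\ V 0%N 0 = U 0%N 0,
  V 1%N 0 = Z * U 0%N 0 + U 1%N 0 &
  V 2%N 0 = Z ^+ 2 / 2 * U 0%N 0 + Z * U 1%N 0 + U 2%N 0].

Definition real_graph (u f : rpair) := exists U V,
  [/\ sq_integrable Im u.1 /\ sq_integrable Ip u.2,
      sq_integrable Im f.1 /\ sq_integrable Ip f.2,
      sobolev_rep Im 3 u.1 U /\ sobolev_rep Ip 3 u.2 V,
      traces_match U V &
      f.1 = (fun x => am * U 3%N x + bm * U 1%N x) %[ae mu in Im] /\
      f.2 = (fun x => ap * V 3%N x + bp * V 1%N x) %[ae mu in Ip]].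

Definition real_inner (u v : rpair) : R :=
  \int[mu]_(x in Im) (u.1 x * v.1 x) + \int[mu]_(x in Ip) (u.2 x * v.2 x).

Lemma rep_combination (I : set R) (al be : R) U (u : R -> R) :
  measurable I -> sobolev_rep I 3 u U ->
  sq_integrable I (fun x => al * U 3%N x + be * U 1%N x).
Proof.
by move=> mI [_ _ U2]; apply: sq_integrableD => //; apply: sq_integrableZ => //; exact: U2.
Qed.

Lemma ae_eq_inner (I : set R) (f f' g g' : R -> R) : measurable I -> sq_integrable I f ->
  sq_integrable I f' -> sq_integrable I g -> sq_integrable I g' ->
  f = f' %[ae mu in I] -> g = g' %[ae mu in I] ->
  \int[mu]_(x in I) (f x * g x) = \int[mu]_(x in I) (f' x * g' x).
Proof.
move=> mI [mf _] [mf' _] [mg _] [mg' _] ff' gg'.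
apply: ae_eq_Rintegral => //; [exact: measurable_funM..|].
apply: (filterS2 (F := almost_everywhere mu)) ff' gg' => x ff' gg' Ix.
by rewrite ff'// gg'.
Qed.

Lemma green_pair (um up vm vp : R -> R) (U V U' V' : nat -> R -> R)
    (f g : rpair) :
  sq_integrable Im um -> sq_integrable Ip up ->
  sq_integrable Im vm -> sq_integrable Ip vp ->
  sq_integrable Im f.1 -> sq_integrable Ip f.2 ->
  sq_integrable Im g.1 -> sq_integrable Ip g.2 ->
  sobolev_rep Im 3 um U -> sobolev_rep Ip 3 up V ->
  sobolev_rep Im 3 vm U' -> sobolev_rep Ip 3 vp V' ->
  f.1 = (fun x => am * U 3%N x + bm * U 1%N x) %[ae mu in Im] ->
  f.2 = (fun x => ap * V 3%N x + bp * V 1%N x) %[ae mu in Ip] ->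
  g.1 = (fun x => am * U' 3%N x + bm * U' 1%N x) %[ae mu in Im] ->
  g.2 = (fun x => ap * V' 3%N x + bp * V' 1%N x) %[ae mu in Ip] ->
  real_inner f (vm, vp) + real_inner (um, up) g =
  green_form am bm U U' - green_form ap bp V V'.
Proof.
move=> um2 up2 vm2 vp2 f12 f22 g12 g22 rU rV rU' rV' fU fV gU gV.
have mm := @measurable_minus R; have mp := @measurable_plus R.
have sU := rep_combination am bm mm rU; have sV := rep_combination ap bp mp rV.
have sU' := rep_combination am bm mm rU'; have sV' := rep_combination ap bp mp rV'.
have [_ uU U2] := rU; have [_ uV V2] := rV.
have [_ uU' U2'] := rU'; have [_ uV' V2'] := rV'.
rewrite /real_inner /=.
rewrite (ae_eq_inner mm f12 sU vm2 (U2' 0%N isT) fU uU').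
rewrite (ae_eq_inner mp f22 sV vp2 (V2' 0%N isT) fV uV').
rewrite (ae_eq_inner mm um2 (U2 0%N isT) g12 sU' uU gU).
rewrite (ae_eq_inner mp up2 (V2 0%N isT) g22 sV' uV gV).
have := green_minus am bm rU rU'; have := green_plus ap bp rV rV'.
have alg (a b c d s t : R) : b + d = - t -> a + c = s -> a + b + (c + d) = s - t.
  by move=> E1 E2; rewrite -E2 addrACA E1.
exact: alg.
Qed.

(** Pairs (p, 0) and (0, p) with p a test function have zero traces, hence lie in the domain.
    Testing the adjoint relation against them gives the weak equation on each half-line separately,
    to which the regularity results apply. *)
Lemma real_adjoint_rep (v w : rpair) : am != 0 -> ap != 0 ->
  sq_integrable Im v.1 -> sq_integrable Ip v.2 ->
  sq_integrable Im w.1 -> sq_integrable Ip w.2 ->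
  (forall u f, real_graph u f -> real_inner f v = real_inner u w) ->
  exists U V, [/\ sobolev_rep Im 3 v.1 U, sobolev_rep Ip 3 v.2 V,
    w.1 = (fun x => - (am * U 3%N x + bm * U 1%N x)) %[ae mu in Im] &
    w.2 = (fun x => - (ap * V 3%N x + bp * V 1%N x)) %[ae mu in Ip]].
Proof.
move=> am0 ap0 v12 v22 w12 w22 adj.
have mm := @measurable_minus R; have mp := @measurable_plus R.
have om := open_interval_minus R; have op := open_interval_plus R.
have z0 (I : set R) : measurable I -> sq_integrable I (fun=> 0 : R).
  by move=> mI; have [_ _ /(_ 0%N isT)] := zero_rep 3 mI.
have nm0 : ~ Im 0 by rewrite minusE ltxx.
have np0 : ~ Ip 0 by rewrite plusE ltxx.
have lin (I : set R) (al be : R) (u p : R -> R) : open_interval I -> sq_integrable I u -> test_on I p ->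
    \int[mu]_(x in I) ((al * derive1n 3 p x + be * derive1n 1 p x) * u x) =
    al * \int[mu]_(x in I) (u x * derive1n 3 p x) +
    be * \int[mu]_(x in I) (u x * derive1n 1 p x).
  move=> oI u2 tp; have mI := open_interval_measurable oI.
  have i3 := sq_integrable_test oI u2 (test_on_deriven 3 tp).
  have i1 := sq_integrable_test oI u2 (test_on_deriven 1 tp).
  rewrite -(lebesgue_RintegralZl al mI i3) -(lebesgue_RintegralZl be mI i1).
  rewrite -(lebesgue_RintegralD mI (lebesgue_integrableZl al mI i3) (lebesgue_integrableZl be mI i1)).
  by apply: eq_Rintegral => x _; ring.
have int0 (I : set R) (u : R -> R) : \int[mu]_(x in I) (0 * u x) = 0.
  under eq_Rintegral do rewrite mul0r.
  by rewrite /Rintegral integral0.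
have [p tp|U rU wU] := regularity_minus am0 (be := bm) v12 w12.
  have := adj (p, fun=> 0)
    (fun x => am * derive1n 3 p x + bm * derive1n 1 p x, fun=> 0).
  rewrite /real_inner/= !int0 !addr0 lin// => ->; first by apply: eq_Rintegral => x _; rewrite mulrC.
  have rp := test_rep 3 om tp.
  exists (fun j => derive1n j p), (fun _ _ => 0); split => //=.
  - by split; [exact: test_on_sq_integrable|exact: z0].
  - by split; [exact: (rep_combination am bm mm rp)|exact: z0].
  - by split => //; exact: zero_rep.
  - have t0 j : derive1n j p 0 = 0 by apply: (test_on_out om (test_on_deriven j tp)).
    by split; rewrite ?(t0 0%N) ?(t0 1%N) ?(t0 2%N) ?mulr0 ?addr0.
  - by split; apply: aeW => x _//; rewrite !mulr0 addr0.
have [p tp|V rV wV] := regularity_plus ap0 (be := bp) v22 w22.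
  have := adj (fun=> 0, p)
    (fun=> 0, fun x => ap * derive1n 3 p x + bp * derive1n 1 p x).
  rewrite /real_inner/= !int0 !add0r lin// => ->; first by apply: eq_Rintegral => x _; rewrite mulrC.
  have rp := test_rep 3 op tp.
  exists (fun _ _ => 0), (fun j => derive1n j p); split => //=.
  - by split; [exact: z0|exact: test_on_sq_integrable].
  - by split; [exact: z0|exact: (rep_combination ap bp mp rp)].
  - by split => //; exact: zero_rep.
  - have t0 j : derive1n j p 0 = 0 by apply: (test_on_out op (test_on_deriven j tp)).
    by split; rewrite ?(t0 0%N) ?(t0 1%N) ?(t0 2%N) ?mulr0 ?addr0.
  - by split; apply: aeW => x _//; rewrite !mulr0 addr0.
by exists U, V.
Qed.

(** The left traces can be prescribed freely and fix the right ones through L_Z; this is all that is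
    needed of the domain to exploit Green's formula. *)
Lemma real_graph_traces (a0 a1 a2 : R) : exists u f U V,
  [/\ real_graph u f,
    [/\ sobolev_rep Im 3 u.1 U, sobolev_rep Ip 3 u.2 V,
        f.1 = (fun x => am * U 3%N x + bm * U 1%N x) &
        f.2 = (fun x => ap * V 3%N x + bp * V 1%N x)],
    [/\ sq_integrable Im u.1, sq_integrable Ip u.2, sq_integrable Im f.1 &
        sq_integrable Ip f.2],
    [/\ U 0%N 0 = a0, U 1%N 0 = a1 & U 2%N 0 = a2] &
    [/\ V 0%N 0 = a0, V 1%N 0 = Z * a0 + a1 &
        V 2%N 0 = Z ^+ 2 / 2 * a0 + Z * a1 + a2]].
Proof.
have mm := @measurable_minus R; have mp := @measurable_plus R.
have [U [rU [U0 U1 U2]]] := cutoff_minus a0 a1 a2.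
have [V [rV [V0 V1 V2]]] := cutoff_plus a0 (Z * a0 + a1) (Z ^+ 2 / 2 * a0 + Z * a1 + a2).
have sU := rep_combination am bm mm rU; have sV := rep_combination ap bp mp rV.
have [_ _ /(_ 0%N isT) sU0] := rU; have [_ _ /(_ 0%N isT) sV0] := rV.
exists (U 0%N, V 0%N),
  (fun x => am * U 3%N x + bm * U 1%N x, fun x => ap * V 3%N x + bp * V 1%N x), U, V.
split => //; exists U, V; split => //.
- by split; rewrite ?V0 ?V1 ?V2 U0 ?U1 ?U2.
- by split; apply: aeW.
Qed.

Definition real_neg (w : rpair) : rpair :=
  (fun x => - w.1 x, fun x => - w.2 x).

Lemma real_graph_adjoint v w u (f : rpair) : am = ap -> bm = bp ->
  real_graph v (real_neg w) -> real_graph u f -> real_inner f v = real_inner u w.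
Proof.
move=> aE bE [U' [V' [[v12 v22] [w12 w22] [rU' rV'] [V0' V1' V2'] [wU wV]]]].
move=> [U [V [[u12 u22] [f12 f22] [rU rV] [V0 V1 V2] [fU fV]]]].
have := green_pair u12 u22 v12 v22 f12 f22 w12 w22 rU rV rU' rV' fU fV wU wV.
rewrite /green_form V0 V1 V2 V0' V1' V2' -aE -bE.
(* Invariance of the form under L_Z, and the origin of the entry Z^2 / 2: the term in U0 U0' gains
   the coefficient Z^2/2 - Z^2 + Z^2/2 = 0, and the mixed terms in U1 U0' and U0 U1' cancel
   likewise. *)
set G := (X in _ = X -> _); have -> : G = 0 by rewrite /G; field.
have mm := @measurable_minus R; have mp := @measurable_plus R.
have w12' : sq_integrable Im w.1.
  by have := sq_integrableN mm w12; under eq_fun do rewrite opprK.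
have w22' : sq_integrable Ip w.2.
  by have := sq_integrableN mp w22; under eq_fun do rewrite opprK.
rewrite {2}/real_inner /= !sq_inner_neg// -opprD => /eqP; rewrite subr_eq0 => /eqP.
by case: (v).
Qed.

Lemma real_adjoint_graph v w : am != 0 -> am = ap -> bm = bp ->
  sq_integrable Im v.1 -> sq_integrable Ip v.2 ->
  sq_integrable Im w.1 -> sq_integrable Ip w.2 ->
  (forall u f, real_graph u f -> real_inner f v = real_inner u w) ->
  real_graph v (real_neg w).
Proof.
move=> am0 aE bE v12 v22 w12 w22 adj.
have ap0 : ap != 0 by rewrite -aE.
have mm := @measurable_minus R; have mp := @measurable_plus R.
have [U' [V' [rU' rV' wU wV]]] := real_adjoint_rep am0 ap0 v12 v22 w12 w22 adj.
have neg (I : set R) (k h : R -> R) : k = (fun x => - h x) %[ae mu in I] ->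
    (fun x => - k x) = h %[ae mu in I].
  by apply: (filterS (F := almost_everywhere mu)) => x H Ix; rewrite H// opprK.
have nw1 := sq_integrableN mm w12; have nw2 := sq_integrableN mp w22.
have nwU := neg _ _ _ wU; have nwV := neg _ _ _ wV.
have key a0 a1 a2 :
   am * (a2 * U' 0%N 0 - a1 * U' 1%N 0 + a0 * U' 2%N 0) + bm * (a0 * U' 0%N 0) =
   am * ((Z ^+ 2 / 2 * a0 + Z * a1 + a2) * V' 0%N 0 - (Z * a0 + a1) * V' 1%N 0 +
     a0 * V' 2%N 0) + bm * (a0 * V' 0%N 0).
  have [u [f [U [V [uf [rU rV fU fV] [u12 u22 f12 f22] [U0 U1 U2] [V0 V1 V2]]]]]] :=
    real_graph_traces a0 a1 a2.
  have fU' : f.1 = (fun x => am * U 3%N x + bm * U 1%N x) %[ae mu in Im].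
    by rewrite fU; exact: aeW.
  have fV' : f.2 = (fun x => ap * V 3%N x + bp * V 1%N x) %[ae mu in Ip].
    by rewrite fV; exact: aeW.
  have := green_pair (g := real_neg w) u12 u22 v12 v22 f12 f22 nw1 nw2 rU rV rU' rV' fU' fV' nwU nwV.
  rewrite /green_form U0 U1 U2 V0 V1 V2 -aE -bE.
  have E := adj _ _ uf.
  have -> : real_inner f (v.1, v.2) = real_inner f v by case: (v).
  rewrite E.
  have -> : real_inner (u.1, u.2) (real_neg w) = - real_inner u w.
    by rewrite /real_inner /= opprD !sq_inner_neg.
  by rewrite subrr => /esym/eqP; rewrite subr_eq0 => /eqP.
(* The form is triangular in the traces: (0, 0, 1) isolates the values, then (0, 1, 0) the first
   derivatives, then (1, 0, 0) the second ones; the beta terms cancel once the values agree. *)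
have V0 : V' 0%N 0 = U' 0%N 0.
  have := key 0 0 1; rewrite !(mul0r, mulr0, mul1r, add0r, addr0, subr0, oppr0).
  by move/(mulfI am0).
have V1 : V' 1%N 0 = Z * U' 0%N 0 + U' 1%N 0.
  apply: (mulfI am0); have := key 0 1 0; rewrite V0; lra.
have V2 : V' 2%N 0 = Z ^+ 2 / 2 * U' 0%N 0 + Z * U' 1%N 0 + U' 2%N 0.
  apply: (mulfI am0); have := key 1 0 0; rewrite V0 V1; lra.
by exists U', V'.
Qed.

(** Skew-symmetry alone is assumed. For u = v, invariance under L_Z turns Green's formula into (am -
    ap)(2 a0 a2 - a1^2) + (bm - bp) a0^2 = 0; the traces (0, 1, 0) give the equality of the alphas,
    and (1, 0, 0) that of the betas. *)
Lemma real_skew_necessary :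
  (forall v w, real_graph v (real_neg w) -> forall u f, real_graph u f ->
    real_inner f v = real_inner u w) -> am = ap /\ bm = bp.
Proof.
move=> H.
have mm := @measurable_minus R; have mp := @measurable_plus R.
have key a0 a1 a2 :
  (am - ap) * (a2 * a0 - a1 * a1 + a0 * a2) + (bm - bp) * (a0 * a0) = 0.
  have [u [f [U [V [uf [rU rV fU fV] [u12 u22 f12 f22] [U0 U1 U2] [V0 V1 V2]]]]]] :=
    real_graph_traces a0 a1 a2.
  have fU' : f.1 = (fun x => am * U 3%N x + bm * U 1%N x) %[ae mu in Im].
    by rewrite fU; exact: aeW.
  have fV' : f.2 = (fun x => ap * V 3%N x + bp * V 1%N x) %[ae mu in Ip].
    by rewrite fV; exact: aeW.
  have := green_pair u12 u22 u12 u22 f12 f22 f12 f22 rU rV rU rV fU' fV' fU' fV'.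
  rewrite /green_form U0 U1 U2 V0 V1 V2.
  have e : real_neg (real_neg f) = f.
    rewrite /real_neg; case: (f) => f1 f2 /=.
    by congr pair; apply/funext => x; rewrite opprK.
  have := H u (real_neg f); rewrite e => /(_ uf _ _ uf) E.
  have -> : real_inner f (u.1, u.2) = real_inner f u by case: (u).
  rewrite E.
  have -> : real_inner (u.1, u.2) f = - real_inner u (real_neg f).
    by rewrite /real_inner /= opprD !sq_inner_neg ?opprK//; exact: sq_integrableN.
  by rewrite subrr => E0; rewrite [RHS]E0; field.
have := key 0 1 0; have := key 1 0 0.
by split; lra.
Qed.

End Operator.

(** * Density of the domain *)

Section Density.
Variable R : realType.
Local Notation mu := (@lebesgue_measure R).
Local Notation Im := (@Iminus R).
Local Notation Ip := (@Iplus R).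
Implicit Types (f g u v F G : R -> R) (x a b eps M : R) (I : set R).
Implicit Types (U V : nat -> R -> R).

Lemma dominated_small I (f_ : nat -> R -> R) G eps : measurable I ->
  (forall n, measurable_fun I (f_ n)) -> mu.-integrable I (EFin \o G) ->
  {ae mu, forall x, I x -> f_ n x @[n --> \oo] --> (0 : R)} ->
  (forall n x, I x -> 0 <= f_ n x <= G x) -> 0 < eps ->
  exists n, \int[mu]_(x in I) f_ n x < eps.
Proof.
move=> mI mf iG cf fG e0.
have [|||||_ _ cvf] := @dominated_convergence _ _ _ mu I
    mI (fun n x => (f_ n x)%:E) (fun=> 0%E) (fun x => (G x)%:E).
- by move=> n; apply/measurable_EFinP; exact: mf.
- exact: measurable_cst.
- apply: (filterS (F := almost_everywhere mu)) cf => x cf Ix.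
  by apply: cvg_EFin; [near=> n|exact: cf].
- exact: iG.
- by apply: aeW => x n Ix; rewrite /= lee_fin; have /andP[? ?] := fG n x Ix; rewrite ger0_norm.
have {}cvf : \int[mu]_(x in I) f_ n x @[n --> \oo] --> (0 : R).
  by apply: fine_cvg; rewrite integral0 in cvf; exact: cvf.
have [n _ /(_ n (leqnn n)) H] := cvgr0_norm_lt _ cvf eps e0.
by exists n; apply: le_lt_trans (ler_norm _) _; exact: H.
Unshelve. all: by end_near. Qed.

Lemma sq_dist_triangle I f g u eps : measurable I -> sq_integrable I f ->
  sq_integrable I g -> sq_integrable I u ->
  \int[mu]_(x in I) ((f x - g x) ^+ 2) < eps / 4 ->
  \int[mu]_(x in I) ((g x - u x) ^+ 2) < eps / 4 ->
  \int[mu]_(x in I) ((f x - u x) ^+ 2) < eps.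
Proof.
move=> mI f2 g2 u2 fg gu.
have [_ i1] := sq_integrableB mI f2 g2; have [_ i2] := sq_integrableB mI g2 u2.
have [_ i3] := sq_integrableB mI f2 u2.
have j1 := lebesgue_integrableZl 2 mI i1; have j2 := lebesgue_integrableZl 2 mI i2.
apply: (@le_lt_trans _ _ (\int[mu]_(x in I) (2 * (f x - g x) ^+ 2 + 2 * (g x - u x) ^+ 2))).
  apply: le_Rintegral => //; first exact: (integrableD _ j1 j2).
  move=> x _; have := sqr_ge0 ((f x - g x) - (g x - u x)).
  rewrite !expr2; nra.
rewrite (lebesgue_RintegralD mI j1 j2) (lebesgue_RintegralZl 2 mI i1) (lebesgue_RintegralZl 2 mI i2).
lra.
Qed.

(** The condition 0 < a keeps the support away from the vertex, which leaves room for the leftward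
    shift of the Steklov means and makes the traces at 0 vanish. *)
Definition bounded_supp f := measurable_fun setT f /\ exists a b M,
  [/\ 0 < a, forall x, `|f x| <= M & forall x, ~ (a <= x <= b) -> f x = 0].

Lemma indicator_itv_integrable a b c : mu.-integrable Ip
  (EFin \o (fun x : R => c * \1_(`[a, b]%classic) x)).
Proof.
apply: lebesgue_integrableZl; first exact: measurable_plus.
apply: (@integrableS _ _ _ mu setT) => //; first exact: measurable_plus.
exact: integrable_indic_itv.
Qed.

Lemma indic_itvE a b x : \1_(`[a, b]%classic) x = (if a <= x <= b then 1 else 0) :> R.
Proof.
rewrite indicE; case: ifPn => H; first by rewrite mem_set//= in_itv.
by rewrite memNset//= in_itv/=; exact/negP.
Qed.

Lemma bounded_supp_sq f : bounded_supp f -> sq_integrable Ip f.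
Proof.
move=> [mf [a [b [M [a0 fM f0]]]]]; split; first exact: measurable_funTS.
apply: le_integrable (indicator_itv_integrable a b (M ^+ 2)) => //.
- exact: measurable_plus.
- by apply/measurable_EFinP; apply: measurable_funTS; exact: measurable_funX.
- move=> x _; rewrite /= lee_fin indic_itvE.
  have M0 : 0 <= M by apply: le_trans (fM 0).
  case: ifPn => [_|/negP nx]; last by rewrite f0// expr0n normr0.
  by rewrite mulr1 !normrX lerXn2r ?nnegrE// [leRHS]ger0_norm.
Qed.

Lemma bounded_supp_loc f : bounded_supp f -> loc_integrable f.
Proof.
move=> [mf [_ [_ [M [_ fM _]]]]] a b.
have := @loc_integrable_cst R M a b; apply: le_integrable => //.
  by apply/measurable_EFinP; exact: measurable_funTS.
by move=> x _; rewrite /= lee_fin; apply: le_trans (ler_norm M).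
Qed.

Definition clip M (y : R) : R := Num.max (- M) (Num.min y M).

Lemma clip_bound M y : 0 <= M -> `|clip M y| <= M.
Proof.
by move=> M0; rewrite /clip ler_norml le_max lexx/= ge_max ge_min lexx orbT andbT; lra.
Qed.

Lemma clip_id M y : `|y| <= M -> clip M y = y.
Proof. by rewrite ler_norml /clip => /andP[h1 h2]; rewrite min_l// max_r. Qed.

(** Clipping at M and then shrinking by c gives a number between 0 and y, so the error is at most
    |y|; this provides the dominating function f^2 in [truncation]. *)
Lemma clip_dist M y c : 0 <= M -> 0 <= c <= 1 -> (y - clip M y * c) ^+ 2 <= y ^+ 2.
Proof.
move=> M0 /andP[c0 c1]; rewrite /clip -subr_ge0.
have [yM|My] := leP y M; last first.
  rewrite max_r; last lra.
  have -> : y ^+ 2 - (y - M * c) ^+ 2 = (M * c) * (2 * y - M * c) by ring.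
  have : M * c <= M by rewrite ler_piMr.
  by move=> ?; rewrite mulr_ge0 ?mulr_ge0//; lra.
have [My|yM'] := leP (- M) y.
  have -> : y ^+ 2 - (y - y * c) ^+ 2 = y ^+ 2 * (c * (2 - c)) by ring.
  by rewrite mulr_ge0 ?sqr_ge0// mulr_ge0//; lra.
have -> : y ^+ 2 - (y - - M * c) ^+ 2 = (M * c) * (- (2 * y) - M * c) by ring.
have : M * c <= M by rewrite ler_piMr.
by move=> ?; rewrite mulr_ge0 ?mulr_ge0//; lra.
Qed.

Lemma truncation f eps : sq_integrable Ip f -> 0 < eps ->
  exists2 g, bounded_supp g & \int[mu]_(x in Ip) ((f x - g x) ^+ 2) < eps.
Proof.
move=> f2 e0; have mI := @measurable_plus R.
have [mr _] := sq_integrable_restrict mI f2; set r := f \_ Ip in mr.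
have rf x : Ip x -> r x = f x by move=> Ix; rewrite /r patchE mem_set.
pose g n x := clip n.+1%:R (r x) * \1_(`[(n.+1%:R : R)^-1, n.+1%:R]%classic) x.
have gb n : bounded_supp (g n).
  split.
    apply: measurable_funM; last exact: measurable_indic.
    apply: measurable_maxr; first exact: measurable_cst.
    by apply: measurable_minr => //; exact: measurable_cst.
  exists n.+1%:R^-1, n.+1%:R, n.+1%:R; split; first by rewrite invr_gt0.
    move=> x; rewrite /g indic_itvE; case: ifP => _; rewrite ?mulr1 ?mulr0 ?normr0//.
    exact: clip_bound.
  by move=> x /negP/negbTE nx; rewrite /g indic_itvE nx mulr0.
have sg n := bounded_supp_sq (gb n).
have [||n Hn] := @dominated_small Ip (fun n x => (f x - g n x) ^+ 2) (fun x => f x ^+ 2) eps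
   mI (fun n => measurable_funX 2 (sq_integrableB mI f2 (sg n)).1) f2.2 _ _ e0.
- apply: aeW => x Ix; move: (Ix); rewrite plusE => x0.
  apply: (@cvg_trans _ ((fun=> 0 : R) @ \oo)); last exact: cvg_cst.
  apply: near_eq_cvg; near=> n.
  have cl : clip n.+1%:R (r x) = r x.
    apply: clip_id; apply: le_trans (ltW (truncnS_gt _)) _.
    by rewrite ler_nat ltnS; near: n; exact: nbhs_infty_ge.
  rewrite /g cl indic_itvE ifT; first by rewrite mulr1 rf// subrr expr0n.
  apply/andP; split.
    rewrite invf_ple ?posrE//; apply: le_trans (ltW (truncnS_gt _)) _.
    by rewrite ler_nat ltnS; near: n; exact: nbhs_infty_ge.
  apply: le_trans (ltW (truncnS_gt _)) _.
  by rewrite ler_nat ltnS; near: n; exact: nbhs_infty_ge.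
- move=> n x Ix; rewrite sqr_ge0/= /g rf//; apply: clip_dist => //.
  by rewrite indic_itvE; case: ifP => _; rewrite ?lexx ?ler01.
by exists (g n).
Unshelve. all: by end_near. Qed.

(** When F is a primitive of f this is the Steklov mean of f over [x, x + h]. *)
Definition diff_quot (h : R) f x := (f (x + h) - f x) / h.

(** The means converge almost everywhere by Lebesgue differentiation and keep the bound M, while
    their support extends to the left by h only; dominated convergence concludes. *)
Lemma steklov_step f F eps : bounded_supp f -> primitive F f -> 0 < eps ->
  exists h, [/\ 0 < h, bounded_supp (diff_quot h F) &
    \int[mu]_(x in Ip) ((f x - diff_quot h F x) ^+ 2) < eps].
Proof.
move=> bf Ff e0; have [mf [a [b [M [a0 fM f0]]]]] := bf.
have mI := @measurable_plus R; have [lf eF] := Ff.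
have M0 : 0 <= M by apply: le_trans (fM 0).
have zero_int c d : c <= d -> (forall x, c <= x <= d -> ~ (a < x <= b)) -> F d - F c = 0.
  move=> cd H; rewrite eF//.
  rewrite (@ae_eq_Rintegral _ _ f (cst 0))//; last 2 first.
  - exact: measurable_funTS.
  - exists [set a]; split => //; first exact: lebesgue_measure_set1.
    move=> x /= /not_implyP[]; rewrite in_itv/= => cxd fx.
    apply: contrapT => xa; apply: fx; apply: f0 => /andP[ax xb].
    by apply: (H x cxd); rewrite xb andbT lt_neqAle ax andbT eq_sym; exact/eqP.
  by rewrite Rintegral_cst// mul0r.
have dist c d : c <= d -> `|F d - F c| <= M * (d - c).
  move=> cd; apply: le_trans (primitive_increment_le Ff cd) _.
  have pM : primitive (fun y => M * y) (fun=> M).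
    apply: primitiveC1 => y; last exact: cst_continuous.
    have d' : is_derive y 1 (M \*: (@id R)) (M *: 1) by exact: is_deriveZ.
    by move: d'; rewrite /GRing.scale/= mulr1.
  rewrite mulrBr; have [_ ->] := pM; last exact: cd.
  apply: le_Rintegral => //; first exact: (loc_integrable_norm lf).
  exact: loc_integrable_cst.
have cF := primitive_continuous Ff.
have bh h : 0 < h -> h < a -> bounded_supp (diff_quot h F) /\
    (forall x, `|diff_quot h F x| <= M) /\
    (forall x, ~ (a - h <= x <= b) -> diff_quot h F x = 0).
  move=> h0 ha.
  have H1 x : `|diff_quot h F x| <= M.
    have hx : x <= x + h by lra.
    rewrite /diff_quot normrM normfV (gtr0_norm h0) ler_pdivrMr//.
    by apply: le_trans (dist _ _ hx) _; rewrite addrAC subrr add0r.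
  have H2 x : ~ (a - h <= x <= b) -> diff_quot h F x = 0.
    move=> nx; rewrite /diff_quot zero_int ?mul0r//; first lra.
    by move=> y xy ay; apply: nx; lra.
  split; last by [].
  split.
    apply: continuous_measurable_fun => x; apply: cvgM; last exact: cvg_cst.
    apply: cvgB; last exact: cF.
    apply: (@continuous_comp _ _ _ (fun y : R => y + h) F); last exact: cF.
    by apply: cvgD; [exact: cvg_id|exact: cvg_cst].
  by exists (a - h), b, M; split => //; lra.
(* Steps of size at most a / 2 keep all supports in the fixed segment [a / 2, b], where (2 M)^2
   dominates the squared errors. *)
pose hn n : R := a / 2 / n.+1%:R.
have hn0 n : 0 < hn n by rewrite /hn !divr_gt0.
have hna n : hn n <= a / 2.
  by rewrite /hn ler_pdivrMr// ler_peMr ?ler1n//; lra.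
have hna' n : hn n < a by have := hna n; lra.
have sf := bounded_supp_sq bf.
have sg n := bounded_supp_sq (bh _ (hn0 n) (hna' n)).1.
have [||n Hn] := @dominated_small Ip (fun n x => (f x - diff_quot (hn n) F x) ^+ 2)
   (fun x => (2 * M) ^+ 2 * \1_(`[a / 2, b]%classic) x) eps
   mI (fun n => measurable_funX 2 (sq_integrableB mI sf (sg n)).1)
   (indicator_itv_integrable _ _ _) _ _ e0.
- apply: (filterS (F := almost_everywhere mu)) (primitive_ae Ff) => x dF _.
  have cvh : hn n @[n --> \oo] --> (0 : R)^'.
    have c0 : hn n @[n --> \oo] --> (0 : R).
      rewrite -(mulr0 (a / 2)); apply: cvgM; first exact: cvg_cst.
      exact: cvg_harmonic.
    move=> A; rewrite /dnbhs /= => A0; have [N _ HN] := c0 _ A0.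
    by exists N => // n Nn; apply: (HN n Nn); rewrite gt_eqF.
  have [/cvg_ex[l Hl] fl] := dF.
  have lE : l = f x by rewrite -fl; apply/esym/cvg_lim.
  have {}Hl := cvg_comp _ _ cvh Hl; rewrite lE in Hl.
  have : diff_quot (hn n) F x @[n --> \oo] --> f x.
    apply: cvg_trans Hl; apply: near_eq_cvg; near=> n.
    by rewrite /= /diff_quot /GRing.scale/= mulr1 mulrC (addrC x).
  move=> H; rewrite (_ : 0 = (f x - f x) * (f x - f x)); last by rewrite subrr mulr0.
  under eq_fun do rewrite expr2.
  by apply: cvgM; apply: cvgB => //; exact: cvg_cst.
- move=> n x _; rewrite sqr_ge0/= indic_itvE.
  have [_ [H1 H2]] := bh _ (hn0 n) (hna' n).
  case: ifPn => [_|/negP nx].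
    rewrite mulr1 -(real_normK (num_real (f x - _))) lerXn2r ?nnegrE ?mulr_ge0//.
    apply: le_trans (ler_normB _ _) _; have := fM x; have := H1 x; lra.
  rewrite f0; last by move=> ?; apply: nx; lra.
  rewrite H2; last by move=> ?; apply: nx; have := hna n; lra.
  by rewrite subrr expr0n mulr0.
by exists (hn n); split => //; have [] := bh _ (hn0 n) (hna' n).
Unshelve. all: by end_near. Qed.

Lemma diff_quot_continuous h f : continuous f -> continuous (diff_quot h f).
Proof.
move=> cf x; apply: cvgM; last exact: cvg_cst.
apply: cvgB; last exact: cf.
apply: (@continuous_comp _ _ _ (fun y : R => y + h) f); last exact: cf.
by apply: cvgD; [exact: cvg_id|exact: cvg_cst].
Qed.

Lemma primitive_diff_quot h F f : primitive F f -> continuous f ->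
  primitive (diff_quot h F) (diff_quot h f).
Proof.
move=> Ff cf; apply: primitiveC1; last exact: diff_quot_continuous.
move=> x; have dF (y : R) : is_derive y 1 F (f y) by apply: primitive_derive Ff _; exact: cf.
have ds : is_derive x 1 (fun y => F (y + h)) (f (x + h) * 1).
  apply: is_derive1_compose.
  have d : is_derive x 1 ((@id R) + cst h) (1 + 0) by exact: is_deriveD.
  by move: d; rewrite addr0.
have d := is_deriveZ h^-1 (is_deriveB ds (dF x)).
rewrite (_ : diff_quot h F = h^-1 \*: ((fun y => F (y + h)) - F)); last first.
  by apply/funext => y; rewrite /diff_quot /GRing.scale/= mulrC.
rewrite (_ : diff_quot h f x = h^-1 *: (f (x + h) * 1 - f x)) //.
by rewrite /diff_quot /GRing.scale/= mulr1 mulrC.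
Qed.

Lemma continuous_supp_sq U a b : 0 < a -> continuous (U 0%N) ->
  (forall x, ~ (a <= x <= b) -> U 0%N x = 0) -> sq_integrable Ip (U 0%N).
Proof.
move=> a0 cU U0; split.
  by apply: measurable_funTS; exact: continuous_measurable_fun.
apply: (@integrable_supp _ Ip `[a, b]%classic) => //.
- exact: measurable_plus.
- by move=> x /=; rewrite in_itv/= plusE => /andP[]; lra.
- by move=> x _; rewrite /= in_itv/= => nx; rewrite U0// expr0n.
apply: continuous_loc_integrable.
rewrite (_ : (fun x => U 0%N x ^+ 2) = fun x => U 0%N x * U 0%N x).
  by move=> x; apply: cvgM; exact: cU.
by apply/funext => x; rewrite expr2.
Qed.

Lemma dense_plus f eps : sq_integrable Ip f -> 0 < eps ->
  exists V, [/\ sobolev_rep Ip 3 (V 0%N) V, V 0%N 0 = 0, V 1%N 0 = 0, V 2%N 0 = 0 &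
    \int[mu]_(x in Ip) ((f x - V 0%N x) ^+ 2) < eps].
Proof.
move=> f2 e0; have mI := @measurable_plus R.
(* Each use of [sq_dist_triangle] splits a tolerance into two quarters, one for the current
   approximation and one for the rest of the chain; the last splitting uses e4 twice. Four means are
   taken: the first makes the function continuous, and each of the next three gains a derivative. *)
pose e1 := eps / 4; pose e2 := e1 / 4; pose e3 := e2 / 4; pose e4 := e3 / 4.
have e10 : 0 < e1 by rewrite /e1; lra.
have e20 : 0 < e2 by rewrite /e2; lra.
have e30 : 0 < e3 by rewrite /e3; lra.
have e40 : 0 < e4 by rewrite /e4; lra.
have [f0 bf0 H0] := truncation f2 e10.
have [F0 P0] := primitive_exists (bounded_supp_loc bf0).
have [h1 [h10 bf1 H1]] := steklov_step bf0 P0 e20.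
set f1 := diff_quot h1 F0 in bf1 H1.
have cf1 : continuous f1 by exact/diff_quot_continuous/primitive_continuous/P0.
have [F1 P1] := primitive_exists (continuous_loc_integrable cf1).
have [h2 [h20 bf2 H2]] := steklov_step bf1 P1 e30.
set f2' := diff_quot h2 F1 in bf2 H2.
have cf2 : continuous f2' by exact/diff_quot_continuous/primitive_continuous/P1.
have [F2 P2] := primitive_exists (continuous_loc_integrable cf2).
have [h3 [h30 bf3 H3]] := steklov_step bf2 P2 e40.
set f3 := diff_quot h3 F2 in bf3 H3.
have cf3 : continuous f3 by exact/diff_quot_continuous/primitive_continuous/P2.
have [F3 P3] := primitive_exists (continuous_loc_integrable cf3).
have [h4 [h40 bf4 H4]] := steklov_step bf3 P3 e40.
set f4 := diff_quot h4 F3 in bf4 H4.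
pose V (j : nat) : R -> R := match j with
  | 0 => f4 | 1 => diff_quot h4 f3
  | 2 => diff_quot h4 (diff_quot h3 f2')
  | _ => diff_quot h4 (diff_quot h3 (diff_quot h2 f1)) end.
have q0 : primitive (V 0%N) (V 1%N) by exact: primitive_diff_quot.
have q1 : primitive (V 1%N) (V 2%N).
  by apply: primitive_diff_quot; [exact: primitive_diff_quot|exact: diff_quot_continuous].
have q2 : primitive (V 2%N) (V 3%N).
  apply: primitive_diff_quot; last by apply: diff_quot_continuous; exact: diff_quot_continuous.
  by apply: primitive_diff_quot; [exact: primitive_diff_quot|exact: diff_quot_continuous].
have cV j : continuous (V j).
  case: j => [|[|[|j]]]; [exact: primitive_continuous q0|exact: primitive_continuous q1
    |exact: primitive_continuous q2
    |by apply: diff_quot_continuous; apply: diff_quot_continuous; exact: diff_quot_continuous].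
have [_ [a [b [M [a0 _ z0]]]]] := bf4.
have dz F G : primitive F G -> continuous G -> (forall x, ~ (a <= x <= b) -> F x = 0) ->
    forall x, ~ (a <= x <= b) -> G x = 0.
  move=> FG cG F0' x nx; rewrite -(derive1_out F0' nx) derive1E.
  by have [_ ->] : is_derive x 1 F (G x) by apply: primitive_derive FG _; exact: cG.
have z1 := dz _ _ q0 (cV 1%N) z0.
have z2 := dz _ _ q1 (cV 2%N) z1.
have z3 := dz _ _ q2 (cV 3%N) z2.
have n0 : ~ (a <= 0 <= b) by lra.
have sV j : sq_integrable Ip (V j).
  case: j => [|[|[|j]]].
  - exact: (@continuous_supp_sq (fun=> V 0%N) a b).
  - exact: (@continuous_supp_sq (fun=> V 1%N) a b).
  - exact: (@continuous_supp_sq (fun=> V 2%N) a b).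
  - exact: (@continuous_supp_sq (fun=> V 3%N) a b a0 (cV 3%N)).
exists V; split; [split => //|exact: z0|exact: z1|exact: z2|].
- by case=> [|[|[|]]].
- exact: aeW.
have s0 := bounded_supp_sq bf0; have s1 := bounded_supp_sq bf1.
have s2 := bounded_supp_sq bf2; have s3 := bounded_supp_sq bf3.
have s4 := bounded_supp_sq bf4.
apply: (sq_dist_triangle mI f2 s0 s4 H0).
apply: (sq_dist_triangle mI s0 s1 s4 H1).
apply: (sq_dist_triangle mI s1 s2 s4 H2).
exact: (sq_dist_triangle mI s2 s3 s4 H3 H4).
Qed.

Lemma dense_minus f eps : sq_integrable Im f -> 0 < eps ->
  exists V, [/\ sobolev_rep Im 3 (V 0%N) V, V 0%N 0 = 0, V 1%N 0 = 0, V 2%N 0 = 0 &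
    \int[mu]_(x in Im) ((f x - V 0%N x) ^+ 2) < eps].
Proof.
move=> f2 e0; have mIm := @measurable_minus R; have mIp := @measurable_plus R.
have f2' : sq_integrable Ip (fun x => f (- x)).
  by rewrite -preimage_opp_minus; exact: sq_integrable_opp.
have [V [rV V0 V1 V2 HV]] := dense_plus f2' e0.
have rV' : sobolev_rep Im 3 (reflect_rep V 0%N) (reflect_rep V).
  have := sobolev_rep_reflect mIp rV; rewrite preimage_opp_plus.
  by congr sobolev_rep; apply/funext => x; rewrite /reflect_rep expr0 mul1r.
exists (reflect_rep V); split => //; rewrite ?/reflect_rep ?oppr0 ?V0 ?V1 ?V2 ?mulr0//.
have [_ _ /(_ 0%N isT) sV] := rV'.
have [_ i] := sq_integrableB mIm f2 sV.
have := reflect_Rintegral i => /= <-.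
apply: le_lt_trans HV; rewrite le_eqVlt; apply/orP; left; apply/eqP.
by apply: eq_Rintegral => x _; rewrite /reflect_rep expr0 mul1r opprK.
Qed.

End Density.

(** * The complex operator *)

Section ComplexPairs.
Variable R : realType.
Local Notation mu := (@lebesgue_measure R).
Local Notation Im := (@Iminus R).
Local Notation Ip := (@Iplus R).
Local Notation rpair := ((R -> R) * (R -> R))%type.
Implicit Types (u v w f g : fpair R) (p q : rpair) (a b : nat -> R[i]).

Definition re_pair u : rpair := (re u.1, re u.2).
Definition im_pair u : rpair := (im u.1, im u.2).

Definition cpair p q : fpair R := (cfun p.1 q.1, cfun p.2 q.2).

Definition sq_pair p := sq_integrable Im p.1 /\ sq_integrable Ip p.2.

Lemma re_pairK p q : re_pair (cpair p q) = p.
Proof. by case: p. Qed.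

Lemma im_pairK p q : im_pair (cpair p q) = q.
Proof. by case: q. Qed.

Lemma complexP (x y : R[i]) : x = y <->
  complex.Re x = complex.Re y /\ complex.Im x = complex.Im y.
Proof. by split=> [->//|]; case: x; case: y => a b c d /= [-> ->]. Qed.

Lemma ReD (x y : R[i]) : complex.Re (x + y) = complex.Re x + complex.Re y.
Proof. by case: x; case: y. Qed.

Lemma ImD (x y : R[i]) : complex.Im (x + y) = complex.Im x + complex.Im y.
Proof. by case: x; case: y. Qed.

Lemma ReB (x y : R[i]) : complex.Re (x - y) = complex.Re x - complex.Re y.
Proof. by case: x; case: y. Qed.

Lemma ImB (x y : R[i]) : complex.Im (x - y) = complex.Im x - complex.Im y.
Proof. by case: x; case: y. Qed.

Lemma ReN (x : R[i]) : complex.Re (- x) = - complex.Re x.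
Proof. by case: x. Qed.

Lemma ImN (x : R[i]) : complex.Im (- x) = - complex.Im x.
Proof. by case: x. Qed.

Lemma ReZ (x : R) (y : R[i]) : complex.Re (x%:C * y) = x * complex.Re y.
Proof. by rewrite ReM /= mul0r subr0. Qed.

Lemma ImZ (x : R) (y : R[i]) : complex.Im (x%:C * y) = x * complex.Im y.
Proof. by rewrite ImM /= mul0r addr0. Qed.

Lemma L2pairP u : L2pair u <-> sq_pair (re_pair u) /\ sq_pair (im_pair u).
Proof.
have mm := @measurable_minus R; have mp := @measurable_plus R.
split=> [[/(L2P _ mm)[? ?] /(L2P _ mp)[? ?]]|[[? ?] [? ?]]]; first by [].
by split; apply/L2P.
Qed.

Lemma trace_minusE u U V j : L2 Im u.1 -> sobolev_rep Im 3 (re u.1) U ->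
  sobolev_rep Im 3 (im u.1) V -> (j < 3)%N -> trace_minus j u = U j 0 +i* V j 0.
Proof.
move=> u2 rU iV j3; have oI := open_interval_minus R.
have [_ uUV] := wderiv_rep oI u2 rU iV (ltnW j3).
apply: boundary_valueE uUV.
- by case: oI.
- by near=> x; rewrite minusE.
- exact: cvg_within.
- exact: sobolev_rep_continuous rU j3.
- exact: sobolev_rep_continuous iV j3.
Unshelve. all: by end_near. Qed.

Lemma trace_plusE u U V j : L2 Ip u.2 -> sobolev_rep Ip 3 (re u.2) U ->
  sobolev_rep Ip 3 (im u.2) V -> (j < 3)%N -> trace_plus j u = U j 0 +i* V j 0.
Proof.
move=> u2 rU iV j3; have oI := open_interval_plus R.
have [_ uUV] := wderiv_rep oI u2 rU iV (ltnW j3).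
apply: boundary_valueE uUV.
- by case: oI.
- by near=> x; rewrite plusE.
- exact: cvg_within.
- exact: sobolev_rep_continuous rU j3.
- exact: sobolev_rep_continuous iV j3.
Unshelve. all: by end_near. Qed.

Lemma LZ_col Z a b :
  LZ Z *m (\col_(j < 3) a j) = \col_(j < 3) b j <->
  [/\ a 0%N = b 0%N, b 1%N - a 1%N = Z%:C * a 0%N &
      (Z ^+ 2 / 2)%:C * a 0%N + Z%:C * a 1%N = b 2%N - a 2%N].
Proof.
pose c (i j : nat) : R :=
  nth 0 (nth [::] [:: [:: 1; 0; 0]; [:: Z; 1; 0]; [:: Z ^+ 2 / 2; Z; 1]] i) j.
have row (i : 'I_3) : (LZ Z *m (\col_(j < 3) a j)) i ord0 =
    (c i 0%N)%:C * a 0%N + (c i 1%N)%:C * a 1%N + (c i 2%N)%:C * a 2%N.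
  by rewrite !mxE !big_ord_recr big_ord0 /= add0r !mxE.
split=> [/colP E|[E0 E1 E2]].
  have := E (Ordinal (isT : 0 < 3)%N); have := E (Ordinal (isT : 1 < 3)%N).
  have := E (Ordinal (isT : 2 < 3)%N); rewrite !row !mxE /c /= ?mul1r ?mul0r ?addr0.
  move=> e2 e1 e0; split; first exact: e0.
    by rewrite -e1; ring.
  by rewrite -e2; ring.
apply/colP => -[[|[|[|]]]// i]; rewrite row !mxE /c /= ?mul1r ?mul0r ?addr0.
- by [].
- by rewrite -E1 subrK.
- by rewrite E2 subrK.
Qed.

Lemma sq_integrable_glue (g h : R -> R) : sq_integrable Im g -> sq_integrable Ip h ->
  sq_integrable setT (fun x => if x < 0 then g x else h x).
Proof.
move=> g2 h2; have mm := @measurable_minus R; have mp := @measurable_plus R.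
have mT : measurable [set: R] by [].
have sum2 := sq_integrableD mT (sq_integrable_restrict mm g2) (sq_integrable_restrict mp h2).
apply: ae_eq_sq_integrable sum2 => //.
  have -> : [set: R] = Im `|` ([set 0] `|` Ip).
    apply/seteqP; split => // x _ /=; rewrite minusE plusE.
    by case: (ltgtP x 0) => [| |->]; [left|right; right|right; left].
  apply/measurable_funU => //; first exact: measurableU.
  split.
    apply: eq_measurable_fun g2.1 => x /set_mem; rewrite minusE => x0.
    by rewrite x0.
  apply/measurable_funU => //; split; first exact: measurable_fun_set1.
  apply: eq_measurable_fun h2.1 => x /set_mem; rewrite plusE => x0.
  by rewrite ltNge ltW.
exists [set 0]; split; [exact: measurable_set1|exact: lebesgue_measure_set1|].
move=> x /= H; apply: contrapT => /eqP x0; apply: H => _.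
have iE (I : set R) (k : R -> R) (b : bool) : (I x <-> b) -> (k \_ I) x = if b then k x else 0.
  by move=> Ib; rewrite patchE; case: ifPn => [/set_mem/Ib->//|/negP xI];
    case: b Ib xI => // Ib [];
    apply/mem_set/Ib.
rewrite (iE _ _ (x < 0)) ?minusE// (iE _ _ (0 < x)) ?plusE//.
by move: x0; case: (ltgtP x 0) => // _ _; rewrite ?addr0 ?add0r.
Qed.

(** Equality of the values at 0 lets the two primitives be joined; the first derivatives may jump
    there, whence the order 1. *)
Lemma sobolev_rep_glue (g h : R -> R) (U V : nat -> R -> R) :
  sobolev_rep Im 3 g U -> sobolev_rep Ip 3 h V -> V 0%N 0 = U 0%N 0 ->
  sobolev_rep setT 1 (fun x => if x < 0 then g x else h x)
    (fun j x => if x < 0 then U j x else V j x).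
Proof.
move=> [pU gU U2] [pV hV V2] UV0; split => [[|]// _||j j1].
- by apply: primitive_glue; [exact: pU|exact: pV|].
- have n0 : \forall x \ae mu, x != 0.
    exists [set 0]; split; [exact: measurable_set1|exact: lebesgue_measure_set1|].
    by move=> x /= /negP/negPn/eqP.
  apply: (filterS3 (F := almost_everywhere mu)) gU hV n0 => x gU hV x0 _.
  move: gU hV; rewrite minusE plusE => gU hV; case: ifPn => [/gU//|].
  by rewrite -leNgt le_eqVlt eq_sym (negPf x0)/= => /hV.
- by apply: sq_integrable_glue; [apply: U2|apply: V2]; apply: leq_trans j1 _.
Qed.

Lemma inner_split u v : L2pair u -> L2pair v ->
  inner u v = (real_inner (re_pair u) (re_pair v) + real_inner (im_pair u) (im_pair v))
   +i* (real_inner (im_pair u) (re_pair v) - real_inner (re_pair u) (im_pair v)).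
Proof.
move=> /L2pairP[[ur1 ur2] [ui1 ui2]] /L2pairP[[vr1 vr2] [vi1 vi2]].
have mm := @measurable_minus R; have mp := @measurable_plus R.
have half (I : set R) (h k : R -> R[i]) : measurable I -> sq_integrable I (re h) ->
    sq_integrable I (im h) -> sq_integrable I (re k) -> sq_integrable I (im k) ->
    cintegral I (fun x => h x * (k x)^*) =
    (\int[mu]_(x in I) (re h x * re k x) + \int[mu]_(x in I) (im h x * im k x))
    +i* (\int[mu]_(x in I) (im h x * re k x) - \int[mu]_(x in I) (re h x * im k x)).
  move=> mI hr hi kr ki; pose k' := cfun (re k) (fun x => - im k x).
  have -> : (fun x => h x * (k x)^*) = (fun x => h x * k' x).
    by apply/funext => x; rewrite /k' /cfun /re /im; case: (k x).
  have nki := sq_integrableN mI ki.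
  rewrite cintegralM//; try exact: sq_integrableM.
  rewrite /k' /re /im /= -/(re h) -/(im h) -/(re k) -/(im k).
  have e1 := sq_inner_neg mI hr ki; have e2 := sq_inner_neg mI hi ki.
  rewrite /re /im in e1 e2; rewrite e1 e2 opprK.
  by congr (_ +i* _); rewrite addrC.
rewrite /inner (half _ _ _ mm)// (half _ _ _ mp)// /real_inner /=.
apply/complexP; rewrite ReD ImD /=; split; first by rewrite addrACA.
by rewrite opprD addrACA.
Qed.

End ComplexPairs.

(** * Reduction of the complex operator to the real one, and its skew-self-adjointness *)

Section ComplexOperator.
Variable R : realType.
Local Notation mu := (@lebesgue_measure R).
Local Notation Im := (@Iminus R).
Local Notation Ip := (@Iplus R).
Local Notation rpair := ((R -> R) * (R -> R))%type.
Variables (am ap bm bp Z : R).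
Implicit Types (u v w f g : fpair R) (p q : rpair).
Local Notation graph := (real_graph am ap bm bp Z).

Lemma AZ_domainE u :
  domAZ Z u <-> [/\ H3pair u, trace_minus 0 u = trace_plus 0 u,
          trace_plus 1 u - trace_minus 1 u = Z%:C * trace_minus 0 u &
          (Z ^+ 2 / 2)%:C * trace_minus 0 u + Z%:C * trace_minus 1 u
            = trace_plus 2 u - trace_minus 2 u].
Proof.
have H := LZ_col Z (fun j => trace_minus j u) (fun j => trace_plus j u).
by split=> [[? /H[]]|[? ? ? ?]]; [|split => //; exact/H].
Qed.

Lemma third_order_expr_rep u U U' V V' : L2pair u ->
  sobolev_rep Im 3 (re u.1) U -> sobolev_rep Im 3 (im u.1) U' ->
  sobolev_rep Ip 3 (re u.2) V -> sobolev_rep Ip 3 (im u.2) V' ->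
  aeqpair (third_order_expr am ap bm bp (wderiv Im) (wderiv Ip) u)
   (cpair (fun x => am * U 3%N x + bm * U 1%N x, fun x => ap * V 3%N x + bp * V 1%N x)
     (fun x => am * U' 3%N x + bm * U' 1%N x, fun x => ap * V' 3%N x + bp * V' 1%N x)).
Proof.
move=> [um up] rU rU' rV rV'.
have half (I : set R) (al be : R) (h : R -> R[i]) (W W' : nat -> R -> R) :
    open_interval I -> L2 I h ->
    sobolev_rep I 3 (re h) W -> sobolev_rep I 3 (im h) W' ->
    aeq I (fun x => al%:C * wderiv I 3 h x + be%:C * wderiv I 1 h x)
      (cfun (fun x => al * W 3%N x + be * W 1%N x) (fun x => al * W' 3%N x + be * W' 1%N x)).
  move=> oI h2 rW rW'.
  have [_ e3] := wderiv_rep oI h2 rW rW' (leqnn 3).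
  have [_ e1] := wderiv_rep oI h2 rW rW' (isT : 1 <= 3)%N.
  apply: (filterS2 (F := almost_everywhere mu)) e3 e1 => x e3 e1 Ix.
  rewrite e3// e1//; apply/complexP; rewrite /cfun ReD ImD !ReZ !ImZ.
  by [].
by split; apply: half => //; [exact: open_interval_minus|exact: open_interval_plus].
Qed.

(** The coefficients and the matrix L_Z are real, so the complex operator is two copies of the real
    one, acting on real and imaginary parts. *)
Lemma AZP u f : AZ am ap bm bp Z u f <->
  graph (re_pair u) (re_pair f) /\ graph (im_pair u) (im_pair f).
Proof.
have om := open_interval_minus R; have op := open_interval_plus R.
have mat U V U' V' :
  [/\ U 0%N 0 +i* U' 0%N 0 = V 0%N 0 +i* V' 0%N 0,
    (V 1%N 0 +i* V' 1%N 0) - (U 1%N 0 +i* U' 1%N 0) = Z%:C * (U 0%N 0 +i* U' 0%N 0) &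
    (Z ^+ 2 / 2)%:C * (U 0%N 0 +i* U' 0%N 0) + Z%:C * (U 1%N 0 +i* U' 1%N 0) =
      (V 2%N 0 +i* V' 2%N 0) - (U 2%N 0 +i* U' 2%N 0)] <->
  traces_match Z U V /\ traces_match Z U' V'.
  split=> [[/complexP[/= a0 b0] /complexP[]]|[[a0 a1 a2] [b0 b1 b2]]].
    rewrite ReB ImB ReZ ImZ /= => a1 b1 /complexP[].
    rewrite ReB ImB ReD ImD !ReZ !ImZ /= => a2 b2.
    by split; split; lra.
  by split; apply/complexP; rewrite ?ReB ?ImB ?ReD ?ImD ?ReZ ?ImZ ?ReZ ?ImZ /=; split; lra.
split=> [[/AZ_domainE[[/(sobolevP _ _ om)[um [U [U' [rU rU']]]]
    /(sobolevP _ _ op)[up [V [V' [rV rV']]]]] t0 t1 t2]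
    /L2pairP[fr fi] [fm fp]]|[[U [V [[urm urp] [frm frp] [rU rV] tUV [eU eV]]]]
      [U' [V' [[uim uip] [fim fip] [rU' rV'] tUV' [eU' eV']]]]]].
  have u2 : L2pair u by [].
  have /L2pairP[ur ui] := u2.
  move: t0 t1 t2; rewrite !(trace_minusE um rU rU')// !(trace_plusE up rV rV')//.
  move=> t0 t1 t2; have /mat[tr ti] := And3 t0 t1 t2.
  have [em ep] := third_order_expr_rep u2 rU rU' rV rV'.
  have /aeqP[frm fim] := fm; have /aeqP[frp fip] := fp.
  have /aeqP[erm eim] := em; have /aeqP[erp eip] := ep.
  split; [exists U, V|exists U', V']; split => //; split.
  - exact: ae_eq_trans frm erm.
  - exact: ae_eq_trans frp erp.
  - exact: ae_eq_trans fim eim.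
  - exact: ae_eq_trans fip eip.
have u2 : L2pair u by apply/L2pairP.
have [um up] := u2.
split.
- apply/AZ_domainE; rewrite !(trace_minusE um rU rU')// !(trace_plusE up rV rV')//.
  have [? ? ?] := (mat U V U' V').2 (conj tUV tUV'); split => //; split.
    by apply/sobolevP => //; split => //; exists U, U'.
  by apply/sobolevP => //; split => //; exists V, V'.
- exact/L2pairP.
- have [/aeqP[erm eim] /aeqP[erp eip]] := third_order_expr_rep u2 rU rU' rV rV'.
  split; apply/aeqP; split.
  + exact: ae_eq_trans eU (ae_eq_sym erm).
  + exact: ae_eq_trans eU' (ae_eq_sym eim).
  + exact: ae_eq_trans eV (ae_eq_sym erp).
  + exact: ae_eq_trans eV' (ae_eq_sym eip).
Qed.

Lemma domain_AZ : domain (AZ am ap bm bp Z) = domAZ Z.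
Proof.
apply/seteqP; split=> u; first by case=> f [].
move=> du; have [[sm sp] _] := du.
have mm := @measurable_minus R; have mp := @measurable_plus R.
have /(sobolevP _ _ (open_interval_minus R))[um [U [U' [rU rU']]]] := sm.
have /(sobolevP _ _ (open_interval_plus R))[up [V [V' [rV rV']]]] := sp.
have [em ep] := third_order_expr_rep (conj um up) rU rU' rV rV'.
exists (cpair (fun x => am * U 3%N x + bm * U 1%N x, fun x => ap * V 3%N x + bp * V 1%N x)
     (fun x => am * U' 3%N x + bm * U' 1%N x, fun x => ap * V' 3%N x + bp * V' 1%N x)).
split => //.
  apply/L2pairP; rewrite re_pairK im_pairK; split; split => /=;
    [exact: (rep_combination _ _ mm rU)|exact: (rep_combination _ _ mp rV)|
     exact: (rep_combination _ _ mm rU')|exact: (rep_combination _ _ mp rV')].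
split.
- by apply: (filterS (F := almost_everywhere mu)) em => x H Ix; rewrite H.
- by apply: (filterS (F := almost_everywhere mu)) ep => x H Ix; rewrite H.
Qed.

Lemma zero_graph : graph (fun=> 0, fun=> 0) (fun=> 0, fun=> 0).
Proof.
have rm := zero_rep 3 (@measurable_minus R); have rp := zero_rep 3 (@measurable_plus R).
have [_ _ /(_ 0%N isT) sm] := rm; have [_ _ /(_ 0%N isT) sp] := rp.
exists (fun _ _ => 0), (fun _ _ => 0); split => //.
- by split; rewrite ?mulr0 ?addr0.
- by split; apply: aeW => x _; rewrite !mulr0 addr0.
Qed.

(** A test function on an open half-line vanishes at 0 with all its derivatives, so that the
    transmission conditions reduce to 0 = 0. *)
Lemma extends_A0 : extends (AZ am ap bm bp Z) (A0 am ap bm bp).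
Proof.
have om := open_interval_minus R; have op := open_interval_plus R.
move=> u f [/L2pairP[ur ui] /L2pairP[fr fi] [phi [tm tp [um up] [fm fp]]]].
have /(test_functionP _ om)[trm tim] := tm; have /(test_functionP _ op)[trp tip] := tp.
have /aeqP[urm uim] := um; have /aeqP[urp uip] := up.
have /aeqP[frm fim] := fm; have /aeqP[frp fip] := fp.
have nm0 : ~ Im 0 by rewrite minusE ltxx.
have np0 : ~ Ip 0 by rewrite plusE ltxx.
have rep (I : set R) (g p : R -> R) : open_interval I -> test_on I p -> g = p %[ae mu in I] ->
    sobolev_rep I 3 g (fun j => derive1n j p).
  by move=> oI t gp; have [H1 _ H3] := test_rep 3 oI t; split.
have tr0 (h k : R -> R) : test_on Im h -> test_on Ip k ->
    traces_match Z (fun j => derive1n j h) (fun j => derive1n j k).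
  move=> th tk; split; rewrite !(test_on_out om (test_on_deriven _ th) nm0);
    by rewrite !(test_on_out op (test_on_deriven _ tk) np0) ?mulr0 ?addr0.
have reE (al be : R) (h : R -> R[i]) : re (fun x => al%:C * cderiv 3 h x + be%:C * cderiv 1 h x) =
   fun x => al * derive1n 3 (re h) x + be * derive1n 1 (re h) x.
  by apply/funext => x; rewrite {1}/re ReD !ReZ.
have imE (al be : R) (h : R -> R[i]) : im (fun x => al%:C * cderiv 3 h x + be%:C * cderiv 1 h x) =
   fun x => al * derive1n 3 (im h) x + be * derive1n 1 (im h) x.
  by apply/funext => x; rewrite {1}/im ImD !ImZ.
rewrite /third_order_expr /= !reE in frm frp; rewrite /third_order_expr /= !imE in fim fip.
apply/AZP; split.
- exists (fun j => derive1n j (re phi.1)), (fun j => derive1n j (re phi.2)); split => //.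
  + by split; exact: rep.
  + exact: tr0.
- exists (fun j => derive1n j (im phi.1)), (fun j => derive1n j (im phi.2)); split => //.
  + by split; exact: rep.
  + exact: tr0.
Qed.

Lemma domain_H1 u : domain (AZ am ap bm bp Z) u -> sobolev setT 1 (join_halves u).
Proof.
move=> [f /AZP[[U [V [ur _ [rU rV] [t0 _ _] _]]] [U' [V' [ui _ [rU' rV'] [t0' _ _] _]]]]].
have mT : measurable [set: R] by [].
have rr := sobolev_rep_glue rU rV t0; have ri := sobolev_rep_glue rU' rV' t0'.
have joinr : re (join_halves u) = (fun x => if x < 0 then re u.1 x else re u.2 x).
  by apply/funext => x; rewrite /join_halves /re; case: ifP.
have joini : im (join_halves u) = (fun x => if x < 0 then im u.1 x else im u.2 x).
  by apply/funext => x; rewrite /join_halves /im; case: ifP.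
apply/(sobolevP _ _ (open_interval_setT R)); split.
  have [ur1 ur2] := ur; have [ui1 ui2] := ui.
  by apply/(L2P _ mT); rewrite joinr joini; split; exact: sq_integrable_glue.
exists (fun j x => if x < 0 then U j x else V j x), (fun j x => if x < 0 then U' j x else V' j x).
by rewrite joinr joini.
Qed.

Lemma real_inner0 p : real_inner (fun=> 0, fun=> 0) p = 0.
Proof.
rewrite /real_inner /=; under eq_Rintegral do rewrite mul0r.
under [X in _ + X]eq_Rintegral do rewrite mul0r.
by rewrite /Rintegral !integral0 addr0.
Qed.

Lemma real_graph_sq p q : graph p q -> sq_pair p /\ sq_pair q.
Proof. by move=> [U [V []]]. Qed.

Lemma sq_pairN p : sq_pair (real_neg p) -> sq_pair p.
Proof.
have mm := @measurable_minus R; have mp := @measurable_plus R.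
move=> [n1 n2]; split; [have := sq_integrableN mm n1|have := sq_integrableN mp n2];
  by under eq_fun do rewrite opprK.
Qed.

Lemma re_pairN w : re_pair (- w) = real_neg (re_pair w).
Proof.
by congr pair; apply/funext => x; exact: ReN.
Qed.

Lemma im_pairN w : im_pair (- w) = real_neg (im_pair w).
Proof.
by congr pair; apply/funext => x; exact: ImN.
Qed.

Lemma AZ_real p q : graph p q ->
  AZ am ap bm bp Z (cpair p (fun=> 0, fun=> 0)) (cpair q (fun=> 0, fun=> 0)).
Proof. by move=> pq; apply/AZP; rewrite !re_pairK !im_pairK; split => //; exact: zero_graph. Qed.

Lemma L2pair_AZ u f : AZ am ap bm bp Z u f -> L2pair u /\ L2pair f.
Proof.
by move=> /AZP[/real_graph_sq[? ?] /real_graph_sq[? ?]]; split; exact/L2pairP.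
Qed.

(** Testing with real pairs, which belong to the graph by [AZ_real], separates the adjoint relation
    into its real and imaginary parts; the converse is bilinearity. *)
Lemma adjoint_AZP v w : adjoint (AZ am ap bm bp Z) v w <->
  [/\ L2pair v, L2pair w,
    (forall p q, graph p q -> real_inner q (re_pair v) = real_inner p (re_pair w)) &
    (forall p q, graph p q -> real_inner q (im_pair v) = real_inner p (im_pair w))].
Proof.
split=> [[v2 w2 H]|[v2 w2 Hr Hi]].
  have E p q : graph p q -> real_inner q (re_pair v) = real_inner p (re_pair w) /\
      real_inner q (im_pair v) = real_inner p (im_pair w).
    move=> pq; have pq' := AZ_real pq; have [p2 q2] := L2pair_AZ pq'.
    have := H _ _ pq'; rewrite !inner_split// !re_pairK !im_pairK !real_inner0.
    by rewrite !addr0 !add0r => -[-> /oppr_inj ->].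
  by split => // p q /E[].
split => // u f uf; have [u2 f2] := L2pair_AZ uf.
by have /AZP[ur ui] := uf; rewrite !inner_split// (Hr _ _ ur) (Hr _ _ ui) (Hi _ _ ur) (Hi _ _ ui).
Qed.

Lemma AZ_dense : densely_defined (AZ am ap bm bp Z).
Proof.
have mm := @measurable_minus R; have mp := @measurable_plus R.
move=> u u2 e e0; have /L2pairP[[ur1 ur2] [ui1 ui2]] := u2.
(* The squared distance is a sum of four integrals: two half-lines, each with a real and an
   imaginary part. The approximants have zero traces and thus satisfy the transmission
   conditions. *)
have d0 : 0 < e ^+ 2 / 4 by rewrite divr_gt0// exprn_gt0.
have [U [rU U0 U1 U2 dU]] := dense_minus ur1 d0.
have [V [rV V0 V1 V2 dV]] := dense_plus ur2 d0.
have [U' [rU' U0' U1' U2' dU']] := dense_minus ui1 d0.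
have [V' [rV' V0' V1' V2' dV']] := dense_plus ui2 d0.
have gr (A B : nat -> R -> R) : sobolev_rep Im 3 (A 0%N) A -> sobolev_rep Ip 3 (B 0%N) B ->
    traces_match Z A B -> exists q, graph (A 0%N, B 0%N) q.
  move=> rA rB AB; have [_ _ /(_ 0%N isT) A2] := rA; have [_ _ /(_ 0%N isT) B2] := rB.
  exists (fun x => am * A 3%N x + bm * A 1%N x, fun x => ap * B 3%N x + bp * B 1%N x).
  exists A, B; split => //; last by split; exact: aeW.
  by split; [exact: (rep_combination _ _ mm rA)|exact: (rep_combination _ _ mp rB)].
have [q gq] : exists q, graph (U 0%N, V 0%N) q.
  by apply: gr => //; split; rewrite ?U0 ?U1 ?U2 ?V0 ?V1 ?V2; ring.
have [q' gq'] : exists q, graph (U' 0%N, V' 0%N) q.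
  by apply: gr => //; split; rewrite ?U0' ?U1' ?U2' ?V0' ?V1' ?V2'; ring.
pose v := cpair (U 0%N, V 0%N) (U' 0%N, V' 0%N).
have dv : AZ am ap bm bp Z v (cpair q q').
  by apply/AZP; rewrite !re_pairK !im_pairK.
exists v; first by exists (cpair q q').
have [v2 _] := L2pair_AZ dv.
have /L2pairP[[vr1 vr2] [vi1 vi2]] := v2.
have reB : re_pair (u - v) = (fun x => re u.1 x - U 0%N x, fun x => re u.2 x - V 0%N x).
  by congr pair; apply/funext => x; rewrite /re ReB.
have imB : im_pair (u - v) = (fun x => im u.1 x - U' 0%N x, fun x => im u.2 x - V' 0%N x).
  by congr pair; apply/funext => x; rewrite /im ImB.
have uv2 : L2pair (u - v).
  by apply/L2pairP; rewrite reB imB; split; split => /=; exact: sq_integrableB.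
rewrite /L2norm inner_split// reB imB /real_inner [complex.Re _]/=.
rewrite -[ltRHS](ger0_norm (ltW e0)) -sqrtr_sqr ltr_sqrt ?exprn_gt0//.
have alg (a b c d s : R) : a < s / 4 -> b < s / 4 -> c < s / 4 -> d < s / 4 ->
  a + b + (c + d) < s by lra.
exact: alg.
Qed.

Lemma AZ_skew : am != 0 ->
  skew_self_adjoint (AZ am ap bm bp Z) <-> am = ap /\ bm = bp.
Proof.
move=> am0; split=> [[_ H]|[aE bE]].
  apply: (@real_skew_necessary _ am ap bm bp Z) => v w vw u f uf.
  (* Real pairs are embedded with zero imaginary part; the hypothesis then yields the real adjoint
     relation as its real part. *)
  pose v' := cpair v (fun=> 0, fun=> 0); pose w' := cpair w (fun=> 0, fun=> 0).
  have /H/adjoint_AZP[_ _ + _] : opp_operator (AZ am ap bm bp Z) v' w'.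
    apply/AZP; rewrite re_pairN im_pairN !re_pairK !im_pairK; split => //.
    rewrite (_ : real_neg _ = (fun=> 0, fun=> 0)); first exact: zero_graph.
    by congr pair; apply/funext => x /=; rewrite oppr0.
  by rewrite !re_pairK; exact.
split=> [|v w]; first exact: AZ_dense.
rewrite /opp_operator AZP re_pairN im_pairN; split.
  move=> /adjoint_AZP[/L2pairP[[? ?] [? ?]] /L2pairP[[? ?] [? ?]] Hr Hi].
  by split; exact: real_adjoint_graph.
move=> [gr gi]; apply/adjoint_AZP.
have [vr2 wr2] := real_graph_sq gr; have [vi2 wi2] := real_graph_sq gi.
split.
- exact/L2pairP.
- by apply/L2pairP; split; exact: sq_pairN.
- by move=> p q; exact: real_graph_adjoint.
- by move=> p q; exact: real_graph_adjoint.
Qed.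

End ComplexOperator.

Theorem proposition2p3 (R : realType) (alpham alphap betam betap : R)
    (hm : 0 < alpham) (hp : 0 < alphap) (Z : R) (hZ : Z != 0) :
  [/\ domain (AZ alpham alphap betam betap Z) =
        [set u | [/\ H3pair u,
          trace_minus 0 u = trace_plus 0 u,
          trace_plus 1 u - trace_minus 1 u = Z%:C * trace_minus 0 u &
          (Z ^+ 2 / 2)%:C * trace_minus 0 u + Z%:C * trace_minus 1 u
            = trace_plus 2 u - trace_minus 2 u]],
      extends (AZ alpham alphap betam betap Z) (A0 alpham alphap betam betap),
      skew_self_adjoint (AZ alpham alphap betam betap Z) <->
        alpham = alphap /\ betam = betap &
      forall u : fpair R, domain (AZ alpham alphap betam betap Z) u ->
        sobolev setT 1 (join_halves u)].
Proof.
split.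
- by rewrite domain_AZ; apply/funext => u; apply/propext; exact: AZ_domainE.
- exact: extends_A0.
- by apply: AZ_skew; rewrite gt_eqF.
- exact: domain_H1.
Qed.
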